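(* Let $E$ be a quadratic extension of a non-Archimedean local field $F$ (of characteristic zero) and let $\widetilde{\mathrm{GL}_2(E)}$ be the two-fold metaplectic covering of $\mathrm{GL}_2(E)$. Then: (1) the two-fold metaplectic covering splits over the subgroup $\mathrm{GL}_2(F)$; (2) the $\mathbb C^\times$-covering obtained from $\widetilde{\mathrm{GL}_2(E)}$ splits over the subgroup $D_F^\times$.
   Context: Let $(\cdot,\cdot)$ denote the quadratic Hilbert symbol of $E$. For $g=\begin{pmatrix}a&b\\c&d\end{pmatrix}\in\mathrm{GL}_2(E)$ put $x(g)=c$ if $c\neq0$ and $x(g)=d$ if $c=0$. For $g_1,g_2\in\mathrm{SL}_2(E)$ put $\beta(g_1,g_2)=(x(g_1),x(g_2))\,(-x(g_1)^{-1}x(g_2),x(g_1g_2))$. For $g\in\mathrm{GL}_2(E)$ let $p(g)\in\mathrm{SL}_2(E)$ be defined by $g=\mathrm{diag}(1,\det g)\,p(g)$; for $y\in E^\times$ put $g^y=\mathrm{diag}(1,y^{-1})\,g\,\mathrm{diag}(1,y)$ and $v(y,g)=1$ if $c\neq0$, $v(y,g)=(y,d)$ if $c=0$. Extend $\beta$ by $\beta(g_1,g_2)=\beta(p(g_1)^{\det g_2},p(g_2))\,v(\det g_2,p(g_1))$. The metaplectic cover $\widetilde{\mathrm{GL}_2(E)}$ is $\mathrm{GL}_2(E)\times\{\pm1\}$ with $(g_1,\epsilon_1)(g_2,\epsilon_2)=(g_1g_2,\epsilon_1\epsilon_2\beta(g_1,g_2))$. The $\mathbb C^\times$-covering obtained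 from it is $(\widetilde{\mathrm{GL}_2(E)}\times\mathbb C^\times)/\langle((1,-1),-1)\rangle$, a central extension of $\mathrm{GL}_2(E)$ by $\mathbb C^\times$. $D_F$ is the unique quaternion division algebra with center $F$, and $D_F^\times\hookrightarrow\mathrm{GL}_2(E)$ via a fixed isomorphism $D_F\otimes_FE\cong M_2(E)$ (unique up to $\mathrm{GL}_2(E)$-conjugacy). *)

(* Defs.v *)
From HB Require Import structures.
From mathcomp Require Import all_boot all_order all_algebra all_field.
From mathcomp Require Import boolp.
From mathcomp Require Import reals.
From mathcomp Require Import complex.
Set Implicit Arguments. Unset Strict Implicit. Unset Printing Implicit Defensive.
Import Order.TTheory GRing.Theory Num.Theory.
Local Open Scope ring_scope.

(* A normalized discrete valuation v on F (v is only meaningful on F^x). *)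
Definition is_discrete_valuation (F : fieldType) (v : F -> int) : Prop :=
  [/\ (forall x y : F, x != 0 -> y != 0 -> v (x * y) = v x + v y),
      (forall x y : F, x != 0 -> y != 0 -> x + y != 0 ->
          Num.min (v x) (v y) <= v (x + y)) &
      (exists pi : F, pi != 0 /\ v pi = 1)].

Definition vclose (F : fieldType) (v : F -> int) (N : int) (x y : F) : Prop :=
  x - y = 0 \/ (x - y != 0 /\ N <= v (x - y)).

Definition vcomplete (F : fieldType) (v : F -> int) : Prop :=
  forall u : nat -> F,
    (forall N : int, exists n0, forall m n, (n0 <= m)%N -> (n0 <= n)%N ->
        vclose v N (u m) (u n)) ->
    exists l : F, forall N : int, exists n0, forall n, (n0 <= n)%N ->
        vclose v N (u n) l.

Definition finite_residue_field (F : fieldType) (v : F -> int) : Prop :=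
  exists s : seq F, forall x : F, (x = 0 \/ (x != 0 /\ 0 <= v x)) ->
    exists2 r, r \in s & vclose v 1 x r.

Definition nonarch_local_field_char0 (F : fieldType) : Prop :=
  [pchar F] =i pred0 /\
  exists v : F -> int,
    [/\ is_discrete_valuation v, vcomplete v & finite_residue_field v].

Definition hilbert (E : fieldType) (a b : E) : int :=
  if `[< exists x y z : E, [\/ x != 0, y != 0 | z != 0] /\
                           a * x ^+ 2 + b * y ^+ 2 = z ^+ 2 >]
  then 1 else -1.

Section Cocycle.
Variable E : fieldType.
Implicit Types (g : 'M[E]_2) (y : E).

Definition xg g : E := if g 1 0 != 0 then g 1 0 else g 1 1.

Definition beta_SL g1 g2 : int :=
  hilbert (xg g1) (xg g2) * hilbert (- (xg g1)^-1 * xg g2) (xg (g1 *m g2)).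

Definition diag1 y : 'M[E]_2 := diag_mx (\row_(i < 2) if i == 0 then 1 else y).

(* g = diag(1, det g) p(g) *)
Definition pg g : 'M[E]_2 := diag1 (\det g)^-1 *m g.

Definition conjy y g : 'M[E]_2 := diag1 y^-1 *m g *m diag1 y.

Definition vyg y g : int := if g 1 0 != 0 then 1 else hilbert y (g 1 1).

Definition beta g1 g2 : int :=
  beta_SL (conjy (\det g2) (pg g1)) (pg g2) * vyg (\det g2) (pg g1).
End Cocycle.

Definition quaternion_division_algebra (F : fieldType) (D : falgType F) : Prop :=
  [/\ \dim {:D} = 4%N,
      (forall x : D, x != 0 -> x \is a GRing.unit) &
      (forall x : D, (forall y : D, x * y = y * x) -> exists a : F, x = a%:A)].

Definition Falg_hom (F : fieldType) (E : fieldExtType F) (D : falgType F)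
    (phi : D -> 'M[E]_2) : Prop :=
  [/\ (forall x y, phi (x + y) = phi x + phi y),
      (forall x y, phi (x * y) = phi x *m phi y),
      phi 1 = 1%:M &
      (forall (a : F) x, phi (a *: x) = (a%:A : E) *: phi x)].

(* Main.v *)
(* For a, b in F^x the symbol (a, b)_E is trivial: E splits every quaternion
   algebra over F, because there is only one quaternion division algebra over a
   local field and it contains E. Hence beta is identically 1 on GL_2(F).

   For D = E + E w with w^2 = mu, write phi x up to conjugation as
   [[conj d, mu conj c], [c, d]]. The symbols (a, z)_E = (a, N z)_F for a in F^x,
   and (z, conj z)_E = 1, turn beta on D^x into a simple cocycle bt. On the norm
   one group D^1 it is the coboundary of
   s1 k = - (x_k, - nu)_E (- delta mu, - nu)_F, nu = 2 - tr k,
   and s1 is invariant under conjugation by D^x. The cover of D^x modulo the lift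
   of D^1 by s1 is therefore a central extension of the abelian group N(D^x),
   which is commutative because D^x is D^1 E^x or D^1 E^x u D^1 E^x h and the
   elements of E^x and h commute in it. Since C^x is divisible, the sign
   character of the central subgroup {1, -1} extends to a character of this
   abelian quotient, and this character is the splitting. *)
Require Import Defs.
From HB Require Import structures.
From mathcomp Require Import all_boot all_order all_algebra all_field.
From mathcomp Require Import boolp reals complex.
From mathcomp Require classical_sets.
From mathcomp Require Import ring lra zify.
Set Implicit Arguments. Unset Strict Implicit. Unset Printing Implicit Defensive.
Import Order.TTheory GRing.Theory Num.Theory.
Local Open Scope ring_scope.

(** * Valuations and Hensel's lemma *)


(** The symbol calculus rests on one fact: the nonzero values of [p^2 - a q^2] form a group of index
    at most two. It is proved uniformly in the residue characteristic: a nonsplit quaternion algebra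
    over a local field contains the unramified quadratic extension, so it can be written [(u, e)]
    with [u] an unramified discriminant, unique up to squares, and [e] of odd valuation. The
    quadratic defect of [delta u] then decides what happens over [E]. Kubota's formula branches on
    vanishing lower left entries, so identities on [D^x] threaten to split into many cases. The
    cocycle identity for [bt] and the coboundary identity for [s1] are checked where enough entries
    are nonzero; the generic case is a Steinberg relation read off from a polynomial identity
    between entries. They are then transported to all elements by right multiplication with a norm
    one [k] chosen to make the relevant entries nonzero. The section [s1] takes signs as values.
    Values leave the signs only when the character is extended beyond [D^1]: an element with a power
    whose value is already fixed receives a root of that value. *)

Definition vge (K : fieldType) (v : K -> int) (n : int) (x : K) : bool :=
  (x == 0) || (n <= v x).

Section Valuation.
Variables (K : fieldType) (v : K -> int).
Hypothesis vP : is_discrete_valuation v.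
Implicit Types (x y : K) (m n : int).

Lemma valuationM x y : x != 0 -> y != 0 -> v (x * y) = v x + v y.
Proof. by case: vP => h _ _; apply: h. Qed.

Lemma valuation1 : v 1 = 0.
Proof.
have : v (1 * 1) = v 1 + v 1 by rewrite valuationM ?oner_eq0.
by rewrite mulr1; lia.
Qed.

Lemma valuationN1 : v (-1) = 0.
Proof.
have : v (-1 * -1) = v (-1) + v (-1) by rewrite valuationM ?oppr_eq0 ?oner_eq0.
by rewrite mulrNN mulr1 valuation1; lia.
Qed.

Lemma valuationN x : v (- x) = v x.
Proof.
have [->|x0] := eqVneq x 0; first by rewrite oppr0.
by rewrite -mulN1r valuationM ?valuationN1 ?add0r // oppr_eq0 oner_eq0.
Qed.

Lemma valuationV x : x != 0 -> v x^-1 = - v x.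
Proof.
move=> x0; have : v (x / x) = v x + v x^-1 by rewrite valuationM ?invr_eq0.
by rewrite divff // valuation1; lia.
Qed.

Lemma valuationX x k : x != 0 -> v (x ^+ k) = v x *+ k.
Proof.
move=> x0; elim: k => [|k IH]; first by rewrite expr0 valuation1.
by rewrite exprS valuationM ?expf_neq0 // IH mulrS.
Qed.

Lemma vge_neq0 n x : x != 0 -> vge v n x = (n <= v x).
Proof. by rewrite /vge => /negPf ->. Qed.

Lemma vge_0 n : vge v n 0. Proof. by rewrite /vge eqxx. Qed.

Lemma vge_1 : vge v 0 1. Proof. by rewrite /vge valuation1 lexx orbT. Qed.

Lemma vge_le m n x : m <= n -> vge v n x -> vge v m x.
Proof. by rewrite /vge => mn /orP[->//|h]; rewrite (le_trans mn h) orbT. Qed.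

Lemma vgeN n x : vge v n (- x) = vge v n x.
Proof. by rewrite /vge oppr_eq0 valuationN. Qed.

Lemma vgeD n x y : vge v n x -> vge v n y -> vge v n (x + y).
Proof.
have [->|x0] := eqVneq x 0; first by rewrite add0r.
have [->|y0] := eqVneq y 0; first by rewrite addr0.
have [->|s0] := eqVneq (x + y) 0; first by rewrite vge_0.
rewrite !vge_neq0 // => hx hy; case: vP => _ h _.
by apply: le_trans (h _ _ x0 y0 s0); rewrite le_min hx.
Qed.

Lemma vgeB n x y : vge v n x -> vge v n y -> vge v n (x - y).
Proof. by move=> hx hy; apply: vgeD; rewrite ?vgeN. Qed.

Lemma vgeM m n x y : vge v m x -> vge v n y -> vge v (m + n) (x * y).
Proof.
have [->|x0] := eqVneq x 0; first by rewrite mul0r !vge_0.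
have [->|y0] := eqVneq y 0; first by rewrite mulr0 !vge_0.
have xy0 : x * y != 0 by rewrite mulf_neq0.
by rewrite !vge_neq0 // valuationM //; lia.
Qed.

Lemma vgeMl n x y : vge v 0 x -> vge v n y -> vge v n (x * y).
Proof. by move=> hx hy; rewrite -[n]add0r vgeM. Qed.

Lemma vgeMr n x y : vge v n x -> vge v 0 y -> vge v n (x * y).
Proof. by move=> hx hy; rewrite -[n]addr0 vgeM. Qed.

Lemma vgeX n x k : vge v n x -> vge v (n *+ k) (x ^+ k).
Proof.
move=> hx; elim: k => [|k IH]; first by rewrite expr0 mulr0n vge_1.
by rewrite exprS mulrS vgeM.
Qed.

Lemma vge_nat k : vge v 0 k%:R.
Proof. by elim: k => [|k IH]; rewrite ?vge_0 // -natr1 vgeD ?vge_1. Qed.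

Lemma vge_all0 x : (forall n, vge v n x) -> x = 0.
Proof.
move=> h; apply/eqP/negPn/negP => x0; have := h (v x + 1).
by rewrite vge_neq0 //; lia.
Qed.

Lemma vge_div m n x y : y != 0 -> v y <= m -> vge v (n + m) x -> vge v n (x / y).
Proof.
move=> y0 hy hx; have -> : n = (n + m) - m by lia.
apply: vgeM => //; rewrite vge_neq0 ?invr_neq0 // valuationV //; lia.
Qed.

Lemma vgeXr n x k : vge v (n *+ k.+1) (x ^+ k.+1) -> vge v n x.
Proof.
have [->|x0] := eqVneq x 0; first by rewrite vge_0.
rewrite !vge_neq0 ?expf_neq0 // valuationX //.
by rewrite ler_pMn2r.
Qed.

Definition vunit x := (x != 0) && (v x == 0).

Lemma vunitP x : reflect (vge v 0 x /\ ~~ vge v 1 x) (vunit x).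
Proof.
apply: (iffP idP) => [/andP[x0 /eqP h]|[h1]].
  by rewrite !vge_neq0 // h.
rewrite /vge negb_or => /andP[x0 h2]; move: h1.
rewrite vge_neq0 // => h1; rewrite /vunit x0 /=; apply/eqP; lia.
Qed.

Lemma vunit_neq0 x : vunit x -> x != 0. Proof. by case/andP. Qed.
Lemma vunit_int x : vunit x -> vge v 0 x. Proof. by case/vunitP. Qed.

Lemma vunitM x y : vunit x -> vunit y -> vunit (x * y).
Proof.
move=> /andP[x0 /eqP hx] /andP[y0 /eqP hy].
by rewrite /vunit mulf_neq0 // valuationM // hx hy.
Qed.

Lemma vunitV x : vunit x -> vunit x^-1.
Proof. by move=> /andP[x0 /eqP hx]; rewrite /vunit invr_neq0 // valuationV // hx. Qed.

Lemma vunit_sqr x : vunit (x ^+ 2) -> vunit x.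
Proof.
rewrite /vunit expf_eq0 /= => /andP[x0]; rewrite x0 valuationX //.
by rewrite mulrn_eq0.
Qed.

Lemma vgeMu n x y : vunit x -> vge v n (x * y) = vge v n y.
Proof.
move=> ux; apply/idP/idP => h; last by apply: vgeMl h; apply: vunit_int.
by rewrite -[y](mulKf (vunit_neq0 ux)) vgeMl // vunit_int // vunitV.
Qed.

Lemma vunit_add x y : vunit x -> vge v 1 y -> vunit (x + y).
Proof.
move=> /vunitP[h1 h2] hy; apply/vunitP; split.
  by apply: vgeD h1 (vge_le _ hy).
by apply: contra h2 => h; rewrite -[x](addrK y) vgeB.
Qed.

Lemma vge1_sqr x : vge v 1 (x ^+ 2) -> vge v 1 x.
Proof.
have [->|x0] := eqVneq x 0; first by rewrite vge_0.
rewrite !vge_neq0 ?expf_neq0 // valuationX //; lia.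
Qed.

Lemma vge1_mul x y : vge v 0 x -> vge v 0 y -> vge v 1 (x * y) -> vge v 1 x \/ vge v 1 y.
Proof.
move=> hx hy h; case: (boolP (vge v 1 x)) => [|nx]; [by left|right].
by rewrite vgeMu // in h; apply/vunitP.
Qed.

Hypothesis vcompl : vcomplete v.

Lemma vclose_vge n x y : vclose v n x y <-> vge v n (x - y).
Proof.
rewrite /vclose /vge; split=> [[->|[_ ->]]|]; rewrite ?eqxx ?orbT //.
by case: eqP => [->|/eqP h]; [left|right].
Qed.

(* The fixed point of the contraction [y |-> al * y ^+ 2 + ga] on the maximal
   ideal; this form of Hensel's lemma also covers residue characteristic 2. *)
Lemma hensel (al ga : K) : vge v 0 al -> vge v 1 ga ->
  exists2 y, vge v 1 y & y = al * y ^+ 2 + ga.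
Proof.
move=> hal hga.
pose f y := al * y ^+ 2 + ga.
pose u (k : nat) := iter k f 0.
have uE k : u k.+1 = f (u k) by [].
have u1 k : vge v 1 (u k).
  elim: k => [|k IH]; first exact: vge_0.
  rewrite uE /f vgeD // vgeMl //.
  by have := vgeX 2 IH; apply: vge_le.
(* The factor [x + y] lies in the maximal ideal, and this alone makes [f] a contraction; 2 is never
   inverted. *)
have fB x y : f x - f y = al * (x - y) * (x + y) by rewrite /f; ring.
have uS k : vge v (k%:Z + 1) (u k.+1 - u k).
  elim: k => [|k IH]; first by rewrite subr0 u1.
  rewrite (uE k.+1) [in X in _ - X](uE k) fB.
  have -> : k.+1%:Z + 1 = (k%:Z + 1) + 1 by lia.
  by apply: vgeM; [apply: vgeMl | apply: vgeD].
have uD i k : vge v (i%:Z + 1) (u (i + k)%N - u i).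
  elim: k => [|k IH]; first by rewrite addn0 subrr vge_0.
  rewrite addnS -[u _](subrK (u (i + k)%N)) -addrA vgeD //.
  by apply: vge_le (uS _); lia.
have [l hl] : exists l, forall N, exists k0, forall k, (k0 <= k)%N -> vclose v N (u k) l.
  apply: vcompl => N; exists `|N|%N => i k hi hk; apply/vclose_vge.
  have -> : u i - u k = (u i - u `|N|%N) - (u k - u `|N|%N) by ring.
  rewrite -(subnKC hi) -(subnKC hk).
  by apply: vgeB; apply: vge_le (uD _ _); lia.
have l1 : vge v 1 l.
  have [n0 /(_ n0 (leqnn _)) /vclose_vge h] := hl 1.
  by have -> : l = u n0 - (u n0 - l); [ring | apply: vgeB].
exists l => //; apply/eqP; rewrite -subr_eq0; apply/eqP/vge_all0 => n.
have [n0 h] := hl (Num.max n 0).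
have h1 := h _ (leqnn n0); have h2 := h _ (leqnSn n0).
move/vclose_vge in h1; move/vclose_vge in h2.
have -> : l - (al * l ^+ 2 + ga) = al * (u n0 - l) * (u n0 + l) - (u n0.+1 - l).
  by rewrite uE /f; ring.
apply: vgeB; last by apply: vge_le h2; lia.
rewrite -[n]addr0; apply: vgeM.
  by apply: vgeMl => //; apply: vge_le h1; lia.
by apply: (@vge_le _ 1) => //; apply: vgeD.
Qed.

(* Otherwise [X^2 - T X + N] would be reducible by Hensel's lemma. *)
Lemma trace_integral (T N : K) : vge v 0 N ->
  (forall x, x ^+ 2 - T * x + N = 0 -> vge v 0 T) -> vge v 0 T.
Proof.
move=> hN hr; case: (boolP (vge v 0 T)) => // hT; move: (hT).
rewrite /vge negb_or -ltNge => /andP[T0 vT].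
(* Substituting [X = T y] turns [X^2 - T X + N] into [T^2 (y^2 - y + N / T^2)], and [N / T^2] is in
   the maximal ideal when [T] is not integral. *)
have [|y hy ey] := @hensel 1 (N / T ^+ 2) vge_1.
  apply: (@vge_div (v (T ^+ 2))); rewrite ?expf_neq0 ?lexx //.
  by apply: vge_le hN; rewrite valuationX //; lia.
have := hr (T * y); rewrite (negPf hT) => ->//.
rewrite [y in T * (T * y)]ey; by field.
Qed.

(** With the root written [x + z] and [w] the derivative at [x], the equation becomes
    [z = - z^2 / w - f(x) / w], which is the shape solved by [hensel]. *)
Lemma hensel_monic (T N x : K) : vge v 0 T -> vge v 0 N -> vge v 0 x ->
    vge v 1 (x ^+ 2 - T * x + N) -> vunit (2%:R * x - T) ->
  exists2 y, vge v 1 (y - x) & y ^+ 2 - T * y + N = 0.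
Proof.
move=> hT hN hx hf hu; set w := 2%:R * x - T in hu.
have w0 := vunit_neq0 hu.
have [||y hy ey] := @hensel (- w^-1) (- ((x ^+ 2 - T * x + N) / w)).
- by rewrite vgeN vunit_int // vunitV.
- by rewrite vgeN vgeMr // vunit_int // vunitV.
exists (x + y); first by rewrite addrC addKr.
have e2 : w * y = - y ^+ 2 - (x ^+ 2 - T * x + N).
  by rewrite [y in LHS]ey; field.
have -> : (x + y) ^+ 2 - T * (x + y) + N = (x ^+ 2 - T * x + N) + w * y + y ^+ 2.
  by rewrite /w; ring.
by rewrite e2; ring.
Qed.

End Valuation.

(** * The unramified quadratic extension *)

Section Residue.
Variables (K : fieldType) (v : K -> int).
Hypothesis vP : is_discrete_valuation v.
Hypothesis vcompl : vcomplete v.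
Hypothesis vfin : finite_residue_field v.

(** The residue field as a bare finite set [T] with reduction [rho] and lifts [tau]: the arguments
    below only count. The given list may repeat classes or contain non-integral elements, so a class
    is named by the first index congruent to it, and only indices that occur are kept. *)
Lemma residue_system : exists (T : finType) (rho : K -> T) (tau : T -> K),
  [/\ forall t, vge v 0 (tau t), forall t, rho (tau t) = t &
      forall x y, vge v 0 x -> vge v 0 y -> (rho x = rho y <-> vge v 1 (x - y))].
Proof.
have [s hs] := vfin.
pose idx x := find (fun r => vge v 1 (x - r)) s.
have has_s x : vge v 0 x -> has (fun r => vge v 1 (x - r)) s.
  move=> hx; have [|r rs /vclose_vge hr] := hs x.
    move: hx; rewrite /vge; case: eqP => [->|/eqP h]; by [left|right].
  by apply/hasP; exists r.
have idx_lt x : (idx x < (size s).+1)%N by rewrite ltnS find_size.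
pose p (i : 'I_(size s).+1) := `[< exists2 x, vge v 0 x & idx x = i >].
have p0 : p (Ordinal (idx_lt 0)) by apply/asboolP; exists 0; rewrite ?vge_0.
have px x : vge v 0 x -> p (Ordinal (idx_lt x)) by move=> hx; apply/asboolP; exists x.
pose T := {i : 'I_(size s).+1 | p i}.
pose rho x : T := insubd (Sub _ p0 : T) (Ordinal (idx_lt x)).
have rhoE x : vge v 0 x -> nat_of_ord (val (rho x)) = idx x.
  by move=> hx; rewrite /rho val_insubd px.
have /choice [tau htau] : forall t : T, exists x, vge v 0 x /\ rho x = t.
  case=> i pi; have /asboolP [x hx ix] := pi.
  by exists x; split=> //; apply/val_inj/val_inj; rewrite /= rhoE.
have idxP x y : vge v 0 x -> vge v 0 y -> (idx x = idx y <-> vge v 1 (x - y)).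
  move=> hx hy; split=> [e|h].
    have h1 := nth_find 0 (has_s _ hx); have h2 := nth_find 0 (has_s _ hy).
    rewrite -/(idx x) in h1; rewrite -/(idx y) -e in h2.
    have -> : x - y = (x - s`_(idx x)) - (y - s`_(idx x)) by ring.
    exact: vgeB.
  apply: eq_find => r; apply/idP/idP => hr.
    by have -> : y - r = (x - r) - (x - y); [ring | apply: vgeB].
  by have -> : x - r = (y - r) + (x - y); [ring | apply: vgeD].
exists T, rho, tau; split=> [t|t|x y hx hy]; try by case: (htau t).
rewrite -idxP // -!rhoE //; split=> [->//|e].
by apply/val_inj/val_inj.
Qed.

Hypothesis nz2 : (2%:R : K) != 0.

Lemma two_val : vunit v 2%:R \/ vge v 1 2%:R.
Proof.
case: (boolP (vge v 1 2%:R)) => h; [by right|left].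
by apply/(vunitP v); split=> //; apply: vge_nat.
Qed.

(** In residue characteristic 2 squaring is injective on residues, because [(s - t)^2] and
    [s^2 - t^2] agree modulo 2; an injective self-map of a finite set is onto. *)
Lemma sqr_surj_mod c : vge v 1 2%:R -> vge v 0 c ->
  exists2 y, vge v 0 y & vge v 1 (c - y ^+ 2).
Proof.
move=> h2 hc; have [T [rho [tau [ti rt rP]]]] := residue_system.
have t2i t : vge v 0 (tau t ^+ 2) by have := vgeX vP 2 (ti t).
pose f t := rho (tau t ^+ 2).
have finj : injective f.
  move=> t t' /(rP _ _ (t2i t) (t2i t')) h.
  rewrite -(rt t) -(rt t'); apply/rP => //; apply: (vge1_sqr vP).
  have -> : (tau t - tau t') ^+ 2
     = (tau t ^+ 2 - tau t' ^+ 2) + 2%:R * (tau t' * (tau t' - tau t)) by ring.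
  apply: vgeD => //; apply: vgeMr => //; apply: vgeMl => //; exact: vgeB.
have /codomP [t et] := injF_onto finj (rho c).
by exists (tau t) => //; apply/rP.
Qed.

Lemma sqrt_unit e x : vunit v 2%:R -> vunit v x -> vge v 0 e -> vge v 1 (e - x ^+ 2) ->
  exists z, z ^+ 2 = e.
Proof.
move=> u2 ux he h; have [|||||y _ /eqP] := @hensel_monic _ _ vP vcompl 0 (- e) x.
- exact: vge_0.
- by rewrite vgeN.
- exact: vunit_int ux.
- by rewrite mul0r subr0 -(vgeN vP) opprD opprK addrC.
- by rewrite subr0 vunitM.
by rewrite mul0r subr0 subr_eq0 => /eqP <-; exists y.
Qed.

(* [1 - 4 N] is the discriminant of [X^2 - X + N]; when this polynomial has no
   root modulo the maximal ideal, it generates the unramified quadratic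
   extension. *)
Definition unram N :=
  vge v 0 N /\ forall y, vge v 0 y -> ~~ vge v 1 (y ^+ 2 - y + N).

(** A residual double root is impossible: if 2 is a unit it would be [1/2], and if 2 is not a unit
    the discriminant is congruent to 1. *)
Lemma unram_disc N : unram N -> vunit v (1 - 4%:R * N).
Proof.
move=> [hN hr]; have h4 : vge v 0 (4%:R * N) by rewrite vgeMl // vge_nat.
apply/(vunitP v); split; first by apply: vgeB => //; exact: vge_1.
apply/negP => h; case: two_val => [u2|h2].
  have nz4 : (4%:R : K) != 0 by rewrite (natrM K 2 2) mulf_neq0.
  have /negP[] := hr 2%:R^-1 (vunit_int (vunitV vP u2)).
  have -> : 2%:R^-1 ^+ 2 - 2%:R^-1 + N = - (2%:R^-1 * (2%:R^-1 * (1 - 4%:R * N))).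
    by field.
  by rewrite vgeN // !vgeMu // ?vunitV.
have /(vunitP v)[_ /negP[]] : vunit v 1 by rewrite /vunit oner_eq0 valuation1.
have -> : (1 : K) = (1 - 4%:R * N) + 2%:R * (2%:R * N) by ring.
apply: vgeD => //; apply: vgeMr => //; apply: vgeMl => //; exact: vge_nat.
Qed.

(** The square of the derivative [2 y - 1] is congruent to the discriminant, so the residual root is
    simple and lifts to some [z]; then [N = z - z^2] and the discriminant is [(1 - 2 z)^2]. *)
Lemma root_disc N y : vge v 0 N -> vge v 0 y -> vge v 1 (y ^+ 2 - y + N) ->
  vunit v (1 - 4%:R * N) -> exists2 e, e != 0 & 1 - 4%:R * N = e ^+ 2.
Proof.
move=> hN hy h hu; have [|||||z hz ez] := @hensel_monic _ _ vP vcompl 1 N y.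
- exact: vge_1.
- by [].
- by [].
- by rewrite mul1r.
- have : vunit v ((2%:R * y - 1) ^+ 2).
    have -> : (2%:R * y - 1) ^+ 2 = (1 - 4%:R * N) + 4%:R * (y ^+ 2 - y + N) by ring.
    by apply: vunit_add => //; apply: vgeMl => //; apply: vge_nat.
  exact: vunit_sqr.
have eN : N = z - z ^+ 2 by apply/eqP; rewrite -subr_eq0 -ez; apply/eqP; ring.
have e1 : 1 - 4%:R * N = (1 - 2%:R * z) ^+ 2 by rewrite eN; ring.
exists (1 - 2%:R * z) => //.
by move: (vunit_neq0 hu); rewrite e1 expf_eq0.
Qed.

(* Counting residues: the set [A] of reducible [N] has at least half the size of
   the set [X] of all [N] with unit discriminant, and multiplication of
   discriminants by [1 - 4 N1] moves [A] off itself. *)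
Lemma unram_unique N1 N2 : unram N1 -> unram N2 ->
  exists2 e, e != 0 & (1 - 4%:R * N1) * (1 - 4%:R * N2) = e ^+ 2.
Proof.
move=> u1 u2; have d1 := unram_disc u1; have d2 := unram_disc u2.
have [hN1 r1] := u1; have [hN2 r2] := u2.
have h4 : vge v 0 4%:R by apply: vge_nat.
have h2 : vge v 0 2%:R by apply: vge_nat.
have h1 := vge_1 vP.
(* Multiplication of discriminants written on the parameters, so that it remains meaningful on
   residues when 4 is not a unit. *)
pose op (x y : K) : K := x + y - 4%:R * x * y.
have opD x y : 1 - 4%:R * op x y = (1 - 4%:R * x) * (1 - 4%:R * y) by rewrite /op; ring.
have opi x y : vge v 0 x -> vge v 0 y -> vge v 0 (op x y).
  by move=> hx hy; apply: vgeB; [|apply: vgeD|apply: vgeMl => //; apply: vgeMl].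
pose red (x : K) := exists2 y, vge v 0 y & vge v 1 (y ^+ 2 - y + x).
have redM x y : vge v 0 x -> vge v 0 y -> red x -> red y -> red (op x y).
  (* Square roots of discriminants multiply: the witness [c] is determined by
     [1 - 2 c = (1 - 2 a) (1 - 2 b)]. *)
  move=> hx hy [a ha ra] [b hb rb]; exists (a + b - 2%:R * a * b).
    by apply: vgeB => //; [apply: vgeD | apply: vgeMl => //; apply: vgeMl].
  have -> : (a + b - 2%:R * a * b) ^+ 2 - (a + b - 2%:R * a * b) + op x y =
     (a ^+ 2 - a + x) * (1 - 4%:R * y) +
     (b ^+ 2 - b + y) * (1 + 4%:R * (a ^+ 2 - a)) by rewrite /op; ring.
  have s0 (z : K) : vge v 0 z -> vge v 0 (z ^+ 2) by move=> hz; have := vgeX vP 2 hz.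
  apply: vgeD => //; apply: vgeMr => //.
    by apply: vgeB => //; apply: vgeMl.
  apply: vgeD => //; apply: vgeMl => //; apply: vgeB => //; exact: s0.
have redV x y : vge v 0 x -> vge v 0 y -> vunit v (1 - 4%:R * y) ->
    red (op x y) -> red y -> red x.
  move=> hx hy uy rxy ry.
  (* The inverse of [y] for [op]. *)
  pose y' := - y / (1 - 4%:R * y).
  have iu := vunit_int (vunitV vP uy).
  have hy' : vge v 0 y' by rewrite vgeMl // vgeN.
  have -> : x = op (op x y) y' by rewrite /op /y'; field; exact: vunit_neq0 uy.
  apply: redM => //; first exact: opi.
  have [b hb rb] := ry.
  pose w := 1 - 2%:R * b.
  have hw2 : vunit v (w ^+ 2).
    have -> : w ^+ 2 = (1 - 4%:R * y) + 4%:R * (b ^+ 2 - b + y) by rewrite /w; ring.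
    by apply: vunit_add => //; apply: vgeMl.
  have hw : vunit v w by apply: vunit_sqr hw2.
  exists (- b / w); first by rewrite vgeMl ?vgeN // (vunit_int) // vunitV.
  have -> : (- b / w) ^+ 2 - - b / w + y' =
     (b ^+ 2 - b + y) * (- (w ^+ 2)^-1 / (1 - 4%:R * y)).
    have w0 := vunit_neq0 hw; rewrite /y' /w in w0 *; field.
    by rewrite w0 (vunit_neq0 uy).
  apply: vgeMr => //; apply: vgeMl => //; rewrite vgeN //.
  by apply: (vunit_int); apply: vunitV.
have redS x : red (op x x) \/ ~ vge v 0 x.
  case: (boolP (vge v 0 x)) => hx; [left|by right].
  exists (2%:R * x); first exact: vgeMl.
  have -> : (2%:R * x) ^+ 2 - 2%:R * x + op x x = 0 by rewrite /op; ring.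
  exact: vge_0.
have opA x y z : op (op x y) z = op x (op y z) by rewrite /op; ring.
have nr1 : ~ red N1 by case=> y hy; apply/negP/r1.
have nr2 : ~ red N2 by case=> y hy; apply/negP/r2.
case: (pselect (red (op N1 N2))) => [[y hy hr]|nr].
  have [||e e0 ee] := root_disc _ hy hr; rewrite ?opD ?vunitM //; first exact: opi.
  by exists e; rewrite // -opD.
have [T [rho [tau [ti rt rP]]]] := residue_system.
have rE x : vge v 0 x -> vge v 1 (tau (rho x) - x).
  by move=> hx; apply/rP; rewrite ?rt.
have red_eq x y : vge v 1 (x - y) -> red x -> red y.
  move=> h [a ha ra]; exists a => //.
  have -> : a ^+ 2 - a + y = (a ^+ 2 - a + x) - (x - y) by ring.
  exact: vgeB.
have u_eq x y : vge v 1 (x - y) -> vunit v x -> vunit v y.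
  by move=> h ux; rewrite -[y](subrK x) addrC; apply: vunit_add => //; rewrite -vgeN // opprB.
pose X := [set t | vunit v (1 - 4%:R * tau t)].
pose Y := [set t | vunit v (1 - 2%:R * tau t)].
pose A := [set t in X | `[< red (tau t) >]].
have XY : (#|X| <= #|Y|)%N.
  case: two_val => [v2|v2]; last first.
    apply: subset_leq_card; apply/subsetP => t _; rewrite inE.
    apply: vunit_add => //; first by rewrite /vunit oner_eq0 valuation1.
    by rewrite vgeN // vgeMr.
  pose f t := rho (2%:R * tau t).
  have ft t : vge v 0 (2%:R * tau t) by apply: vgeMl.
  have finj : injective f.
    move=> t t' /(rP _ _ (ft _) (ft _)); rewrite -mulrBr vgeMu // => h.
    by rewrite -(rt t) -(rt t'); apply/rP.
  rewrite -(card_imset _ finj); apply: subset_leq_card; apply/subsetP => _ /imsetP[t tX ->].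
  rewrite !inE in tX *; apply: u_eq tX.
  have -> : 1 - 4%:R * tau t - (1 - 2%:R * tau (f t)) = 2%:R * (tau (f t) - 2%:R * tau t).
    by ring.
  by rewrite vgeMl // rE.
have YA : (#|Y| <= 2 * #|A|)%N.
  pose q t := rho (tau t - tau t ^+ 2).
  have qi t : vge v 0 (tau t - tau t ^+ 2).
    by apply: vgeB => //; have := vgeX vP 2 (ti t).
  (* Fibres of [t - t^2] on residues have at most the two points [t] and [1 - t]. Recording whether
     [t] is the point picked in its fibre makes [f] injective into [A] times the booleans. *)
  pose pk a := [pick t in Y | q t == a].
  pose f t := (q t, Some t == pk (q t)).
  have qq t t' : q t = q t' -> t = t' \/ vge v 1 (1 - tau t - tau t').
    move=> /(rP _ _ (qi _) (qi _)) h.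
    have e : tau t - tau t ^+ 2 - (tau t' - tau t' ^+ 2) =
       (tau t - tau t') * (1 - tau t - tau t') by ring.
    have h3 : vge v 0 (tau t - tau t') by apply: vgeB.
    have h3' : vge v 0 (1 - tau t - tau t') by apply: vgeB => //; apply: vgeB.
    rewrite e in h; case: (vge1_mul vP h3 h3' h) => h'; [left|by right].
    by rewrite -(rt t) -(rt t'); apply/rP.
  have q3 t t' t'' : q t = q t'' -> q t' = q t'' -> t != t'' -> t' != t'' -> t = t'.
    move=> /qq [->|h]; first by rewrite eqxx.
    move=> /qq [->|h']; first by rewrite eqxx.
    move=> _ _; rewrite -(rt t) -(rt t'); apply/rP => //.
    have -> : tau t - tau t' = (1 - tau t' - tau t'') - (1 - tau t - tau t'') by ring.
    exact: vgeB.
  have finj : {in Y &, injective f}.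
    move=> t t' tY t'Y; rewrite /f => -[e]; rewrite -e /pk.
    case: pickP => [a /andP[aY /eqP ea]|]; last by move=> /(_ t); rewrite tY eqxx.
    have S x y : (Some x == Some y :> option T) = (x == y) by apply/eqP/eqP => [[]|->].
    rewrite !S; case: (eqVneq t a) => [->|n1]; case: (eqVneq t' a) => [->|n2] // _.
    by apply: (q3 _ _ a) => //; rewrite ea.
  rewrite mulnC -card_bool -cardsT -cardsX -(card_in_imset finj).
  apply: subset_leq_card; apply/subsetP => _ /imsetP[t tY ->].
  have qX : vge v 1 (tau (q t) - (tau t - tau t ^+ 2)) by apply: rE.
  rewrite !inE /= andbT; apply/andP; split.
    apply: (u_eq ((1 - 2%:R * tau t) ^+ 2)).
      have -> : (1 - 2%:R * tau t) ^+ 2 - (1 - 4%:R * tau (q t)) =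
         4%:R * (tau (q t) - (tau t - tau t ^+ 2)) by ring.
      exact: vgeMl.
    by rewrite inE in tY; rewrite expr2 vunitM.
  apply/asboolP; exists (tau t) => //.
  by have -> : tau t ^+ 2 - tau t + tau (q t) = tau (q t) - (tau t - tau t ^+ 2) by ring.
pose f t := rho (op N1 (tau t)).
have fi t : vge v 0 (op N1 (tau t)) by apply: opi.
have fE t : vge v 1 (tau (f t) - op N1 (tau t)) by apply: rE.
have finj : injective f.
  move=> t t' /(rP _ _ (fi _) (fi _)).
  have -> : op N1 (tau t) - op N1 (tau t') = (1 - 4%:R * N1) * (tau t - tau t').
    by rewrite /op; ring.
  by rewrite vgeMu // => h; rewrite -(rt t) -(rt t'); apply/rP.
(* If [t] and [op N1 t] were both reducible, [N1] would be too. *)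
have dis : [disjoint A & f @: A].
  rewrite -setI_eq0 -subset0; apply/subsetP => x /setIP[fr /imsetP[t tA ex]].
  move: fr tA; rewrite ex !inE => /andP[_ /asboolP fr] /andP[tX /asboolP tr].
  case: nr1; apply: (redV _ (tau t)) => //.
  by apply: red_eq fr; apply: fE.
(* With [op N1 N2] irreducible, [N2] also avoids the translate of [A], because [op N1 N1] is
   reducible. This is one element too many in [X], whose size is at most twice that of [A]. *)
have N2A : rho N2 \notin A :|: f @: A.
  rewrite inE negb_or; apply/andP; split.
    rewrite !inE; apply/negP => /andP[_ /asboolP h]; apply: nr2.
    by apply: red_eq h; apply: rE.
  apply/negP => /imsetP[t tA /(rP _ _ hN2 (fi _)) e]; apply: nr.
  rewrite !inE in tA; move: tA => /andP[tX /asboolP tr].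
  apply: (red_eq (op (op N1 N1) (tau t))).
    have -> : op (op N1 N1) (tau t) - op N1 N2 = (N2 - op N1 (tau t)) * - (1 - 4%:R * N1).
      by rewrite /op; ring.
    by apply: vgeMr => //; rewrite vgeN // (vunit_int).
  by apply: redM => //; [apply: opi | case: (redS N1)].
have : (#|rho N2 |: (A :|: f @: A)| <= #|X|)%N.
  apply: subset_leq_card; apply/subsetP => x; rewrite !inE => /orP[/eqP ->|/orP[/andP[]//|]].
    apply: (u_eq _ _ _ d2).
    have -> : 1 - 4%:R * N2 - (1 - 4%:R * tau (rho N2)) = 4%:R * (tau (rho N2) - N2) by ring.
    by apply: vgeMl => //; apply: rE.
  move=> /imsetP[t]; rewrite !inE => /andP[tX _] ->.
  apply: (u_eq (1 - 4%:R * op N1 (tau t))); last by rewrite opD vunitM.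
  have -> : 1 - 4%:R * op N1 (tau t) - (1 - 4%:R * tau (f t)) =
     4%:R * (tau (f t) - op N1 (tau t)) by ring.
  by apply: vgeMl.
have cU : #|A :|: f @: A| = (#|A| + #|A|)%N.
  have [_] := leq_card_setU A (f @: A).
  by rewrite dis => /eqP ->; rewrite card_imset.
by rewrite cardsU1 N2A cU; lia.
Qed.

(** In residue characteristic 2, [x] is a residual square root of [c] and Hensel's lemma solves for
    [y]. Otherwise the square is completed, a pigeonhole on residual squares solves the equation
    modulo the maximal ideal, and a square root is lifted. *)
Lemma unram_norm N c : unram N -> vunit v c ->
  exists x y, c = x ^+ 2 + x * y + N * y ^+ 2.
Proof.
move=> uN uc; have [hN rN] := uN; have d := unram_disc uN.
have hc := vunit_int uc.
have s0 (z : K) : vge v 0 z -> vge v 0 (z ^+ 2) by move=> hz; have := vgeX vP 2 hz.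
case: two_val => [u2|h2]; last first.
  have [x hx xc] := sqr_surj_mod h2 hc.
  have ux : vunit v x.
    apply/(vunitP v); split=> //; apply/negP => x1.
    have [_ /negP[]] := vunitP v _ uc.
    rewrite -[c](subrK (x ^+ 2)) vgeD //.
    by have := vgeX vP 2 x1; apply: vge_le.
  have ixu := vunit_int (vunitV vP ux).
  have [||y hy ey] := @hensel _ _ vP vcompl (- (N / x)) ((c - x ^+ 2) / x).
  - by rewrite vgeN // vgeMl.
  - by rewrite vgeMr.
  exists x, y; have x0 := vunit_neq0 ux.
  have -> : x ^+ 2 + x * y + N * y ^+ 2 = x ^+ 2 + x * (y + N / x * y ^+ 2) by field.
  by rewrite [X in X + N / x * _]ey; field.
have nz4 : (4%:R : K) != 0 by rewrite (natrM K 2 2) mulf_neq0.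
set u := 1 - 4%:R * N in d.
suff [X [Y e]] : exists X Y, c = X ^+ 2 - u * Y ^+ 2.
  by exists (X - Y), (2%:R * Y); rewrite e /u; ring.
have [T [rho [tau [ti rt rP]]]] := residue_system.
have rE x : vge v 0 x -> vge v 1 (tau (rho x) - x).
  by move=> hx; apply/rP; rewrite ?rt.
have hu := vunit_int d.
pose q t := rho (tau t ^+ 2).
have qq t t' : q t = q t' -> t = t' \/ vge v 1 (tau t + tau t').
  move=> /(rP _ _ (s0 _ (ti _)) (s0 _ (ti _))) h.
  have e : tau t ^+ 2 - tau t' ^+ 2 = (tau t - tau t') * (tau t + tau t') by ring.
  have h3 : vge v 0 (tau t - tau t') by apply: vgeB.
  have h3' : vge v 0 (tau t + tau t') by apply: vgeD.
  rewrite e in h; case: (vge1_mul vP h3 h3' h) => h'.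
  - by left; rewrite -(rt t) -(rt t'); apply/rP.
  - by right.
pose H := q @: [set: T].
pose pk a := [pick t | q t == a].
pose f t := (q t, Some t == pk (q t)).
have finj : injective f.
  move=> t t'; rewrite /f => -[e]; rewrite -e /pk.
  case: pickP => [a /eqP ea|]; last by move=> /(_ t); rewrite eqxx.
  have S x y : (Some x == Some y :> option T) = (x == y) by apply/eqP/eqP => [[]|->].
  rewrite !S; case: (eqVneq t a) => [->|n1]; case: (eqVneq t' a) => [->|n2] // _.
  case: (qq t a) => [||h1]; rewrite ?ea //; first by move/eqP: n1.
  case: (qq t' a) => [||h2]; rewrite ?ea //; first by move/eqP: n2.
  rewrite -(rt t) -(rt t'); apply/rP => //.
  by have -> : tau t - tau t' = (tau t + tau a) - (tau t' + tau a); [ring | apply: vgeB].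
(* Squares fill more than half of the residues: the fibres of squaring are pairs [t], [- t], except
   for the single point over 0. So the squares must meet their image under [c + u t]. *)
have cT : (#|T| < 2 * #|H|)%N.
  rewrite -cardsT -(card_imset _ finj) mulnC -card_bool -[#|{: bool}|]cardsT -cardsX.
  apply: proper_card; apply/properP; split.
    by apply/subsetP => _ /imsetP[t _ ->]; rewrite in_setX /= in_setT andbT; apply: imset_f.
  exists (q (rho 0), false).
    by rewrite in_setX /= in_setT andbT; apply: imset_f.
  apply/negP => /imsetP[t _ [e]].
  have z0 : vge v 1 (tau (rho 0)) by rewrite -[tau _]subr0 rE // vge_0.
  have t0 a : q a = q (rho 0) -> a = rho 0.
    move=> /qq [//|h]; rewrite -[LHS]rt; apply/rP => //; first exact: vge_0.
    by rewrite subr0 -[tau a](addrK (tau (rho 0))) vgeB.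
  rewrite -e (t0 t) // /pk; case: pickP => [a /eqP ea|/(_ (rho 0))]; last by rewrite eqxx.
  by rewrite (t0 a) // eqxx.
pose g t := rho (c + u * tau t).
have gi t : vge v 0 (c + u * tau t) by apply: vgeD => //; apply: vgeMl.
have ginj : injective g.
  move=> t t' /(rP _ _ (gi _) (gi _)).
  have -> : c + u * tau t - (c + u * tau t') = u * (tau t - tau t') by ring.
  by rewrite vgeMu // => h; rewrite -(rt t) -(rt t'); apply/rP.
have : ~~ [disjoint H & g @: H].
  apply/negP => dis; have [_] := leq_card_setU H (g @: H).
  rewrite dis card_imset // => /eqP e; have := max_card (H :|: g @: H).
  by rewrite e; lia.
case/pred0Pn => _ /andP[/imsetP[t _ ->]] /imsetP[_ /imsetP[t' _ ->]].
move=> /(rP _ _ (s0 _ (ti _)) (gi _)) e.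
have {e} e : vge v 1 (tau t ^+ 2 - (c + u * tau t' ^+ 2)).
  have -> : tau t ^+ 2 - (c + u * tau t' ^+ 2) = tau t ^+ 2 - (c + u * tau (q t')) +
     u * (tau (q t') - tau t' ^+ 2) by ring.
  by apply: vgeD => //; apply: vgeMl => //; apply: rE; apply: s0.
have ci : vge v 0 (c + u * tau t' ^+ 2).
  by apply: vgeD => //; apply: vgeMl => //; apply: s0.
(* Square roots lift only from units. If [tau t] is not a unit then [tau t'] is, since [c] is, and
   the other variable is lifted instead. *)
case: (boolP (vge v 1 (tau t))) => ht; last first.
  have ut : vunit v (tau t) by apply/(vunitP v).
  have [|z ez] := sqrt_unit u2 ut ci; first by rewrite -vgeN // opprB.
  by exists z, (tau t'); rewrite ez; ring.
have t2 : vge v 1 (tau t ^+ 2) by have := vgeX vP 2 ht; apply: vge_le.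
have ut' : vunit v (tau t').
  apply/(vunitP v); split=> //; apply/negP => t1.
  have [_ /negP[]] := vunitP v _ uc.
  have -> : c = tau t ^+ 2 - (tau t ^+ 2 - (c + u * tau t' ^+ 2)) - u * tau t' ^+ 2 by ring.
  apply: vgeB => //; first exact: vgeB.
  apply: vgeMl => //.
  by have := vgeX vP 2 t1; apply: vge_le.
have u0 := vunit_neq0 d.
have [||z ez] := sqrt_unit u2 ut' (e := (tau t ^+ 2 - c) / u).
- apply: vgeMr => //; first by apply: vgeB => //; apply: s0.
  by apply: (vunit_int); apply: vunitV.
- have -> : (tau t ^+ 2 - c) / u - tau t' ^+ 2 =
     (tau t ^+ 2 - (c + u * tau t' ^+ 2)) / u by field.
  by apply: vgeMr => //; apply: vunit_int; apply: vunitV.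
by exists (tau t), z; rewrite ez; field.
Qed.

End Residue.

(** * Norms and quaternions *)

Section QuadraticNorm.
Variables (K : fieldType) (v : K -> int).
Hypothesis vP : is_discrete_valuation v.
Hypothesis vcompl : vcomplete v.
Variables (A : zmodType) (mul : A -> A -> A) (emb : K -> A) (conj : A -> A).
Variables (Nr Tr : A -> K).
Hypothesis mulDl : forall x y z, mul (x + y) z = mul x z + mul y z.
Hypothesis NrM : forall x y, Nr (mul x y) = Nr x * Nr y.
Hypothesis Nr_conj : forall x, Nr (conj x) = Nr x.
Hypothesis mul_conj : forall x, mul x (conj x) = emb (Nr x).
Hypothesis Nr_shift : forall x al, Nr (x + emb al) = al ^+ 2 + al * Tr x + Nr x.
Hypothesis Nr_aniso : forall x, Nr x = 0 -> x = 0.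
Hypothesis embN : forall al, emb (- al) = - emb al.
Hypothesis Tr_emb : forall al, Tr (emb al) = 2%:R * al.
Hypothesis Nr_emb : forall al, Nr (emb al) = al ^+ 2.

(** The hypotheses on [A] are shared by quaternion algebras and quadratic extensions. A root of the
    characteristic polynomial of [x / d] puts [x] in the base field by anisotropy, where integrality
    is immediate; this is what [trace_integral] asks for. *)
Lemma trace_norm_integral x d : d != 0 -> vge v 0 (Nr x / d ^+ 2) -> vge v 0 (Tr x / d).
Proof.
move=> d0 hN; apply: (trace_integral vP vcompl hN) => al e.
have /Nr_aniso /eqP : Nr (x + emb (- (al * d))) = 0.
  have -> : Nr (x + emb (- (al * d))) = d ^+ 2 * (al ^+ 2 - Tr x / d * al + Nr x / d ^+ 2).
    by rewrite Nr_shift; field.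
  by rewrite e mulr0.
rewrite embN subr_eq0 => /eqP ex; rewrite ex Tr_emb.
have -> : 2%:R * (al * d) / d = 2%:R * al by field.
rewrite ex Nr_emb in hN.
have e2 : (al * d) ^+ 2 / d ^+ 2 = al ^+ 2 by field.
rewrite e2 in hN; apply: vgeMl => //; first exact: vge_nat.
by apply: (@vgeXr _ _ vP 0 al 1); rewrite mul0rn.
Qed.

(** After division by the term of smaller valuation, [N(1 + z) = 1 + Tr z + N z], and the trace of
    [z] is integral as soon as its norm is. The quotient is expressed through [x] times the
    conjugate of [y]. *)
Lemma norm_ultrametric n x y : vge v n (Nr x) -> vge v n (Nr y) -> vge v n (Nr (x + y)).
Proof.
wlog le_yx : x y / Nr y = 0 \/ Nr y != 0 /\ vge v (v (Nr y)) (Nr x).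
  move=> wl hx hy; have [y0|y0] := eqVneq (Nr y) 0; first by apply: wl => //; left.
  have [x0|x0] := eqVneq (Nr x) 0; first by rewrite addrC; apply: wl => //; left.
  case: (leP (v (Nr y)) (v (Nr x))) => h.
    by apply: wl => //; right; rewrite vge_neq0.
  by rewrite addrC; apply: wl => //; right; rewrite vge_neq0 //; split=> //; apply: ltW.
case: le_yx => [/Nr_aniso -> hx _|[y0 le_yx] hx hy]; first by rewrite addr0.
pose w := mul x (conj y).
have hq : vge v 0 (Nr x / Nr y) by apply: (@vge_div _ _ vP (v (Nr y))); rewrite ?add0r.
have e : Nr (x + y) = Nr y * (1 + Tr w / Nr y + Nr x / Nr y).
  apply: (mulIf y0); rewrite -{1}(Nr_conj y) -NrM mulDl mul_conj Nr_shift NrM Nr_conj -/w.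
  by field.
rewrite e; apply: vgeMr => //; apply: vgeD => //; apply: vgeD => //; first exact: vge_1.
apply: trace_norm_integral => //; rewrite NrM Nr_conj.
by have -> : Nr x * Nr y / Nr y ^+ 2 = Nr x / Nr y by field.
Qed.

End QuadraticNorm.

(** * Values of [p^2 - a q^2] and the quaternion norm over a field *)

Section NormForm.
Variable K : fieldType.
Implicit Types a b c : K.

Definition is_norm a b := exists p q : K, b = p ^+ 2 - a * q ^+ 2.

Lemma is_normM a b c : is_norm a b -> is_norm a c -> is_norm a (b * c).
Proof.
move=> [p [q ->]] [r [s ->]]; exists (p * r + a * q * s), (p * s + q * r); ring.
Qed.

Lemma is_norm_sqr a c : is_norm a (c ^+ 2).
Proof. by exists c, 0; ring. Qed.

Lemma is_normN a : is_norm a (- a).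
Proof. by exists 0, 1; ring. Qed.

Lemma is_norm_div a b c : b != 0 -> is_norm a (b * c) -> is_norm a b -> is_norm a c.
Proof.
move=> b0 h1 h2; have -> : c = (b * c) * b * b^-1 ^+ 2 by field.
by apply: is_normM (is_norm_sqr _ _); apply: is_normM.
Qed.

(** The form factors as [(p - c q) (p + c q)]; the witnesses make the factors 1 and [b]. *)
Lemma is_norm_square (c b : K) : 2%:R != 0 :> K -> c != 0 -> is_norm (c ^+ 2) b.
Proof.
move=> n2 c0; exists ((b + 1) / 2%:R), ((b - 1) / (2%:R * c)); field.
by rewrite c0 n2.
Qed.

Lemma is_normC a b : 2%:R != 0 :> K -> b != 0 -> is_norm a b -> is_norm b a.
Proof.
move=> n2 b0 [p [q e]]; have [q0|q0] := eqVneq q 0.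
  have eb : b = p ^+ 2 by rewrite e q0; ring.
  rewrite eb; apply: is_norm_square => //.
  by move: b0; rewrite eb expf_eq0.
by exists (p / q), (q^-1); rewrite e; field.
Qed.

(** The algebra [(a, b)] on the basis [1, i, j, ij], with [i^2 = a], [j^2 = b] and [ji = - ij]. *)
Definition quat_mul a b (x y : K * K * K * K) : K * K * K * K :=
  let: (x0, x1, x2, x3) := x in let: (y0, y1, y2, y3) := y in
  (x0 * y0 + a * x1 * y1 + b * x2 * y2 - a * b * x3 * y3,
   x0 * y1 + x1 * y0 - b * x2 * y3 + b * x3 * y2,
   x0 * y2 + x2 * y0 + a * x1 * y3 - a * x3 * y1,
   x0 * y3 + x3 * y0 + x1 * y2 - x2 * y1).

Definition quat_norm a b (x : K * K * K * K) : K :=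
  let: (x0, x1, x2, x3) := x in x0 ^+ 2 - a * x1 ^+ 2 - b * (x2 ^+ 2 - a * x3 ^+ 2).

Definition quat_conj (x : K * K * K * K) : K * K * K * K :=
  let: (x0, x1, x2, x3) := x in (x0, - x1, - x2, - x3).

(** A nontrivial zero would present [b] as a quotient of two values of [p^2 - a q^2], hence as such
    a value. *)
Lemma quat_aniso a b x : 2%:R != 0 :> K -> a != 0 -> ~ is_norm a b ->
  quat_norm a b x = 0 -> x = 0.
Proof.
move=> n2 a0 nab; case: x => [[[x0 x1] x2] x3] /= e.
have sq (p q : K) : p ^+ 2 - a * q ^+ 2 = 0 -> p = 0 /\ q = 0.
  move=> e1; have [q0|q0] := eqVneq q 0.
    by move: e1; rewrite q0 expr0n mulr0 subr0 => /eqP; rewrite expf_eq0 /= => /eqP ->.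
  have ea : a = (p / q) ^+ 2.
    by rewrite -[a](mulfK (expf_neq0 2 q0)) -(subr0_eq e1); field.
  case: nab; rewrite ea; apply: is_norm_square => //.
  by move: a0; rewrite ea expf_eq0.
have [e2|n] := eqVneq (x2 ^+ 2 - a * x3 ^+ 2) 0.
  have [-> ->] := sq _ _ e2; rewrite e2 mulr0 subr0 in e.
  by have [-> ->] := sq _ _ e.
case: nab; apply: (is_norm_div n); last by exists x2, x3.
by exists x0, x1; rewrite mulrC; apply/esym/subr0_eq.
Qed.

End NormForm.
Arguments quat_conj {K} x.

(** * Quaternion division algebras contain the unramified quadratic extension *)

Section LocalField.
Variables (K : fieldType) (v : K -> int).
Hypothesis vP : is_discrete_valuation v.
Hypothesis vcompl : vcomplete v.
Hypothesis vfin : finite_residue_field v.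
Hypothesis nz2 : (2%:R : K) != 0.
Implicit Types a b c : K.

Section Quaternion.
Variables a b : K.
Hypotheses (a0 : a != 0) (b0 : b != 0) (nab : ~ is_norm a b).

Local Notation Q := (K * K * K * K)%type.
Let mul := quat_mul a b.
Let nrm := quat_norm a b.
Let emb (x : K) : Q := (x, 0, 0, 0).

Let mulDl x y z : mul (x + y) z = mul x z + mul y z.
Proof.
case: x y z => [[[x0 x1] x2] x3] [[[y0 y1] y2] y3] [[[z0 z1] z2] z3].
by congr (_, _, _, _) => /=; ring.
Qed.

Let nrmM x y : nrm (mul x y) = nrm x * nrm y.
Proof.
case: x y => [[[x0 x1] x2] x3] [[[y0 y1] y2] y3]; rewrite /nrm /mul /=; ring.
Qed.

Let nrm_ultra n x y : vge v n (nrm x) -> vge v n (nrm y) -> vge v n (nrm (x + y)).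
Proof.
apply: (@norm_ultrametric _ _ vP vcompl Q mul emb quat_conj nrm
         (fun x : Q => 2%:R * x.1.1.1)) => // {x y}.
- by move=> [[[x0 x1] x2] x3]; rewrite /nrm /=; ring.
- move=> [[[x0 x1] x2] x3]; rewrite /nrm /emb /=; congr (_, _, _, _); ring.
- move=> [[[x0 x1] x2] x3] al; rewrite /nrm /emb /=; ring.
- by move=> x; apply: quat_aniso.
- by move=> al; rewrite /emb; congr (_, _, _, _); rewrite /= oppr0.
- by move=> al; rewrite /nrm /emb /=; ring.
Qed.

Let nrmN x : nrm (- x) = nrm x.
Proof. by case: x => [[[x0 x1] x2] x3]; rewrite /nrm /=; ring. Qed.

Let nrmZ c x : nrm (mul (emb c) x) = c ^+ 2 * nrm x.
Proof. by case: x => [[[x0 x1] x2] x3]; rewrite /nrm /mul /emb /=; ring. Qed.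

(* If every integral quaternion were congruent to an integer of [K] modulo the
   maximal ideal, then commutators of integral quaternions would be divisible
   by every power of a uniformizer [Pi], and the algebra would be commutative. *)
Lemma quat_residue_nontrivial : exists2 x : Q, vge v 0 (nrm x) &
  forall al, vge v 0 al -> ~~ vge v 1 (nrm (x - emb al)).
Proof.
apply: contrapT => nex.
have res x : vge v 0 (nrm x) -> exists2 al, vge v 0 al & vge v 1 (nrm (x - emb al)).
  move=> hx; apply: contrapT => h; apply: nex; exists x => // al hal.
  by apply/negP => h'; apply: h; exists al.
(* [Pi] has the least positive norm valuation [e]. If no norm has valuation 1, a uniformizer of [K]
   serves, with [e = 2]. *)
have [e [Pi [e1 Pi0 ePi hPi]]] : exists (e : int) (Pi : Q), [/\ 1 <= e, nrm Pi != 0,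
    v (nrm Pi) = e & forall x, vge v 1 (nrm x) -> vge v e (nrm x)].
  case: (pselect (exists2 x, nrm x != 0 & v (nrm x) = 1)) => [[x x0 hx]|nx].
    by exists 1, x; split.
  have [_ _ [p [p0 hp]]] := vP; exists 2, (emb p).
  have ne : nrm (emb p) = p ^+ 2 by rewrite /nrm /emb /=; ring.
  split=> //; rewrite ?ne ?expf_neq0 ?valuationX ?hp // => x.
  have [->|x0] := eqVneq (nrm x) 0; first by rewrite !vge_0.
  rewrite !vge_neq0 // => h; case: (eqVneq (v (nrm x)) 1) => h1; last by lia.
  by case: nx; exists x.
pose br x y : Q := mul x y - mul y x.
have brE n (x y : Q) : vge v 0 (nrm x) -> vge v 0 (nrm y) -> vge v n%:Z (nrm (br x y)).
  elim: n x y => [|n IH] x y hx hy.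
    by apply: nrm_ultra; rewrite ?nrmN nrmM vgeMl.
  have dec z : vge v 0 (nrm z) -> exists al z', vge v 0 (nrm z') /\ z = emb al + mul Pi z'.
    move=> hz; have [al hal h] := res z hz.
    exists al, (mul (emb (nrm Pi)^-1) (mul (quat_conj Pi) (z - emb al))); split.
      have nc w : nrm (quat_conj w) = nrm w.
        by case: w => [[[x0 x1] x2] x3]; rewrite /nrm /=; ring.
      rewrite nrmZ nrmM nc.
      have -> : (nrm Pi)^-1 ^+ 2 * (nrm Pi * nrm (z - emb al)) = nrm (z - emb al) / nrm Pi.
        by field.
      by apply: (vge_div vP Pi0 (lexx _)); rewrite add0r ePi; apply: hPi.
    case: (Pi) (z) Pi0 => [[[p0 p1] p2] p3] [[[z0 z1] z2] z3].
    rewrite /nrm /= => P0.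
    by congr (_, _, _, _); rewrite /= ?add0r; field.
  have [al [x' [hx' ->]]] := dec x hx; have [be [y' [hy' ->]]] := dec y hy.
  (* Scalars drop out of the commutator and a factor [Pi] comes out on the left; each remaining term
     contains a commutator covered by the induction hypothesis. *)
  have -> : br (emb al + mul Pi x') (emb be + mul Pi y') =
     mul Pi (mul (br x' Pi) y' - mul (br y' Pi) x' + mul Pi (br x' y')).
    clear; case: (Pi) x' y' => [[[p0 p1] p2] p3] [[[x0 x1] x2] x3] [[[y0 y1] y2] y3].
    by congr (_, _, _, _); rewrite /br /emb /mul /=; ring.
  have iPi : vge v 0 (nrm Pi) by rewrite vge_neq0 // ePi; apply: le_trans e1.
  rewrite nrmM; have -> : n.+1%:Z = 1 + n%:Z by lia.
  apply: vgeM => //; first by rewrite vge_neq0 // ePi.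
  apply: nrm_ultra; first apply: nrm_ultra.
  - by rewrite nrmM vgeMr // IH.
  - by rewrite nrmN nrmM vgeMr // IH.
  - by rewrite nrmM vgeMl // IH.
have scale (c : K) : c != 0 -> exists2 d, d != 0 & vge v 0 (d ^+ 2 * c).
  move=> c0; have [_ _ [p [p0 hp]]] := vP.
  exists (p ^+ `|v c|%N); first by rewrite expf_neq0.
  rewrite vge_neq0 ?mulf_neq0 ?expf_neq0 // valuationM ?expf_neq0 //.
  rewrite !valuationX ?expf_neq0 // hp.
  by rewrite mulrnAC -mulrnA; rewrite -[_ *+ _]mulr_natr mul1r natz; lia.
have [s s0 hs] := scale _ a0; have [t t0 ht] := scale _ b0.
have h n : vge v n%:Z (nrm (br (0, s, 0, 0) (0, 0, t, 0))).
  by apply: brE; rewrite -(vgeN vP); [move: hs|move: ht]; congr vge; rewrite /nrm /=; ring.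
have e0 : nrm (br (0, s, 0, 0) (0, 0, t, 0)) = a * b * (2%:R * s * t) ^+ 2.
  by rewrite /nrm /br /mul /=; ring.
have n0 : a * b * (2%:R * s * t) ^+ 2 != 0.
  by rewrite mulf_neq0 ?mulf_neq0 ?expf_neq0 ?mulf_neq0.
have := h (`|v (a * b * (2%:R * s * t) ^+ 2)|%N.+1).
by rewrite e0 vge_neq0 //; lia.
Qed.

(** The left side is the square of the pure quaternion [(0, x, y, z)], so the equation embeds the
    unramified extension. The source is an integral quaternion not congruent to a scalar: its
    characteristic polynomial has no residual root and is brought to the form [X^2 - X + N]. *)
Lemma quat_unramified : exists N x y z,
  unram v N /\ a * x ^+ 2 + b * y ^+ 2 - a * b * z ^+ 2 = 1 - 4%:R * N.
Proof.
have [[[[x0 x1] x2] x3] hx hr] := quat_residue_nontrivial.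
pose T := 2%:R * x0; pose N := nrm (x0, x1, x2, x3).
have hN : vge v 0 N by [].
have nr al : vge v 0 al -> ~~ vge v 1 (al ^+ 2 - T * al + N).
  move=> /hr; congr (~~ vge _ _ _).
  by rewrite /N /T /nrm /emb /=; ring.
have hT : vge v 0 T.
  apply: (trace_integral vP vcompl hN) => al e.
  case: (boolP (vge v 0 al)) => [/nr|]; first by rewrite e vge_0.
  have e1 : nrm ((x0, x1, x2, x3) + emb (- al)) = 0.
    by rewrite -e /N /T /nrm /emb /=; ring.
  have [] := quat_aniso nz2 a0 nab e1; rewrite !addr0 => /eqP.
  rewrite subr_eq0 => /eqP <- h1 h2 h3 /negP[].
  apply: (@vgeXr _ _ vP 0 x0 1); rewrite mul0rn.
  by move: hN; rewrite /N /nrm /= h1 h2 h3; congr vge; ring.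
have n4 : (4%:R : K) != 0 by rewrite (natrM K 2 2) mulf_neq0.
have i2 := vge_nat vP 2.
case: (two_val vP) => [u2|h2].
  have u4 : vunit v 4%:R by rewrite (natrM K 2 2) vunitM.
  exists ((1 - (T ^+ 2 - 4%:R * N)) / 4%:R), (2%:R * x1), (2%:R * x2), (2%:R * x3).
  split; last by rewrite /N /T /nrm /=; field.
  split.
    apply: vgeMr => //; last by rewrite vunit_int // vunitV.
    apply: vgeB => //; first exact: vge_1.
    by apply: vgeB => //; [have := vgeX vP 2 hT | apply: vgeMl => //; apply: vge_nat].
  move=> y hy.
  have hy' : vge v 0 ((T + (2%:R * y - 1)) / 2%:R).
    apply: vgeMr => //; last by rewrite vunit_int // vunitV.
    by apply: vgeD => //; apply: vgeB; rewrite ?vge_1 ?vgeMl.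
  have := nr _ hy'; congr (~~ _).
  by congr (vge _ _ _); field; rewrite n4 nz2.
(* With [T] in the maximal ideal the residual polynomial would be [X^2 + N], which has a root in
   residue characteristic 2. *)
have uT : vunit v T.
  apply/(vunitP v); split=> //; apply/negP => T1.
  have [y hy e] := sqr_surj_mod vP vfin h2 hN.
  have /negP[] := nr _ hy.
  have -> : y ^+ 2 - T * y + N = (N - y ^+ 2) + 2%:R * y ^+ 2 - T * y by ring.
  apply: vgeB => //; last by apply: vgeMr.
  by apply: vgeD => //; apply: vgeMr => //; have := vgeX vP 2 hy.
have T0 := vunit_neq0 uT; have iT := vunit_int (vunitV vP uT).
have iT2 : vge v 0 (T^-1 ^+ 2) by have := vgeX vP 2 iT.
exists (N * T^-1 ^+ 2), (2%:R * x1 / T), (2%:R * x2 / T), (2%:R * x3 / T); split; last first.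
  move: (T0); rewrite /N /nrm /= /T mulf_eq0 (negPf nz2) /= => x00.
  by field; rewrite nz2 x00.
split; first by apply: vgeMr.
move=> y hy; apply/negP => h; have /negP[] := nr _ (vgeMl vP hT hy).
have -> : (T * y) ^+ 2 - T * (T * y) + N = T ^+ 2 * (y ^+ 2 - y + N * T^-1 ^+ 2) by field.
by apply: vgeMl => //; have := vgeX vP 2 hT.
Qed.

End Quaternion.

End LocalField.

(** * Index of norm groups, quadratic defect and base change *)

Section NormGroups.
Variables (K : fieldType) (v : K -> int).
Hypothesis vP : is_discrete_valuation v.
Hypothesis vcompl : vcomplete v.
Hypothesis vfin : finite_residue_field v.
Hypothesis nz2 : (2%:R : K) != 0.
Implicit Types a b c : K.

Lemma valuation_surj (k : int) : exists2 d, d != 0 & v d = k.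
Proof.
have [_ _ [p [p0 hp]]] := vP.
have h (n : nat) : v (p ^+ n) = n%:Z by rewrite valuationX // hp -mulr_natr mul1r natz.
case: (leP 0 k) => k0.
  by exists (p ^+ `|k|%N); rewrite ?expf_neq0 // h; move: k0; clear; lia.
exists (p ^+ `|k|%N)^-1; first by rewrite invr_neq0 ?expf_neq0.
by rewrite valuationV ?expf_neq0 // h; move: k0; clear; lia.
Qed.

Lemma int_parity (n : int) : (exists k, n = 2%:Z * k) \/ (exists k, n = 2%:Z * k + 1).
Proof.
have : n = 2%:Z * (n %/ 2)%Z \/ n = 2%:Z * (n %/ 2)%Z + 1 by clear; lia.
by case=> h; [left|right]; exists (n %/ 2)%Z.
Qed.

Lemma valuation_sqr c : c != 0 -> v (c ^+ 2) = 2%:Z * v c.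
Proof. by move=> c0; rewrite expr2 valuationM //; clear; lia. Qed.

Lemma unram_norm_even N c k : unram v N -> c != 0 -> v c = 2%:Z * k ->
  is_norm (1 - 4%:R * N) c.
Proof.
move=> uN c0 hc; have [d d0 hd] := valuation_surj k.
have uc : vunit v (c / d ^+ 2).
  apply/andP; split; first by rewrite mulf_neq0 ?invr_neq0 ?expf_neq0.
  by rewrite valuationM ?invr_neq0 ?expf_neq0 // valuationV ?expf_neq0 // valuation_sqr // hd hc subrr.
have [x [y e]] := unram_norm vP vcompl vfin nz2 uN uc.
exists (d * (x + y / 2%:R)), (d * y / 2%:R).
have -> : c = (c / d ^+ 2) * d ^+ 2 by field.
by rewrite e; field.
Qed.

(** A chain of common slots [(a, b) = (a, e) = (u, e)] with [u = 1 - 4 N]. The valuation of [e] must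
    be odd, since elements of even valuation are norms from the unramified extension and the algebra
    would split. *)
Lemma quat_slot a b : a != 0 -> b != 0 -> ~ is_norm a b ->
  exists N e k, [/\ unram v N, e != 0, v e = 2%:Z * k + 1,
    is_norm a (b * e) & is_norm e (a * (1 - 4%:R * N))].
Proof.
move=> a0 b0 nab.
have [N [x [y [z [uN eu]]]]] := quat_unramified vP vcompl vfin nz2 a0 b0 nab.
set u := 1 - 4%:R * N in eu *.
have u0 : u != 0 := vunit_neq0 (unram_disc vP nz2 uN).
suff [e [e0 h1 h2]] : exists e, [/\ e != 0, is_norm a (b * e) & is_norm e (a * u)].
  have nu : ~ is_norm u e.
    move=> h; apply: nab; apply: (is_norm_div e0); first by rewrite mulrC.
    apply: is_normC => //; apply: (is_norm_div u0); first by rewrite mulrC.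
    exact: is_normC.
  case: (int_parity (v e)) => -[k hk]; last by exists N, e, k.
  by case: nu; apply: unram_norm_even hk.
pose w := b * (y ^+ 2 - a * z ^+ 2).
have eu' : u = a * x ^+ 2 + w by rewrite -eu /w; ring.
have [w0|w0] := eqVneq w 0.
  exists b; split=> //; first by rewrite -expr2; apply: is_norm_sqr.
  have -> : a * u = (a * x) ^+ 2 by rewrite eu' w0; ring.
  exact: is_norm_sqr.
(* From [u = a x^2 + w] one gets [a u = (a x)^2 - (- a w)], which exhibits [a u] as a norm for
   [- a w]. *)
exists (- a * w); split; first by rewrite mulf_neq0 ?oppr_eq0.
  have -> : b * (- a * w) = - a * (b ^+ 2 * (y ^+ 2 - a * z ^+ 2)) by rewrite /w; ring.
  apply: is_normM; first exact: is_normN.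
  by apply: is_normM; [apply: is_norm_sqr | exists y, z].
by exists (a * x), 1; rewrite eu'; ring.
Qed.

(* There is only one quaternion division algebra over [K]. *)
Lemma is_norm_index2 a b b' : a != 0 -> b != 0 -> b' != 0 ->
  ~ is_norm a b -> ~ is_norm a b' -> is_norm a (b * b').
Proof.
move=> a0 b0 b0' nb nb'.
have [N [e [k [uN e0 he h1 h2]]]] := quat_slot a0 b0 nb.
have [N' [e' [k' [uN' e0' he' h1' h2']]]] := quat_slot a0 b0' nb'.
set u := 1 - 4%:R * N in h2 *; set u' := 1 - 4%:R * N' in h2' *.
have u0 : u != 0 := vunit_neq0 (unram_disc vP nz2 uN).
have u0' : u' != 0 := vunit_neq0 (unram_disc vP nz2 uN').
have [f f0 ef] := unram_unique vP vcompl vfin nz2 uN uN'; rewrite -/u -/u' in ef.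
have h3 : is_norm e' (a * u).
  have -> : a * u = (a * u') * (f / u') ^+ 2 by rewrite exprMn -ef; field.
  by apply: is_normM (is_norm_sqr _ _).
have au0 : a * u != 0 by rewrite mulf_neq0.
(* Since [u] and [u'] agree up to squares, [a u] is a norm for both [e] and [e']. The product [e e']
   has even valuation, so [u] is a norm for it as well, and therefore [a] is. *)
have h4 : is_norm (e * e') (a * u).
  apply: is_normC => //; first by rewrite mulf_neq0.
  by apply: is_normM; apply: is_normC.
have h5 : is_norm (e * e') u.
  apply: is_normC => //; first by rewrite mulf_neq0.
  apply: (@unram_norm_even _ _ (k + k' + 1)) => //; first by rewrite mulf_neq0.
  by rewrite valuationM // he he'; clear; lia.
have h6 : is_norm a (e * e').
  apply: is_normC => //; apply: (is_norm_div u0) => //.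
  by rewrite [u * a]mulrC.
apply: (is_norm_div (b := e * e')) => //; first by rewrite mulf_neq0.
have -> : e * e' * (b * b') = (b * e) * (b' * e') by ring.
exact: is_normM.
Qed.

(* The quadratic defect: [eps] is a square up to an error of odd valuation,
   unless it is a square or the discriminant of the unramified extension. *)
Lemma quadratic_defect eps : eps != 0 ->
  [\/ exists x k, eps - x ^+ 2 != 0 /\ v (eps - x ^+ 2) = 2%:Z * k + 1,
      exists2 c, c != 0 & eps = c ^+ 2 |
      exists N c, [/\ unram v N, c != 0 & eps = c ^+ 2 * (1 - 4%:R * N)] ].
Proof.
wlog ue : eps / vunit v eps => [wl e0|_].
  case: (int_parity (v eps)) => -[k hk]; last first.
    by constructor 1; exists 0, k; rewrite expr0n subr0.
  have [d d0 hd] := valuation_surj k.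
  have d20 : d ^+ 2 != 0 by rewrite expf_neq0.
  have ue : vunit v (eps / d ^+ 2).
    apply/andP; split; first by rewrite mulf_neq0 ?invr_neq0.
    by rewrite valuationM ?invr_neq0 // valuationV // valuation_sqr // hd hk subrr.
  have ee : eps = d ^+ 2 * (eps / d ^+ 2) by field.
  case: (wl _ ue (vunit_neq0 ue)) => [[x [j [n0 hj]]]|[c c0 ec]|[N [c [uN c0 ec]]]].
  - constructor 1; exists (d * x), (k + j).
    have -> : eps - (d * x) ^+ 2 = d ^+ 2 * (eps / d ^+ 2 - x ^+ 2) by field.
    split; first by rewrite mulf_neq0.
    by rewrite valuationM // hj valuation_sqr // hd; lia.
  - by constructor 2; exists (d * c); rewrite ?mulf_neq0 // ee ec; ring.
  - by constructor 3; exists N, (d * c); split; rewrite ?mulf_neq0 // ee ec; ring.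
have fin N c : c != 0 -> vge v 0 N -> vunit v (1 - 4%:R * N) -> eps = c ^+ 2 * (1 - 4%:R * N) ->
    (exists2 c, c != 0 & eps = c ^+ 2) \/
    exists N c, [/\ unram v N, c != 0 & eps = c ^+ 2 * (1 - 4%:R * N)].
  move=> c0 hN uN ee; case: (pselect (unram v N)) => [|nu]; first by right; exists N, c.
  have [y hy hr] : exists2 y, vge v 0 y & vge v 1 (y ^+ 2 - y + N).
    apply: contrapT => h; apply: nu; split=> // y hy; apply/negP => h'; apply: h; by exists y.
  have [f f0 ef] := root_disc vP vcompl hN hy hr uN.
  by left; exists (c * f); rewrite ?mulf_neq0 // ee ef; ring.
have n4 : (4%:R : K) != 0 by rewrite (natrM K 2 2) mulf_neq0.
case: (two_val vP) => [u2|h2].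
  have u4 : vunit v 4%:R by rewrite (natrM K 2 2) vunitM.
  have e1 : 1 - 4%:R * ((1 - eps) / 4%:R) = eps by field.
  case: (fin ((1 - eps) / 4%:R) 1); rewrite ?oner_eq0 ?e1 ?expr1n ?mul1r //; last 2 first.
  - by move=> h; constructor 2.
  - by move=> h; constructor 3.
  apply: vgeMr => //; last by rewrite vunit_int // vunitV.
  by apply: vgeB => //; [apply: vge_1 | apply: vunit_int].
have he := vunit_int ue.
have v2 : 1 <= v 2%:R by rewrite -vge_neq0.
case: (pselect (exists x k, eps - x ^+ 2 != 0 /\ v (eps - x ^+ 2) = 2%:Z * k + 1)) => [|nodd].
  by constructor 1.
(* An error of even valuation [n + 1 = 2 k] is reduced by adding to [x] a term of valuation at least
   [k]. The cross term has valuation at least [v 2 + k], harmless as long as [n + 2 <= 2 v 2].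
   Precision [v 4] is enough: the error then has the form [4 N x^2] up to sign, with [N]
   integral. *)
have step (n : nat) : n.+1%:Z <= 2%:Z * v 2%:R ->
    exists2 x, vunit v x & vge v n.+1%:Z (eps - x ^+ 2).
  elim: n => [_|n IH hn].
    have [x hx ex] := sqr_surj_mod vP vfin h2 he; exists x => //.
    apply/(vunitP v); split=> //; apply/negP => x1.
    have [_ /negP[]] := vunitP v _ ue.
    rewrite -[eps](subrK (x ^+ 2)) vgeD //.
    by have := vgeX vP 2 x1; apply: vge_le.
  have [|x ux hx] := IH; first by lia.
  case: (boolP (vge v n.+2%:Z (eps - x ^+ 2))) => [h|]; first by exists x.
  rewrite {1}/vge negb_or => /andP[n0 hlt].
  rewrite vge_neq0 // in hx.
  have hv : v (eps - x ^+ 2) = n.+1%:Z by lia.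
  case: (int_parity n.+1%:Z) => -[k hk]; last first.
    by case: nodd; exists x, k; rewrite hv.
  have [d d0 hd] := valuation_surj k.
  have d20 : d ^+ 2 != 0 by rewrite expf_neq0.
  have hq : vge v 0 ((eps - x ^+ 2) / d ^+ 2).
    apply: (vge_div vP d20 (lexx _)).
    by rewrite vge_neq0 // hv valuation_sqr // hd; move: hk; clear; lia.
  have [y hy ey] := sqr_surj_mod vP vfin h2 hq.
  have dy : vge v k (d * y) by rewrite vgeMr // vge_neq0 // hd.
  exists (x + d * y); first by apply: vunit_add => //; apply: vge_le dy; move: hk; clear; lia.
  have -> : eps - (x + d * y) ^+ 2 = d ^+ 2 * ((eps - x ^+ 2) / d ^+ 2 - y ^+ 2)
      - 2%:R * (x * (d * y)) by field.
  apply: vgeB => //.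
    have -> : n.+2%:Z = n.+1%:Z + 1 by clear; lia.
    by apply: vgeM => //; rewrite vge_neq0 // valuation_sqr // hd hk; clear; lia.
  apply: (@vge_le _ _ _ (v 2%:R + (0 + k))); first by move: hn hk; clear; lia.
  apply: vgeM => //; first by rewrite vge_neq0.
  by apply: vgeM => //; apply: vunit_int.
have [n hn] : exists n : nat, n.+1%:Z = 2%:Z * v 2%:R.
  by exists (absz (2%:Z * v 2%:R - 1)%R); move: v2; clear; lia.
have [|x ux hx] := step n; first by rewrite hn.
have x0 := vunit_neq0 ux.
pose N := - ((eps - x ^+ 2) / 4%:R) / x ^+ 2.
have eN : eps = x ^+ 2 * (1 - 4%:R * N) by rewrite /N; field; rewrite n4 x0.
case: (fin N x) => // [||h|h]; last 2 first.
- by constructor 2.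
- by constructor 3.
- apply: vgeMr => //; last by rewrite vunit_int // vunitV // expr2 vunitM.
  rewrite vgeN //; apply: (vge_div vP n4 (lexx _)); apply: vge_le hx.
  by rewrite (natrM K 2 2) valuationM //; lia.
- have -> : 1 - 4%:R * N = eps / x ^+ 2 by rewrite eN; field.
  by rewrite vunitM // vunitV // expr2 vunitM.
Qed.

(** Only [(u, e)] from [quat_slot] has to be split over [L], and the three cases are those of the
    defect of [delta u]. If [delta u - x^2] has odd valuation, then [x^2 - delta u = x^2 - u r^2] is
    a norm for [u] over [L] and corrects [e] to even valuation. If [delta u] is a square, [u] is a
    square in [L]. An unramified discriminant is impossible, as [delta] would be a square. *)
Lemma is_norm_quadratic_ext (L : fieldType) (iota : {rmorphism K -> L}) (delta : K) (r : L) a b :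
  (forall c, delta != c ^+ 2) -> r ^+ 2 = iota delta -> a != 0 -> b != 0 ->
  is_norm (iota a) (iota b).
Proof.
move=> nsq er a0 b0.
have map x y : is_norm x y -> is_norm (iota x) (iota y).
  by case=> p [q ->]; exists (iota p), (iota q); ring.
have nL : (2%:R : L) != 0 by rewrite -(rmorph_nat iota) fmorph_eq0.
case: (pselect (is_norm a b)) => [|nab]; first exact: map.
have [N [e [k [uN e0 he h1 h2]]]] := quat_slot a0 b0 nab.
set u := 1 - 4%:R * N in h2 *.
have u0 : u != 0 := vunit_neq0 (unram_disc vP nz2 uN).
have d0 : delta != 0 by apply: contraTneq (nsq 0) => ->; rewrite expr0n eqxx.
have r0 : r != 0 by apply: contra_neq d0 => r0; apply/eqP; rewrite -(fmorph_eq0 iota) -er r0 expr0n.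
suff hue : is_norm (iota u) (iota e).
  have hae : is_norm (iota a) (iota e).
    apply: is_normC; rewrite ?fmorph_eq0 //.
    apply: (is_norm_div (b := iota u)); rewrite ?fmorph_eq0 //.
      by rewrite -rmorphM mulrC; apply: map.
    by apply: is_normC; rewrite ?fmorph_eq0.
  apply: (is_norm_div (b := iota e)); rewrite ?fmorph_eq0 //.
  by rewrite -rmorphM mulrC; apply: map.
have du0 : delta * u != 0 by rewrite mulf_neq0.
case: (quadratic_defect du0) => [[x [j [n0 hj]]]|[c c0 ec]|[N' [c [uN' c0 ec]]]].
- set g := delta * u - x ^+ 2 in n0 hj.
  apply: (is_norm_div (b := iota (- g))); first by rewrite fmorph_eq0 oppr_eq0.
    rewrite -rmorphM; apply: map; apply: (@unram_norm_even _ _ (j + k + 1)) => //.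
      by rewrite mulf_neq0 ?oppr_eq0.
    by rewrite valuationM ?oppr_eq0 // valuationN // hj he; clear; lia.
  exists (iota x), r; rewrite er -rmorphM -rmorphXn -rmorphB; congr (iota _).
  by rewrite /g; ring.
- have -> : iota u = (iota c / r) ^+ 2.
    have -> : iota u = iota (delta * u) / iota delta.
      by rewrite -fmorph_div; congr (iota _); field.
    by rewrite ec -er rmorphXn; field.
  by apply: is_norm_square => //; rewrite mulf_neq0 ?invr_eq0 ?fmorph_eq0.
- have [f f0 ef] := unram_unique vP vcompl vfin nz2 uN uN'; rewrite -/u in ef.
  have /eqP[] := nsq (c * f / u).
  rewrite !exprMn -ef; have -> : delta = delta * u / u by field.
  by rewrite ec; field.
Qed.

End NormGroups.

(** * Quadratic extensions of local fields *)

Section QuadraticConj.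
Variables (F L : fieldType) (iota : {rmorphism F -> L}) (delta : F) (r : L).
Hypothesis nz2 : (2%:R : F) != 0.
Hypothesis nsq : forall c, delta != c ^+ 2.
Hypothesis er : r ^+ 2 = iota delta.
Hypothesis span : forall z, exists a b, z = iota a + iota b * r.

Lemma quadratic_coord_inj a b a' b' :
  iota a + iota b * r = iota a' + iota b' * r -> a = a' /\ b = b'.
Proof.
move=> e; have [eb|nb] := eqVneq b b'.
  by move: e; rewrite eb => /addIr /fmorph_inj ->.
have b0 : b - b' != 0 by rewrite subr_eq0.
have /eqP[] := nsq ((a' - a) / (b - b')); apply: (fmorph_inj iota).
have ib0 : iota b - iota b' != 0 by rewrite -rmorphB fmorph_eq0.
rewrite -er rmorphXn fmorph_div !rmorphB; congr (_ ^+ 2).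
apply: (mulIf ib0); rewrite divfK //.
apply/eqP; rewrite -subr_eq0; apply/eqP.
have -> : r * (iota b - iota b') - (iota a' - iota a) =
  (iota a + iota b * r) - (iota a' + iota b' * r) by ring.
by rewrite e subrr.
Qed.

Lemma quadratic_conj : exists conj : {rmorphism L -> L},
  (forall a, conj (iota a) = iota a) /\ conj r = - r.
Proof.
have /choice [re hre] := span; have /choice [im him] := hre.
pose cj z := iota (re z) - iota (im z) * r.
have cjE a b : cj (iota a + iota b * r) = iota a - iota b * r.
  by have [e1 e2] := quadratic_coord_inj (him (iota a + iota b * r)); rewrite /cj -e1 -e2.
have cjB x y : cj (x - y) = cj x - cj y.
  rewrite (him x) (him y).
  have -> : iota (re x) + iota (im x) * r - (iota (re y) + iota (im y) * r) =
    iota (re x - re y) + iota (im x - im y) * r by ring.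
  by rewrite !cjE; ring.
have cjM x y : cj (x * y) = cj x * cj y.
  rewrite (him x) (him y); set a := re x; set b := im x; set c := re y; set d := im y.
  have -> : (iota a + iota b * r) * (iota c + iota d * r) =
    iota (a * c + b * d * delta) + iota (a * d + b * c) * r.
    by rewrite !rmorphD !rmorphM -er; ring.
  by rewrite !cjE !rmorphD !rmorphM -er; ring.
have cj1 : cj 1 = 1.
  have -> : (1 : L) = iota 1 + iota 0 * r by rewrite rmorph1 rmorph0; ring.
  by rewrite cjE; ring.
pose cj_a := GRing.isZmodMorphism.Build L L cj cjB.
pose cj_m := GRing.isMonoidMorphism.Build L L cj (cj1, cjM).
pose cjR : {rmorphism L -> L} := HB.pack cj cj_a cj_m.
exists cjR; split=> [a|]; rewrite /=.
  have -> : iota a = iota a + iota 0 * r by rewrite rmorph0; ring.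
  by rewrite cjE rmorph0; ring.
have -> : r = iota 0 + iota 1 * r by rewrite rmorph0 rmorph1; ring.
by rewrite cjE rmorph0 rmorph1; ring.
Qed.

End QuadraticConj.

Section QuadraticExtension.
Variables (F L : fieldType) (iota : {rmorphism F -> L}) (delta : F) (r : L).
Variables (conj : {rmorphism L -> L}).
Hypothesis nz2 : (2%:R : F) != 0.
Hypothesis nsq : forall c, delta != c ^+ 2.
Hypothesis er : r ^+ 2 = iota delta.
Hypothesis span : forall z, exists a b, z = iota a + iota b * r.
Hypothesis conj_iota : forall a, conj (iota a) = iota a.
Hypothesis conj_r : conj r = - r.

Lemma conjE a b : conj (iota a + iota b * r) = iota a - iota b * r.
Proof. by rewrite rmorphD rmorphM !conj_iota conj_r mulrN. Qed.

Lemma conjKq z : conj (conj z) = z.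
Proof. by have [a [b ->]] := span z; rewrite conjE rmorphB rmorphM !conj_iota conj_r; ring. Qed.

Lemma iota_two_neq0 : (2%:R : L) != 0.
Proof. by rewrite -(rmorph_nat iota) fmorph_eq0. Qed.

Lemma delta_neq0 : delta != 0.
Proof. by apply: contraTneq (nsq 0) => ->; rewrite expr0n eqxx. Qed.

Lemma r_neq0 : r != 0.
Proof.
by apply: contra_neq delta_neq0 => r0; apply/eqP; rewrite -(fmorph_eq0 iota) -er r0 expr0n.
Qed.

Lemma norm_exists : exists nrm : L -> F, forall z, iota (nrm z) = z * conj z.
Proof.
have /choice [f hf] z : exists y, iota y = z * conj z; last by exists f.
have [a [b ->]] := span z; exists (a ^+ 2 - delta * b ^+ 2).
have -> : iota (a ^+ 2 - delta * b ^+ 2) = iota a ^+ 2 - iota delta * iota b ^+ 2 by ring.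
by rewrite conjE -er; ring.
Qed.

Variable nrm : L -> F.
Hypothesis nrmE : forall z, iota (nrm z) = z * conj z.

Lemma nrm_coord a b : nrm (iota a + iota b * r) = a ^+ 2 - delta * b ^+ 2.
Proof.
apply: (fmorph_inj iota); rewrite nrmE conjE.
have -> : iota (a ^+ 2 - delta * b ^+ 2) = iota a ^+ 2 - iota delta * iota b ^+ 2 by ring.
by rewrite -er; ring.
Qed.

Lemma nrmM x y : nrm (x * y) = nrm x * nrm y.
Proof. by apply: (fmorph_inj iota); rewrite rmorphM !nrmE rmorphM mulrACA. Qed.

Lemma nrm_iota a : nrm (iota a) = a ^+ 2.
Proof. by apply: (fmorph_inj iota); rewrite nrmE conj_iota rmorphXn. Qed.

Lemma nrm_eq0 z : (nrm z == 0) = (z == 0).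
Proof. by rewrite -(fmorph_eq0 iota) nrmE mulf_eq0 fmorph_eq0 orbb. Qed.

Lemma nrm_conj z : nrm (conj z) = nrm z.
Proof. by apply: (fmorph_inj iota); rewrite !nrmE conjKq mulrC. Qed.

Lemma nrm_r : nrm r = - delta.
Proof. by apply: (fmorph_inj iota); rewrite nrmE conj_r rmorphN -er; ring. Qed.

Section Valuation.
Variable v : F -> int.
Hypothesis vP : is_discrete_valuation v.
Hypothesis vcompl : vcomplete v.
Hypothesis vfin : finite_residue_field v.

Lemma nrm_ultrametric n x y : vge v n (nrm x) -> vge v n (nrm y) -> vge v n (nrm (x + y)).
Proof.
have [tr htr] : exists tr : L -> F, forall z, iota (tr z) = z + conj z.
  have /choice [f hf] z : exists y, iota y = z + conj z; last by exists f.
  have [a [b ->]] := span z; exists (2%:R * a).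
  by rewrite conjE; ring.
apply: (@norm_ultrametric _ _ vP vcompl L *%R iota conj nrm tr) => {x y}.
- exact: mulrDl.
- exact: nrmM.
- exact: nrm_conj.
- by move=> z; rewrite nrmE.
- move=> z al; apply: (fmorph_inj iota).
  rewrite !rmorphD rmorphM rmorphXn !nrmE htr !rmorphD conj_iota; ring.
- by move=> z /eqP; rewrite nrm_eq0 => /eqP.
- by move=> al; rewrite rmorphN.
- by move=> al; apply: (fmorph_inj iota); rewrite htr conj_iota rmorphM rmorph_nat; ring.
- exact: nrm_iota.
Qed.

(** The valuation of [L] is that of the norm divided by [e]. When no norm has valuation 1, all norms
    have even valuation, since division by an element of [F] would otherwise produce 1; then
    [e = 2]. *)
Lemma valuation_ext : exists (w : L -> int) (e : int),
  [/\ 1 <= e <= 2%:Z, forall z, z != 0 -> v (nrm z) = e * w z & is_discrete_valuation w].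
Proof.
have [e [e12 [w hw [z1 z10 hz1]]]] : exists e : int, 1 <= e <= 2%:Z /\
    exists2 w : L -> int, forall z, z != 0 -> v (nrm z) = e * w z & exists2 z, z != 0 & w z = 1.
  case: (pselect (exists2 z, z != 0 & v (nrm z) = 1)) => [h|h].
    by exists 1; split=> //; exists (fun z => v (nrm z)) => // z _; rewrite mul1r.
  exists 2%:Z; split=> //; exists (fun z => (v (nrm z) %/ 2)%Z).
    move=> z z0; case: (int_parity (v (nrm z))) => -[k hk]; first by move: hk; clear; lia.
    have [d d0 hd] := valuation_surj vP k.
    have id0 : iota d != 0 by rewrite fmorph_eq0.
    case: h; exists (z / iota d); first by rewrite mulf_neq0 ?invr_eq0.
    have e1 : nrm z = nrm (z / iota d) * d ^+ 2.
      by rewrite -nrm_iota -nrmM divfK.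
    have n0 : nrm (z / iota d) != 0 by rewrite nrm_eq0 mulf_neq0 ?invr_eq0.
    move: hk; rewrite e1 valuationM ?expf_neq0 // (valuation_sqr vP) // hd.
    by clear; lia.
  have [p p0 hp] := valuation_surj vP 1.
  exists (iota p); first by rewrite fmorph_eq0.
  by rewrite nrm_iota (valuation_sqr vP) // hp.
exists w, e; split=> //; split.
- move=> x y x0 y0; have xy0 : x * y != 0 by rewrite mulf_neq0.
  have := hw _ xy0; rewrite nrmM valuationM ?nrm_eq0 // !hw //.
  rewrite -mulrDr => /mulfI -> //.
  by move: e12; clear; lia.
- move=> x y x0 y0 s0.
  have := @nrm_ultrametric (Num.min (v (nrm x)) (v (nrm y))) x y.
  rewrite !vge_neq0 ?nrm_eq0 // !hw //.
  have -> : Num.min (e * w x) (e * w y) = e * Num.min (w x) (w y).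
    by rewrite minr_pMr //; move: e12; clear; lia.
  have e0 : 0 < e by move: e12; clear; lia.
  rewrite !ler_pM2l // !ge_min !lexx orbT; exact.
- by exists z1.
Qed.

Lemma residues_mod (n : nat) : exists s : seq F, forall x, vge v 0 x ->
  exists2 y, y \in s & vge v n%:Z (x - y).
Proof.
elim: n => [|n [s hs]].
  by exists [:: 0] => x hx; exists 0; rewrite ?inE ?subr0.
have [p p0 hp] := valuation_surj vP n%:Z.
have [t ht] := vfin.
exists [seq y + p * z | y <- s, z <- t] => x hx.
have [y ys hy] := hs x hx.
have hq : vge v 0 ((x - y) / p) by apply: (vge_div vP p0 (lexx _)); rewrite add0r hp.
have [|z zt /vclose_vge hz] := ht ((x - y) / p).
  by move: hq; rewrite /vge; case: eqP => [->|/eqP h]; [left|right].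
exists (y + p * z); first by apply/allpairsP; exists (y, z).
have -> : x - (y + p * z) = p * ((x - y) / p - z) by field.
have -> : n.+1%:Z = n%:Z + 1 by clear; lia.
by apply: vgeM => //; rewrite vge_neq0 // hp.
Qed.

(** Convergence in [L] is convergence of both coordinates: [coord] and [nrmB] bound norms and
    coordinates by each other. The constants [C] and [c0] absorb 2 and [delta], since [1, r] need
    not be an integral basis. *)
Lemma nonarch_local_field_ext : [pchar F] =i pred0 -> nonarch_local_field_char0 L.
Proof.
move=> chF; split; first by move=> p; rewrite (fmorph_pchar iota) chF.
have [w [e [e12 hw wP]]] := valuation_ext; exists w.
have e0 : 0 < e by move: e12; clear; lia.
have d0 := delta_neq0.
have n4 : (4%:R : F) != 0 by rewrite (natrM F 2 2) mulf_neq0.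
have nd : 4%:R * delta != 0 by rewrite mulf_neq0.
have wge n z : vge w n z = vge v (e * n) (nrm z).
  have [->|z0] := eqVneq z 0.
    by rewrite vge_0 -(rmorph0 iota) nrm_iota expr0n vge_0.
  by rewrite !vge_neq0 ?nrm_eq0 // hw // ler_pM2l.
have nrmN z : nrm (- z) = nrm z by apply: (fmorph_inj iota); rewrite !nrmE rmorphN mulrNN.
have trace m a b : vge v m (nrm (iota a + iota b * r)) ->
    vge v m (4%:R * a ^+ 2) /\ vge v m (4%:R * delta * b ^+ 2).
  move=> h; have h' := h; rewrite -nrm_conj conjE in h'; split.
    have := nrm_ultrametric h h'.
    have -> : iota a + iota b * r + (iota a - iota b * r) = iota (2%:R * a) by ring.
    by rewrite nrm_iota; congr vge; ring.
  rewrite -nrmN in h'; have := nrm_ultrametric h h'.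
  have -> : iota a + iota b * r + - (iota a - iota b * r) = iota 0 + iota (2%:R * b) * r by ring.
  by rewrite nrm_coord -(vgeN vP); congr vge; ring.
pose C : int := Num.max 0 (Num.max (v 4%:R) (v (4%:R * delta))).
have C1 : v 4%:R <= C by rewrite /C !le_max lexx !orbT.
have C2 : v (4%:R * delta) <= C by rewrite /C !le_max lexx !orbT.
have sq m x : vge v (m + m) (x ^+ 2) -> vge v m x.
  by move=> h; apply: (@vgeXr _ _ vP m x 1).
have coord m a b : vge v (m + m + C) (nrm (iota a + iota b * r)) -> vge v m a /\ vge v m b.
  move=> /trace [h1 h2]; split; apply: sq.
    have -> : a ^+ 2 = 4%:R * a ^+ 2 / 4%:R by field.
    exact: (vge_div vP n4 C1).
  have -> : b ^+ 2 = 4%:R * delta * b ^+ 2 / (4%:R * delta) by field; rewrite n4 d0.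
  exact: (vge_div vP nd C2).
have nrmB m a b : vge v m a -> vge v m b ->
    vge v (m + m + Num.min 0 (v delta)) (nrm (iota a + iota b * r)).
  move=> ha hb; rewrite nrm_coord; apply: (vgeB vP).
    have := vgeX vP 2 ha; apply: vge_le.
    by rewrite mulr2n gerDl ge_min lexx.
  apply: (@vge_le _ _ _ (v delta + (m + m))).
    by rewrite addrC lerD2r ge_min lexx orbT.
  by apply: (vgeM vP); [rewrite vge_neq0 | have := vgeX vP 2 hb].
pose c0 := Num.min 0 (v delta).
have c00 : c0 <= 0 by rewrite /c0 ge_min lexx.
split=> //.
- move=> u hu.
  have /choice [a ha] := fun n => span (u n); have /choice [b hb] := ha.
  have lim (s : nat -> F) : (forall m : int, exists n0, forall i j, (n0 <= i)%N -> (n0 <= j)%N ->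
        vge v m (s i - s j)) ->
      exists l, forall m : int, exists n0, forall n, (n0 <= n)%N -> vge v m (s n - l).
    move=> hs; have [|l hl] := vcompl (u := s).
      move=> m; have [n0 h] := hs m; exists n0 => i j hi hj; apply/vclose_vge; exact: h.
    by exists l => m; have [n0 h] := hl m; exists n0 => n hn; apply/vclose_vge; exact: h.
  have cau m : exists n0, forall i j, (n0 <= i)%N -> (n0 <= j)%N ->
      vge v m (a i - a j) /\ vge v m (b i - b j).
    have [n0 h] := hu (Num.max 0 (m + m + C)); exists n0 => i j hi hj; apply: coord.
    have -> : iota (a i - a j) + iota (b i - b j) * r = u i - u j by rewrite (hb i) (hb j); ring.
    have /vclose_vge := h i j hi hj; rewrite wge; apply: vge_le.
    by move: e12; clear; nia.
  have [|la hla] := lim a.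
    by move=> m; have [n0 h] := cau m; exists n0 => i j hi hj; case: (h i j hi hj).
  have [|lb hlb] := lim b.
    by move=> m; have [n0 h] := cau m; exists n0 => i j hi hj; case: (h i j hi hj).
  exists (iota la + iota lb * r) => m.
  pose m' := Num.max 0 (m + m) - c0.
  have [n1 h1] := hla m'; have [n2 h2] := hlb m'.
  exists (maxn n1 n2) => n; rewrite geq_max => /andP[k1 k2]; apply/vclose_vge; rewrite wge.
  have -> : u n - (iota la + iota lb * r) = iota (a n - la) + iota (b n - lb) * r.
    by rewrite (hb n); ring.
  apply: vge_le (nrmB _ _ _ (h1 n k1) (h2 n k2)).
  by rewrite /m' -/c0; move: c00 e12; clear; nia.
- have [s s0 hs] : exists2 s : F, s != 0 & vge v 0 (s ^+ 2 * delta).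
    have [s s0 hs] := valuation_surj vP `|v delta|; exists s => //.
    rewrite vge_neq0 ?mulf_neq0 ?expf_neq0 // valuationM ?expf_neq0 //.
    by rewrite (valuation_sqr vP) // hs; clear; lia.
  (* For integral [z] only [2 a] and [2 s delta b] are known to be integral, so [z] is sorted by
     these modulo a high power. A class may contain non-integral elements, and [pk] picks an
     integral member whenever there is one. *)
  pose P (p : F * F) (n : int) (z : L) := exists a b, [/\ z = iota a + iota b * r, vge v 0 (nrm z),
    vge v n (2%:R * a - p.1) & vge v n (2%:R * s * delta * b - p.2)].
  have n2sd : 2%:R * s * delta != 0 by rewrite !mulf_neq0.
  pose n : nat := absz (C + `|v (2%:R * s * delta)| + `|v 2%:R| + 1 - c0)%R.
  have hn1 : v 2%:R + (1 - c0) <= n%:Z by rewrite /n; move: c00; rewrite /C; clear; lia.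
  have hn2 : v (2%:R * s * delta) + (1 - c0) <= n%:Z by rewrite /n; move: c00; rewrite /C; clear; lia.
  have [t ht] := residues_mod n.
  have /choice [pk hpk] : forall p : F * F, exists z, (exists z', P p n%:Z z') -> P p n%:Z z.
    move=> p; case: (pselect (exists z', P p n%:Z z')) => [[z hz]|h]; first by exists z.
    by exists 0 => /h.
  exists [seq pk (x, y) | x <- t, y <- t] => z hz.
  have {}hz : vge v 0 (nrm z).
    by have : vge w 0 z; [move: hz; rewrite /vge => -[->|[_ ->]]; rewrite ?eqxx ?orbT | rewrite wge mulr0].
  have [a [b ez]] := span z; rewrite ez in hz.
  have [h1 h2] := trace _ _ _ hz.
  have iA : vge v 0 (2%:R * a).
    by apply: sq; rewrite addr0; move: h1; congr vge; ring.
  have iB : vge v 0 (2%:R * s * delta * b).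
    apply: sq; rewrite addr0.
    have -> : (2%:R * s * delta * b) ^+ 2 = s ^+ 2 * delta * (4%:R * delta * b ^+ 2) by ring.
    exact: vgeMl.
  have [x xt hx] := ht _ iA; have [y yt hy] := ht _ iB.
  exists (pk (x, y)); first by apply/allpairsP; exists (x, y).
  have [|a' [b' [e' hz' hx' hy']]] := hpk (x, y); first by exists z, a, b; rewrite ez.
  apply/vclose_vge; rewrite wge mulr1 e' ez.
  have -> : iota a + iota b * r - (iota a' + iota b' * r) = iota (a - a') + iota (b - b') * r by ring.
  have ha : vge v (1 - c0) (a - a').
    have -> : a - a' = ((2%:R * a - x) - (2%:R * a' - x)) / 2%:R by field.
    apply: (vge_div vP nz2 (lexx _)).
    by apply: (vgeB vP); [apply: vge_le hx | apply: vge_le hx']; rewrite addrC.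
  have hb : vge v (1 - c0) (b - b').
    have -> : b - b' = ((2%:R * s * delta * b - y) - (2%:R * s * delta * b' - y)) / (2%:R * s * delta).
      by field; rewrite nz2 s0 d0.
    apply: (vge_div vP n2sd (lexx _)).
    by apply: (vgeB vP); [apply: vge_le hy | apply: vge_le hy']; rewrite addrC.
  apply: vge_le (nrmB _ _ _ ha hb); rewrite -/c0; move: c00 e12; clear; lia.
Qed.

End Valuation.
End QuadraticExtension.

(** * The Hilbert symbol *)

(* The quadratic Hilbert symbol of nonzero elements, written additively: [true]
   stands for [-1]. *)
Definition hs (K : fieldType) (a b : K) : bool := ~~ `[< is_norm a b >].

Lemma hilbertE (K : fieldType) (a b : K) : 2%:R != 0 :> K -> a != 0 -> b != 0 ->
  hilbert a b = (-1) ^+ hs a b.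
Proof.
move=> n2 a0 b0; rewrite /hilbert /hs.
set P := (X in `[< X >]); have PE : P <-> is_norm a b.
  split=> [[x [y [z [xyz e]]]]|[p [q e]]]; last first.
    by exists q, 1, p; split; [constructor 2; apply: oner_neq0 | rewrite e; ring].
  have [y0|y0] := eqVneq y 0.
    have [x0|x0] := eqVneq x 0.
      have z0 : z == 0 by rewrite -[z == 0](expf_eq0 z 2) -e x0 y0 !expr0n !mulr0 addr0.
      by case: xyz; rewrite ?x0 ?y0 ?z0 ?eqxx.
    have ea : a = (z / x) ^+ 2.
      rewrite expr_div_n -e y0 expr0n mulr0 addr0 mulfK ?expf_neq0 //.
    by rewrite ea; apply: is_norm_square => //; move: a0; rewrite ea expf_eq0.
  exists (z / y), (x / y); rewrite expr_div_n -e; by field.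
have -> : `[< P >] = `[< is_norm a b >] by apply/asboolP/asboolP => /PE.
by case: `[< is_norm a b >].
Qed.

Lemma hilbert0l (K : fieldType) (b : K) : hilbert 0 b = 1.
Proof.
rewrite /hilbert; case: asboolP => // -[]; exists 1, 0, 0; split; last by ring.
by constructor 1; apply: oner_neq0.
Qed.

Lemma hilbert0r (K : fieldType) (a : K) : hilbert a 0 = 1.
Proof.
rewrite /hilbert; case: asboolP => // -[]; exists 0, 1, 0; split; last by ring.
by constructor 2; apply: oner_neq0.
Qed.

Section Symbol.
Variable K : fieldType.
Hypothesis nz2 : (2%:R : K) != 0.
Hypothesis index2 : forall a b b' : K, a != 0 -> b != 0 -> b' != 0 ->
  ~ is_norm a b -> ~ is_norm a b' -> is_norm a (b * b').
Implicit Types a b c x y z : K.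

Lemma hsP a b : reflect (is_norm a b) (~~ hs a b).
Proof. by rewrite /hs negbK; apply: asboolP. Qed.

Lemma hs_norm a b : is_norm a b -> hs a b = false.
Proof. by move=> h; apply/negbTE/hsP. Qed.

Lemma hs_not_norm a b : hs a b = true -> ~ is_norm a b.
Proof. by move=> h n; have /hsP := n; rewrite h. Qed.

Lemma not_norm_hs a b : ~ is_norm a b -> hs a b = true.
Proof. by move=> h; case e: (hs a b) => //; case: h; apply/hsP; rewrite e. Qed.

(** Index at most two says that a product of two non-norms is a norm; the other three cases only use
    that norms form a group. *)
Lemma hsMr a b c : a != 0 -> b != 0 -> c != 0 -> hs a (b * c) = hs a b (+) hs a c.
Proof.
move=> a0 b0 c0; case hb: (hs a b); case hc: (hs a c) => /=.
- by apply: hs_norm; apply: index2 => //; apply: hs_not_norm.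
- apply: not_norm_hs => h; apply: (hs_not_norm hb).
  apply: (is_norm_div c0); first by rewrite mulrC.
  by apply/hsP; rewrite hc.
- apply: not_norm_hs => h; apply: (hs_not_norm hc).
  by apply: (is_norm_div b0 h); apply/hsP; rewrite hb.
- by apply: hs_norm; apply: is_normM; apply/hsP; rewrite ?hb ?hc.
Qed.

Lemma hsC a b : a != 0 -> b != 0 -> hs a b = hs b a.
Proof.
move=> a0 b0; apply/negb_inj; apply/hsP/hsP; exact: is_normC.
Qed.

Lemma hsMl a b c : a != 0 -> b != 0 -> c != 0 -> hs (a * b) c = hs a c (+) hs b c.
Proof. by move=> a0 b0 c0; rewrite hsC ?mulf_neq0 // hsMr // ![hs c _]hsC. Qed.

Lemma hs_sqrr a c : hs a (c ^+ 2) = false.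
Proof. by apply: hs_norm; apply: is_norm_sqr. Qed.

Lemma hs_sqrl a c : c != 0 -> hs (c ^+ 2) a = false.
Proof. by move=> c0; apply: hs_norm; apply: is_norm_square. Qed.

Lemma hs1r a : hs a 1 = false.
Proof. by rewrite -(expr1n _ 2) hs_sqrr. Qed.

Lemma hs1l a : hs 1 a = false.
Proof. by rewrite -(expr1n _ 2) hs_sqrl ?oner_eq0. Qed.

Lemma hsNN a : hs a (- a) = false.
Proof. by apply: hs_norm; apply: is_normN. Qed.

Lemma hsVr a b : a != 0 -> b != 0 -> hs a b^-1 = hs a b.
Proof.
move=> a0 b0; have -> : b^-1 = b * (b^-1) ^+ 2 by field.
by rewrite hsMr ?expf_neq0 ?invr_eq0 // hs_sqrr addbF.
Qed.

Lemma hsVl a b : a != 0 -> b != 0 -> hs a^-1 b = hs a b.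
Proof. by move=> a0 b0; rewrite hsC ?invr_eq0 // hsVr // hsC. Qed.

Lemma hsNr a b : a != 0 -> b != 0 -> hs a (- b) = hs a (-1) (+) hs a b.
Proof.
move=> a0 b0; have n1 : (-1 : K) != 0 by rewrite oppr_eq0 oner_eq0.
by rewrite -[- b]mulN1r hsMr.
Qed.

Lemma hsNl a b : a != 0 -> b != 0 -> hs (- a) b = hs (-1) b (+) hs a b.
Proof.
move=> a0 b0; have n1 : (-1 : K) != 0 by rewrite oppr_eq0 oner_eq0.
by rewrite -[- a]mulN1r hsMl.
Qed.

Lemma hsaa a : a != 0 -> hs a a = hs (-1) a.
Proof.
move=> a0; have n1 : (-1 : K) != 0 by rewrite oppr_eq0 oner_eq0.
have := hsNN a; rewrite hsNr // (hsC a0 n1).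
by case: (hs (-1) a); case: (hs a a).
Qed.

(** The Steinberg relation [(x / z, y / z) = 1], with denominators cleared by squares. *)
Lemma hs_sum x y z : x != 0 -> y != 0 -> z != 0 -> x + y = z -> hs (x * z) (y * z) = false.
Proof.
by move=> x0 y0 z0 e; apply: hs_norm; exists z, 1; rewrite -e; ring.
Qed.

End Symbol.

Lemma local_index2 (K : fieldType) : nonarch_local_field_char0 K ->
  forall a b b' : K, a != 0 -> b != 0 -> b' != 0 ->
  ~ is_norm a b -> ~ is_norm a b' -> is_norm a (b * b').
Proof.
move=> [ch [v [vP vc vf]]]; apply: (is_norm_index2 vP vc vf).
by have /pcharf0P -> := ch.
Qed.

(* Linear identities over F_2 by reflection: atoms are indexed, and a list of
   indices is reduced by cancelling equal pairs. *)
Inductive xor_term := XAtom of nat | XAdd of xor_term & xor_term | XFalse.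

Fixpoint xor_val (e : seq bool) t := match t with
  | XAtom n => nth false e n
  | XAdd a b => xor_val e a (+) xor_val e b
  | XFalse => false
  end.

Fixpoint xor_atoms t := match t with
  | XAtom n => [:: n]
  | XAdd a b => xor_atoms a ++ xor_atoms b
  | XFalse => [::]
  end.

Definition xor_toggle (n : nat) (l : seq nat) := if n \in l then rem n l else n :: l.

Lemma xor_term_eq e a b :
  foldr xor_toggle [::] (xor_atoms a ++ xor_atoms b) = [::] -> xor_val e a = xor_val e b.
Proof.
have val_cat (t : xor_term) : xor_val e t = \big[addb/false]_(i <- xor_atoms t) nth false e i.
  by elim: t => [n|x IHx y IHy|] /=; rewrite ?big_seq1 ?big_cat ?big_nil ?IHx ?IHy.
have togg s : \big[addb/false]_(i <- foldr xor_toggle [::] s) nth false e i =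
    \big[addb/false]_(i <- s) nth false e i.
  elim: s => //= n s IH; rewrite big_cons -IH /xor_toggle; case: ifP => h.
    by rewrite [in RHS](perm_big _ (perm_to_rem h)) big_cons addbA addbb.
  by rewrite big_cons.
move=> h; have := togg (xor_atoms a ++ xor_atoms b).
rewrite h big_nil big_cat -!val_cat.
by case: (xor_val e a); case: (xor_val e b).
Qed.

(** Feeds a known relation into a goal over F_2. After the relevant relations have been added,
    [xor_solve] only has to cancel equal atoms. *)
Lemma xor_use (f g a b : bool) : f = g -> a (+) f = b (+) g -> a = b.
Proof. by move=> ->; apply: addIb. Qed.

Ltac xor_index t e := lazymatch e with
  | ?x :: ?e' => lazymatch constr:(x = t) with
     | ?y = ?y => constr:(0%N)
     | _ => let n := xor_index t e' in constr:(S n) end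
  end.

Ltac xor_env t e := lazymatch t with
  | ?a (+) ?b => let e' := xor_env a e in xor_env b e'
  | false => e
  | _ => match goal with
    | _ => let n := xor_index t e in e
    | _ => constr:(t :: e) end
  end.

Ltac xor_reify t e := lazymatch t with
  | ?a (+) ?b => let a' := xor_reify a e in let b' := xor_reify b e in constr:(XAdd a' b')
  | false => constr:(XFalse)
  | _ => let n := xor_index t e in constr:(XAtom n)
  end.

Ltac xor_solve := lazymatch goal with |- ?a = ?b =>
  let e1 := xor_env a (@nil bool) in let e := xor_env b e1 in
  let a' := xor_reify a e in let b' := xor_reify b e in
  refine (@xor_term_eq e a' b' _); reflexivity end.

Ltac nonzero := repeat first
  [ done | apply: mulf_neq0 | rewrite invr_eq0 | rewrite oppr_eq0 | rewrite fmorph_eq0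
  | apply: expf_neq0 | rewrite oner_eq0 ].

Ltac hs_expand n2 idx := repeat match goal with
  | |- context [hs (?a * ?b) ?x] =>
      rewrite (@hsMl _ n2 idx a b x ltac:(nonzero) ltac:(nonzero) ltac:(nonzero))
  | |- context [hs ?x (?a * ?b)] =>
      rewrite (@hsMr _ idx x a b ltac:(nonzero) ltac:(nonzero) ltac:(nonzero))
  | |- context [hs (?a^-1) ?x] =>
      rewrite (@hsVl _ n2 idx a x ltac:(nonzero) ltac:(nonzero))
  | |- context [hs ?x (?a^-1)] =>
      rewrite (@hsVr _ idx x a ltac:(nonzero) ltac:(nonzero))
  | |- context [hs (- ?a) ?x] =>
      lazymatch a with 1 => fail
      | _ => rewrite (@hsNl _ n2 idx a x ltac:(nonzero) ltac:(nonzero)) end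
  | |- context [hs ?x (- ?a)] =>
      lazymatch a with 1 => fail
      | _ => rewrite (@hsNr _ idx x a ltac:(nonzero) ltac:(nonzero)) end
  | |- context [hs ?x ?x] =>
      lazymatch x with -1 => fail
      | _ => rewrite (@hsaa _ n2 idx x ltac:(nonzero)) end
  end.

Ltac hs_sym n2 := repeat match goal with
  | |- context [hs ?a ?b] => match goal with |- context [hs b a] =>
      tryif constr_eq a b then fail else rewrite (@hsC _ n2 a b ltac:(nonzero) ltac:(nonzero)) end
  end.

Section BaseChangeSymbols.
Variables (F L : fieldType) (iota : {rmorphism F -> L}).
Hypothesis splitFL : forall a b : F, a != 0 -> b != 0 -> is_norm (iota a) (iota b).

Lemma hs_iota a b : a != 0 -> b != 0 -> hs (iota a) (iota b) = false.
Proof. by move=> a0 b0; apply: hs_norm; apply: splitFL. Qed.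

Lemma hs_N1_iota b : b != 0 -> hs (-1) (iota b) = false.
Proof. by move=> b0; rewrite -(rmorphN1 iota) hs_iota ?oppr_eq0 ?oner_eq0. Qed.

Lemma hs_iota_N1 b : b != 0 -> hs (iota b) (-1) = false.
Proof. by move=> b0; rewrite -(rmorphN1 iota) hs_iota ?oppr_eq0 ?oner_eq0. Qed.

Lemma hs_N1_N1 : hs (-1 : L) (-1) = false.
Proof. by rewrite -(rmorphN1 iota) hs_iota ?oppr_eq0 ?oner_eq0. Qed.

End BaseChangeSymbols.

(* The rewriting lemmas [iotaM], [iotaN], [iotaV] fix the canonical structures
   that the tactics below match syntactically. *)
Lemma iotaM (F L : fieldType) (iota : {rmorphism F -> L}) a b : iota (a * b) = iota a * iota b.
Proof. exact: rmorphM. Qed.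

Lemma iotaN (F L : fieldType) (iota : {rmorphism F -> L}) a : iota (- a) = - iota a.
Proof. exact: rmorphN. Qed.

Lemma iotaV (F L : fieldType) (iota : {rmorphism F -> L}) a : iota a^-1 = (iota a)^-1.
Proof. exact: fmorphV. Qed.

Ltac hs_base iota split := repeat match goal with
  | |- context [hs (@GRing.RMorphism.sort _ _ iota ?a) (@GRing.RMorphism.sort _ _ iota ?b)] =>
      rewrite (@hs_iota _ _ iota split a b ltac:(nonzero) ltac:(nonzero))
  | |- context [hs (-1) (@GRing.RMorphism.sort _ _ iota ?b)] =>
      rewrite (@hs_N1_iota _ _ iota split b ltac:(nonzero))
  | |- context [hs (@GRing.RMorphism.sort _ _ iota ?b) (-1)] =>
      rewrite (@hs_iota_N1 _ _ iota split b ltac:(nonzero))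
  end; rewrite ?(hs_N1_N1 split).

Ltac hs_solve_over iota n2L idxL split :=
  rewrite ?(iotaM iota, iotaN iota, iotaV iota) -?addTb; hs_expand n2L idxL;
  hs_base iota split; hs_sym n2L; try xor_solve.

Ltac hs_both_over iota n2 n2L idxF idxL split :=
  rewrite ?(iotaM iota, iotaN iota, iotaV iota) -?addTb; hs_expand n2L idxL; hs_expand n2 idxF;
  hs_base iota split; hs_sym n2L; hs_sym n2; try xor_solve.

(** * Symbol identities behind the splitting over the norm one group *)

Section BaseChange.
Variables (F L : fieldType) (iota : {rmorphism F -> L}).
Hypothesis n2 : (2%:R : F) != 0.
Hypothesis idxF : forall a b b' : F, a != 0 -> b != 0 -> b' != 0 ->
  ~ is_norm a b -> ~ is_norm a b' -> is_norm a (b * b').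
Hypothesis idxL : forall a b b' : L, a != 0 -> b != 0 -> b' != 0 ->
  ~ is_norm a b -> ~ is_norm a b' -> is_norm a (b * b').
Hypothesis splitFL : forall a b : F, a != 0 -> b != 0 -> is_norm (iota a) (iota b).

Let n2L : (2%:R : L) != 0 := iota_two_neq0 iota n2.
Ltac hs_both := hs_both_over iota n2 n2L idxF idxL splitFL.

(** The coboundary identity for [s1] at a pair [x], [y], reduced to symbols: [a], [b], [f] are the
    lower left entries of [x], [y], [xy], the scalars [p], [q], [s] are their [nu], and [e] is
    [- delta mu]. The quantity [C] joins two Steinberg relations, [- C/(bf) + q/b = s/f] and
    [p/a + S^2/(abf) = - C/(bf)]; the last hypothesis evaluates its symbol with [- pqs]. *)
Lemma weil_cochain_symbol (a b f S C : L) (p q s e : F) :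
  a != 0 -> b != 0 -> f != 0 -> p != 0 -> q != 0 -> s != 0 -> e != 0 ->
  C = f * iota q - b * iota s ->
  S ^+ 2 = iota s * a * b - iota p * b * f - iota q * a * f ->
  (if C == 0 then false else hs C (iota (- (p * q * s)))) (+) hs e (- (p * q * s)) = true ->
  true (+) (hs f (iota (- s)) (+) hs e (- s)) =
  true (+) (hs a (iota (- p)) (+) hs e (- p)) (+) (true (+) (hs b (iota (- q)) (+) hs e (- q)))
   (+) hs (f * a) (f * b).
Proof.
move=> cx cy cxy v1 v2 v3 e0 eC R hp.
have ip : iota p != 0 by rewrite fmorph_eq0.
have iq : iota q != 0 by rewrite fmorph_eq0.
have is0 : iota s != 0 by rewrite fmorph_eq0.
have qb0 : iota q / b != 0 by rewrite mulf_neq0 ?invr_eq0.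
have sf0 : iota s / f != 0 by rewrite mulf_neq0 ?invr_eq0.
have pa0 : iota p / a != 0 by rewrite mulf_neq0 ?invr_eq0.
have mE : - C / (b * f) + iota q / b = iota s / f by rewrite eC; field; rewrite cy cxy.
have SE : iota p / a + S ^+ 2 / (a * b * f) = - C / (b * f).
  by rewrite R eC; field; rewrite cx cy cxy.
clear eC R.
rewrite !(iotaN iota, iotaM iota) in hp *.
have [C0|C0] := eqVneq C 0.
  rewrite C0 eqxx in hp; rewrite C0 oppr0 mul0r in mE SE; rewrite add0r in mE.
  (* When [C = 0] the two relations degenerate to [q/b = s/f] and [p/a = - S^2/(abf)], and together
     they make [- pqs] a square in [L]. *)
  have ee : - (iota p * iota q * iota s) = (S * iota q / b) ^+ 2.
    have -> : iota s = f * (iota s / f) by field.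
    have -> : (S * iota q / b) ^+ 2 = (S ^+ 2 / (a * b * f)) * (a * f * iota q ^+ 2 / b).
      by field; rewrite cx cy cxy.
    have -> : S ^+ 2 / (a * b * f) = - (iota p / a) by apply/eqP; rewrite -addr_eq0 addrC SE.
    by rewrite -mE; field; rewrite cx cy.
  have h1 : hs a (- (iota p * iota q * iota s)) = false by rewrite ee hs_sqrr.
  have h2 x : hs x (iota q / b * (iota s / f)) = false by rewrite -mE -expr2 hs_sqrr.
  apply: (xor_use hp); apply: (xor_use h1); apply: (xor_use (h2 a)).
  by apply: (xor_use (h2 (iota s))); apply: (xor_use (h2 b)); hs_both.
rewrite (negPf C0) in hp.
have m0 : - C / (b * f) != 0 by rewrite mulf_neq0 ?oppr_eq0 // invr_eq0 mulf_neq0.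
have h1 := hs_sum m0 qb0 sf0 mE.
have [S0|S0] := eqVneq S 0.
  rewrite S0 expr0n mul0r addr0 in SE.
  have CE : C = - (iota p * b * f / a).
    have -> : C = - (- C / (b * f)) * (b * f) by field; rewrite cy cxy.
    by rewrite -SE; field.
  rewrite CE in hp h1; apply: (xor_use hp); apply: (xor_use h1).
  by hs_both.
have t0 : S ^+ 2 / (a * b * f) != 0.
  by rewrite mulf_neq0 ?expf_neq0 // invr_eq0 !mulf_neq0.
have h2 := hs_sum pa0 t0 m0 SE; rewrite expr2 in h2.
by apply: (xor_use hp); apply: (xor_use h1); apply: (xor_use h2); hs_both.
Qed.

(** The degenerate counterpart for a diagonal [x] with [z = d x] of norm one: such a [z] has trivial
    symbol with [F], and [nu x] equals [- z] up to squares. *)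
Lemma weil_cochain_symbol0 (z b C : L) (p q s e : F) :
  z != 0 -> b != 0 -> p != 0 -> q != 0 -> s != 0 -> e != 0 ->
  (forall x, x != 0 -> hs z (iota x) = false) ->
  - iota p * z = (z - 1) ^+ 2 ->
  C = b * (z * iota q - iota s) ->
  (if C == 0 then false else hs C (iota (- (p * q * s)))) (+) hs e (- (p * q * s)) = true ->
  true (+) (hs (z * b) (iota (- s)) (+) hs e (- s)) =
  true (+) (hs z (iota (- p)) (+) hs e (- p)) (+) (true (+) (hs b (iota (- q)) (+) hs e (- q)))
   (+) hs z^-1 b.
Proof.
move=> z0 b0 p0 q0 s0 e0 hz pE CE hp.
have ip : iota p != 0 by rewrite fmorph_eq0.
have iq : iota q != 0 by rewrite fmorph_eq0.
have is0 : iota s != 0 by rewrite fmorph_eq0.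
have h0 x : hs x (- iota p * z) = false by rewrite pE hs_sqrr.
have hz1 : hs z (-1) = false.
  by rewrite -(rmorphN1 iota); apply: hz; rewrite oppr_eq0 oner_eq0.
have hzp := hz _ p0; have hzs := hz _ s0.
have nC : C = 0 -> hs b (z * iota q * iota s) = false.
  rewrite CE => /eqP; rewrite mulf_eq0 (negPf b0) subr_eq0 => /eqP ->.
  by rewrite -expr2 hs_sqrr.
have [m0|m0] := eqVneq (z * iota q - iota s) 0.
  have C0 : C = 0 by rewrite CE m0 mulr0.
  have h1 := nC C0; rewrite C0 eqxx in hp.
  by apply: (xor_use hp); apply: (xor_use h1); apply: (xor_use hzp); apply: (xor_use hzs); hs_both.
have C0 : C != 0 by rewrite CE mulf_neq0.
have zq0 : z * iota q != 0 by rewrite mulf_neq0.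
have h1 := hs_sum m0 is0 zq0 (subrK _ _).
rewrite (negPf C0) CE in hp.
set m := _ - _ in m0 h1 hp; clearbody m.
apply: (xor_use hp); apply: (xor_use (h0 b)); apply: (xor_use (h0 m)); apply: (xor_use h1).
by apply: (xor_use hz1); apply: (xor_use hzp); hs_both.
Qed.
End BaseChange.

(** * Extension of characters *)

(** As [M] is normal, the elements commuting with a fixed [y] modulo [M] are closed under products,
    so it suffices to compare the generators [M], [A] and [h] with one another. *)
Lemma commutator_criterion (G : groupType) (M A : G -> Prop) (h : G) :
  M 1%g -> (forall x y, M x -> M y -> M (x * y)%g) -> (forall x, M x -> M x^-1%g) ->
  (forall x m, M m -> exists2 m', M m' & (x * m = m' * x)%g) ->
  (forall a b, A a -> A b -> (a * b = b * a)%g) ->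
  (forall a, A a -> exists2 m, M m & (h * a = m * (a * h))%g) ->
  (forall x, exists m a, [/\ M m, A a & (x = m * a \/ x = m * a * h)%g]) ->
  forall x y, exists2 m, M m & (x * y = m * (y * x))%g.
Proof.
move=> M1 MM MV Mn AA hA gen.
pose comm x y := exists2 m, M m & (x * y = m * (y * x))%g.
have csym x y : comm x y -> comm y x.
  by case=> m Mm e; exists m^-1%g; [apply: MV | rewrite e mulKg].
have cmul x x' y : comm x y -> comm x' y -> comm (x * x')%g y.
  move=> [m Mm e] [m' Mm' e']; have [m'' Mm'' e''] := Mn x m' Mm'.
  exists (m'' * m)%g; first exact: MM.
  by rewrite -mulgA e' mulgA e'' -!mulgA (mulgA x) e -!mulgA.
have cM' m y : M m -> comm m y.
  move=> Mm; have [m' Mm' e'] := Mn y m^-1%g (MV _ Mm).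
  exists (m * m')%g; first exact: MM.
  by rewrite -mulgA (mulgA m') -e' -!mulgA mulVg mulg1.
have ch : comm h h by exists 1%g; rewrite ?mul1g.
have cAA a b : A a -> A b -> comm a b.
  by move=> Aa Ab; exists 1%g; rewrite ?mul1g //; apply: AA.
have closed y : (forall a, A a -> comm a y) -> comm h y -> forall x, comm x y.
  move=> cA chy x; have [m [a [Mm Aa [->|->]]]] := gen x.
    by apply: cmul; [exact: cM' | exact: cA].
  by apply: (cmul) => //; apply: cmul; [exact: cM' | exact: cA].
have call a : A a -> forall x, comm x a.
  by move=> Aa; apply: closed; [move=> b Ab; apply: cAA | apply: hA].
have ch' : forall x, comm x h.
  by apply: closed => // a Aa; apply: csym; apply: hA.
move=> x y; apply: closed; last by apply: csym.
by move=> a Aa; apply: csym; apply: call.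
Qed.

Section CharacterExtension.
Variables (G : groupType) (C : numClosedFieldType) (M : G -> Prop) (z : G).
Local Open Scope group_scope.
Hypothesis M1 : M 1.
Hypothesis MM : forall x y, M x -> M y -> M (x * y).
Hypothesis MV : forall x, M x -> M x^-1.
Hypothesis Mcomm : forall x y, exists2 m, M m & x * y = m * (y * x).
Hypothesis zz : z * z = 1.
Hypothesis zC : forall x, x * z = z * x.
Hypothesis nMz : ~ M z.

(* Graphs of partial characters. *)
Record partial_char (S : G -> C -> Prop) : Prop := PartialChar {
  pc_M : forall m, M m -> S m 1%R;
  pc_z : S z (-1)%R;
  pc_mul : forall x y a b, S x a -> S y b -> S (x * y) (a * b)%R;
  pc_inv : forall x a, S x a -> S x^-1 a^-1%R;
  pc_fun : forall a, S 1 a -> a = 1%R }.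

(** The starting character on [M] and [M z]; it is single valued because [z] is not in [M]. *)
Lemma partial_char_base : partial_char (fun x a =>
  M x /\ a = 1%R \/ exists2 m, M m & x = m * z /\ a = (-1)%R).
Proof.
split.
- by move=> m Mm; left.
- by right; exists 1; rewrite ?mul1g.
- move=> x y a b [[Mx ->]|[m Mm [-> ->]]] [[My ->]|[m' Mm' [-> ->]]].
  + by left; rewrite mulr1; split=> //; apply: MM.
  + by right; exists (x * m'); rewrite ?mul1r ?mulgA //; apply: MM.
  + by right; exists (m * y); rewrite ?mulr1 -?mulgA -?zC ?mulgA //; apply: MM.
  + left; rewrite mulrNN mulr1; split=> //.
    by rewrite -mulgA (mulgA z) -zC -!mulgA zz mulg1; apply: MM.
- move=> x a [[Mx ->]|[m Mm [-> ->]]].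
    by left; rewrite invr1; split=> //; apply: MV.
  right; exists m^-1; first exact: MV.
  rewrite invrN1 invgM; split=> //.
  have -> : z^-1 = z by apply: mulg1_eq.
  by rewrite zC.
- move=> a [[_ ->]//|[m Mm [e _]]]; case: nMz.
  have -> : z = m^-1 by rewrite -[z](mulKg m) -e mulg1.
  exact: MV.
Qed.

Lemma pc_neq0 S x a : partial_char S -> S x a -> a != 0%R.
Proof.
move=> pS Sx; apply/eqP => a0; have := pc_mul pS Sx (pc_inv pS Sx).
by rewrite mulgV => /(pc_fun pS) /eqP; rewrite a0 mul0r eq_sym oner_eq0.
Qed.

Lemma pc_uniq S x a b : partial_char S -> S x a -> S x b -> a = b.
Proof.
move=> pS Sa Sb; have := pc_mul pS Sa (pc_inv pS Sb).
rewrite mulgV => /(pc_fun pS) e.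
by rewrite -[a](mulfVK (pc_neq0 pS Sb)) e mul1r.
Qed.

Lemma pc_exp S x a n : partial_char S -> S x a -> S (x ^+ n) (a ^+ n)%R.
Proof.
move=> pS Sx; elim: n => [|n IH]; first by rewrite expg0 expr0; apply: (pc_M pS).
by rewrite expgS exprS; apply: (pc_mul pS).
Qed.

Lemma partial_char_maximal : exists2 S, partial_char S &
  forall S', partial_char S' -> (forall x a, S x a -> S' x a) -> forall x a, S' x a -> S x a.
Proof.
pose T := {S : G -> C -> Prop | partial_char S}.
pose R (s t : T) := `[< forall x a, sval s x a -> sval t x a >].
have [||A tot|[S pS] mx] := @classical_sets.ZL_preorder T (exist _ _ partial_char_base) R.
- by move=> t; apply/asboolP.
- by move=> r s t /asboolP rs /asboolP st; apply/asboolP => x a h; apply/st/rs.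
- case: (pselect (exists s, A s)) => [[s0 As0]|nA]; last first.
    exists (exist _ _ partial_char_base) => s As; case: nA; by exists s.
  pose U x a := exists2 s, A s & sval s x a.
  have two x y a b : U x a -> U y b -> exists2 s, A s & sval s x a /\ sval s y b.
    move=> [s As sx] [t At ty]; have [/asboolP st|/asboolP ts] := tot _ _ As At.
      by exists t => //; split=> //; apply: st.
    by exists s => //; split=> //; apply: ts.
  have pU : partial_char U.
    split.
    - by move=> m Mm; exists s0 => //; apply: (pc_M (svalP s0)).
    - by exists s0 => //; apply: (pc_z (svalP s0)).
    - move=> x y a b Ux Uy; have [s As [sx sy]] := two _ _ _ _ Ux Uy.
      by exists s => //; apply: (pc_mul (svalP s)).
    - by move=> x a [s As sx]; exists s => //; apply: (pc_inv (svalP s)).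
    - by move=> a [s As sx]; apply: (pc_fun (svalP s)).
  exists (exist _ U pU) => s As; apply/asboolP => x a sx; by exists s.
exists S => // S' pS' SS' x a.
have := mx (exist _ S' pS'); rewrite /R /= => h.
by move: (h (introT (asboolP _) SS')) => /asboolP; apply.
Qed.

(* A value for the powers of [x] compatible with those already fixed; this is
   where divisibility of [C^x] is used. *)
Lemma partial_char_root S x : partial_char S ->
  exists2 c : C, c != 0%R & forall n a, S (x ^+ n) a -> (c ^+ n)%R = a.
Proof.
move=> pS; case: (pselect (exists n : nat, exists a, (0 < n)%N /\ S (x ^+ n) a)) => [ex|nex]; last first.
  exists 1%R; rewrite ?oner_eq0 // => -[|n] a Sa.
    by rewrite expg0 in Sa; rewrite expr0 (pc_fun pS Sa).
  by case: nex; exists n.+1, a.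
pose p n := (0 < n)%N && `[< exists a, S (x ^+ n) a >].
(* The exponents with a prescribed value are the multiples of the least positive one, so a root of
   its value is compatible with all of them. *)
have [n /andP[n0 /asboolP[a Sa]] nmin] : exists2 n, p n & forall m, p m -> (n <= m)%N.
  have exp : exists n, p n.
    by have [n [a [n0 Sa]]] := ex; exists n; apply/andP; split=> //; apply/asboolP; exists a.
  by exists (ex_minn exp); case: ex_minnP.
have a0 := pc_neq0 pS Sa.
have rE : (n.-root a ^+ n)%R = a by rewrite rootCK.
exists (n.-root a); first by rewrite rootC_eq0.
move=> m b; rewrite (divn_eq m n) expgnDr mulnC exprD exprM rE => Sb.
have Sq := pc_inv pS (pc_exp (m %/ n) pS Sa).
have := pc_mul pS Sq Sb; rewrite expgnA mulKg => Sr.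
have [r0|r0] := posnP (m %% n).
  move: Sr; rewrite r0 expg0 => /(pc_fun pS) e.
  by rewrite expr0 mulr1 -[b](mulVKf (expf_neq0 (m %/ n) a0)) e mulr1.
have : (n <= m %% n)%N.
  by apply: nmin; rewrite /p r0; apply/asboolP; exists ((a ^+ (m %/ n))^-1 * b)%R.
by rewrite leqNgt ltn_pmod.
Qed.

(** Powers of [x] are written [x^n x^-m] with natural exponents. In a product the second factor is
    moved past them at the cost of an element of [M], which has value 1; the choice of [c] makes the
    result single valued. *)
Lemma partial_char_extend S x : partial_char S -> exists S', [/\ partial_char S',
  forall y a, S y a -> S' y a & exists a, S' x a].
Proof.
move=> pS; have [c c0 cE] := partial_char_root x pS.
have cX n : (c ^+ n)%R != 0%R by rewrite expf_neq0.
pose S' y b := exists h v n m, [/\ S h v, y = h * (x ^+ n * (x ^+ m)^-1) & b = (v * (c ^+ n / c ^+ m))%R].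
have cXm n m : commute (x ^+ n) (x ^+ m) by apply: commuteX2.
have cXV n m : commute (x ^+ n) (x ^+ m)^-1 by apply: commuteV.
exists S'; split; last first.
- exists c, 1, 1%R, 1%N, 0%N; split; first exact: (pc_M pS).
    by rewrite expg0 invg1 mulg1 mul1g expg1.
  by rewrite expr0 expr1 divr1 mul1r.
- move=> y a Sy; exists y, a, 0%N, 0%N; split=> //.
    by rewrite expg0 invg1 !mulg1.
  by rewrite expr0 divr1 mulr1.
have incl y a : S y a -> S' y a.
  move=> Sy; exists y, a, 0%N, 0%N; split=> //.
    by rewrite expg0 invg1 !mulg1.
  by rewrite expr0 divr1 mulr1.
split.
- by move=> m Mm; apply: incl; apply: (pc_M pS).
- by apply: incl; apply: (pc_z pS).
- move=> y y' a b [h [v [n [m [Sh -> ->]]]]] [h' [v' [n' [m' [Sh' -> ->]]]]].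
  have [k Mk ek] := Mcomm (x ^+ n * (x ^+ m)^-1) h'.
  exists (h * k * h'), (v * v')%R, (n + n')%N, (m + m')%N; split.
  + rewrite -[v]mulr1; apply: (pc_mul pS) => //.
    by apply: (pc_mul pS) => //; apply: (pc_M pS).
  + rewrite -!mulgA; congr (_ * _); rewrite !mulgA ek -!mulgA; congr (_ * (_ * _)).
    rewrite !expgnDr invgM -!mulgA; congr (_ * _).
    by rewrite mulgA -cXV -mulgA; congr (_ * _); rewrite -!invgM cXm.
  + by rewrite !exprD; field; rewrite !cX.
- move=> y a [h [v [n [m [Sh -> ->]]]]].
  have [k Mk ek] := Mcomm ((x ^+ m * (x ^+ n)^-1)) h^-1.
  exists (k * h^-1), v^-1%R, m, n; split.
  + rewrite -[v^-1%R]mul1r; apply: (pc_mul pS); last exact: (pc_inv pS).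
    exact: (pc_M pS).
  + by rewrite invgM invgM invgK ek !mulgA.
  + by have v0 := pc_neq0 pS Sh; field; rewrite v0 !cX.
- move=> a [h [v [n [m [Sh e ->]]]]].
  have v0 := pc_neq0 pS Sh.
  have e' : x ^+ m = h * x ^+ n.
    by rewrite -[x ^+ m]mul1g [in LHS]e -!mulgA mulVg mulg1.
  case: (leqP m n) => mn.
    have : S (x ^+ (n - m)) v^-1%R.
      rewrite expgnFr // e' invgM mulgA mulgV mul1g.
      exact: (pc_inv pS).
    move/cE; rewrite -{2}(subnK mn) exprD => ->.
    by field; rewrite v0 !cX.
  have : S (x ^+ (m - n)) v.
    by rewrite expgnFr ?(ltnW mn) // e' mulgK.
  move/cE; rewrite -{2}(subnK (ltnW mn)) exprD => ->.
  by field; rewrite v0 !cX.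
Qed.

Lemma character_extension : exists phi : G -> C,
  [/\ forall x, phi x != 0%R, forall x y, phi (x * y) = (phi x * phi y)%R & phi z = (-1)%R].
Proof.
have [S pS mx] := partial_char_maximal.
have tot x : exists a, S x a.
  have [S' [pS' SS' [a Sa]]] := partial_char_extend x pS.
  by exists a; apply: (mx S').
have [phi hphi] := choice tot; exists phi; split.
- by move=> x; apply: (pc_neq0 pS (hphi x)).
- by move=> x y; apply: (pc_uniq pS (hphi _)); apply: (pc_mul pS).
- by apply: (pc_uniq pS (hphi _)); apply: (pc_z pS).
Qed.

End CharacterExtension.

(** * The cover of a quaternion group *)

Lemma nat_nonroot (K : fieldType) (p : {poly K}) :
  [pchar K] =i pred0 -> p != 0 -> exists n : nat, ~~ root p n%:R.
Proof.
move=> ch p0; apply: contrapT => h.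
have := max_poly_roots (rs := [seq (n%:R : K) | n <- seq.iota 0 (size p)]) p0.
rewrite size_map size_iota ltnn => h'; suff : false by []; apply: h'.
  apply/allP => _ /mapP[n _ ->]; apply/negPn/negP => hn; apply: h; by exists n.
rewrite map_inj_in_uniq ?iota_uniq // => i j _ _ e.
wlog ij : i j e / (i <= j)%N => [wl|].
  by case: (leqP i j) => [|/ltnW] ij; [|symmetry]; apply: wl.
have /eqP : (j - i)%:R = 0 :> K by rewrite natrB // e subrr.
by have /pcharf0P -> := ch; lia.
Qed.

Section Cover.
Variables (F L : fieldType) (iota : {rmorphism F -> L}) (delta : F) (r : L).
Variables (conj : {rmorphism L -> L}) (nrm : L -> F).
Hypothesis n2 : (2%:R : F) != 0.
Hypothesis nsq : forall c, delta != c ^+ 2.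
Hypothesis er : r ^+ 2 = iota delta.
Hypothesis span : forall z, exists a b, z = iota a + iota b * r.
Hypothesis conj_iota : forall a, conj (iota a) = iota a.
Hypothesis conj_r : conj r = - r.
Hypothesis nrmE : forall z, iota (nrm z) = z * conj z.
Hypothesis idxF : forall a b b' : F, a != 0 -> b != 0 -> b' != 0 ->
  ~ is_norm a b -> ~ is_norm a b' -> is_norm a (b * b').
Hypothesis idxL : forall a b b' : L, a != 0 -> b != 0 -> b' != 0 ->
  ~ is_norm a b -> ~ is_norm a b' -> is_norm a (b * b').
Hypothesis splitFL : forall a b : F, a != 0 -> b != 0 -> is_norm (iota a) (iota b).

Let n2L : (2%:R : L) != 0 := iota_two_neq0 iota n2.
Let conjK z : conj (conj z) = z := conjKq span conj_iota conj_r z.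

Let hsii a b : a != 0 -> b != 0 -> hs (iota a) (iota b) = false := hs_iota splitFL (a := a) (b := b).

Lemma trace_exists z : exists t, iota t = z + conj z.
Proof.
have [a [b ->]] := span z; exists (2%:R * a).
by rewrite rmorphD [conj (iota b * r)]rmorphM !conj_iota conj_r; ring.
Qed.

Lemma nrm_neq0 z : z != 0 -> nrm z != 0.
Proof. by move=> z0; rewrite (nrm_eq0 nrmE). Qed.

(** The projection formula for symbols. Taking norms of [p^2 - a q^2] gives one direction, since
    [N(p^2 - a q^2) = (N p + a N q)^2 - a t^2] with [t] the trace of [p] times the conjugate of
    [q]. *)
Lemma hs_proj a z : a != 0 -> z != 0 -> hs (iota a) z = hs a (nrm z).
Proof.
move=> a0 z0; apply/negb_inj; apply/hsP/hsP => [[p [q e]]|[P [Q e]]].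
  have [t ht] := trace_exists (p * conj q).
  exists (nrm p + a * nrm q), t; apply: (fmorph_inj iota).
  rewrite rmorphB rmorphXn rmorphM rmorphXn rmorphD [iota (a * _)]rmorphM ht !nrmE rmorphM conjK.
  by rewrite e rmorphB rmorphXn [conj (iota a * _)]rmorphM rmorphXn conj_iota; ring.
(* If [N z = R^2 - a Q^2], then [(z + R)^2 - a Q^2 = z (t + 2 R)], and the second factor comes from
   [F], hence is a norm by [splitFL]. Either sign of [P] may be taken; if both make the factor
   vanish, then [z^2 = a Q^2] and [a] is a square in [L]. *)
have main R : R ^+ 2 = P ^+ 2 -> forall t, iota t = z + conj z -> t + 2%:R * R != 0 ->
    is_norm (iota a) z.
  move=> eR t ht s0.
  have is0 : iota (t + 2%:R * R) != 0 by rewrite fmorph_eq0.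
  apply: (is_norm_div is0); last exact: splitFL.
  exists (z + iota R), (iota Q).
  have e1 : z * conj z = iota R ^+ 2 - iota a * iota Q ^+ 2.
    by rewrite -nrmE e -eR; ring.
  have -> : (z + iota R) ^+ 2 - iota a * iota Q ^+ 2 =
    z ^+ 2 + 2%:R * z * iota R + (iota R ^+ 2 - iota a * iota Q ^+ 2) by ring.
  have -> : iota (t + 2%:R * R) = iota t + 2%:R * iota R by ring.
  by rewrite -e1 ht; ring.
have [t ht] := trace_exists z.
have [s1|s1] := eqVneq (t + 2%:R * P) 0; last exact: main s1.
have [s2|s2] := eqVneq (t + 2%:R * - P) 0; last by apply: (main (- P)) ht s2; rewrite sqrrN.
have P0 : P = 0.
  apply/eqP; have: 2%:R * (2%:R * P) == 0.
    have -> : 2%:R * (2%:R * P) = (t + 2%:R * P) - (t + 2%:R * - P) by ring.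
    by rewrite s1 s2 subr0.
  by rewrite !mulf_eq0 (negPf n2).
have t0 : t = 0 by move: s1; rewrite P0 mulr0 addr0.
have cz : conj z = - z by apply/eqP; rewrite -addr_eq0 addrC -ht t0 rmorph0.
have ez : z ^+ 2 = iota a * iota Q ^+ 2.
  have := nrmE z; rewrite cz e P0 => h; apply: oppr_inj.
  by rewrite -mulrN in h; rewrite expr2 -mulrN -h; ring.
have Q0 : iota Q != 0.
  by apply: contraTneq z0 => Q0; rewrite -[z == 0](expf_eq0 z 2) ez Q0 expr0n mulr0 eqxx.
have -> : iota a = (z / iota Q) ^+ 2 by rewrite expr_div_n ez mulfK ?expf_neq0.
by apply: is_norm_square => //; rewrite mulf_neq0 ?invr_eq0.
Qed.

Lemma hs_conj x y : hs (conj x) (conj y) = hs x y.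
Proof.
have h u w : is_norm u w -> is_norm (conj u) (conj w).
  by case=> p [q ->]; exists (conj p), (conj q); ring.
apply/negb_inj; apply/hsP/hsP => [/h|]; first by rewrite !conjK.
exact: h.
Qed.

(** The Steinberg relation for [z] plus its conjugate, with sum [t] in [F]; the symbols of both with
    [t] agree by the projection formula and cancel. Trace zero is the case [(z, - z)]. *)
Lemma hs_conj_self z : z != 0 -> hs z (conj z) = false.
Proof.
move=> z0; have cz0 : conj z != 0 by rewrite fmorph_eq0.
have [t ht] := trace_exists z; have [t0|t0] := eqVneq t 0.
  have -> : conj z = - z by apply/eqP; rewrite -addr_eq0 addrC -ht t0 rmorph0.
  exact: hsNN.
have it0 : iota t != 0 by rewrite fmorph_eq0.
have h := hs_sum z0 cz0 it0 (esym ht).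
apply: (xor_use h); hs_expand n2L idxL.
rewrite [hs z (iota t)](hsC n2L z0 it0) !hs_proj // (nrm_conj span conj_iota conj_r nrmE).
have -> : hs (-1) (iota t) = false by rewrite -(rmorphN1 iota) hsii ?oppr_eq0 ?oner_eq0.
xor_solve.
Qed.

Section QuaternionGroup.
(* [x] stands for the matrix [[conj (d x), mu conj (c x)], [c x, d x]]. *)
Variables (D : unitRingType) (mu : F) (c d : D -> L).
Hypothesis unitD : forall x : D, x != 0 -> x \is a GRing.unit.
Hypothesis cB : forall x y, c (x - y) = c x - c y.
Hypothesis dB : forall x y, d (x - y) = d x - d y.
Hypothesis cM : forall x y, c (x * y) = c x * conj (d y) + d x * c y.
Hypothesis dM : forall x y, d (x * y) = iota mu * c x * conj (c y) + d x * d y.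
Hypothesis c1 : c 1 = 0.
Hypothesis d1 : d 1 = 1.
Hypothesis cd_inj : forall x y, c x = c y -> d x = d y -> x = y.
Hypothesis cd_surj : forall a b, exists x, c x = a /\ d x = b.
Hypothesis mu_nonnorm : hs delta mu = true.
Hypothesis mu0 : mu != 0.

Lemma c0E : c 0 = 0. Proof. by rewrite -(subrr 0) cB subrr. Qed.
Lemma d0E : d 0 = 0. Proof. by rewrite -(subrr 0) dB subrr. Qed.

Definition Nrd x : F := nrm (d x) - mu * nrm (c x).

Lemma iNrd x : iota (Nrd x) = d x * conj (d x) - iota mu * (c x * conj (c x)).
Proof. by rewrite /Nrd rmorphB rmorphM !nrmE. Qed.

Lemma NrdM x y : Nrd (x * y) = Nrd x * Nrd y.
Proof.
apply: (fmorph_inj iota); rewrite rmorphM !iNrd cM dM !rmorphD !rmorphM !conjK conj_iota; ring.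
Qed.

Lemma Nrd1 : Nrd 1 = 1.
Proof. by apply: (fmorph_inj iota); rewrite iNrd c1 d1 !rmorph1 !mul0r mulr0 subr0 mulr1. Qed.

Lemma is_norm_nrm z : is_norm delta (nrm z).
Proof.
have [a [b ->]] := span z; exists a, b.
exact: (nrm_coord er conj_iota conj_r nrmE).
Qed.

Lemma Nrd_neq0 x : x != 0 -> Nrd x != 0.
Proof.
move=> x0; apply/negP => /eqP e; have e2 : nrm (d x) = mu * nrm (c x) by apply/subr0_eq.
have [cx|cx] := eqVneq (c x) 0.
  case/negP: x0; apply/eqP/cd_inj; rewrite ?c0E ?d0E //.
  have z0 : nrm 0 = 0 by apply/eqP; rewrite (nrm_eq0 nrmE).
  by apply/eqP; rewrite -(nrm_eq0 nrmE) e2 cx z0 mulr0.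
have nc := nrm_neq0 cx.
apply: (hs_not_norm mu_nonnorm); apply: (is_norm_div nc); last exact: is_norm_nrm.
by rewrite mulrC -e2; apply: is_norm_nrm.
Qed.

Lemma d_neq0 x : x != 0 -> c x = 0 -> d x != 0.
Proof.
move=> x0 cx; apply: contra_neq x0 => dx; apply: cd_inj; by rewrite ?c0E ?d0E.
Qed.

Lemma mulD_neq0 (x y : D) : x != 0 -> y != 0 -> x * y != 0.
Proof.
move=> x0 y0; apply: contra_neq y0 => e.
by rewrite -[y](mulKr (unitD x0)) e mulr0.
Qed.

Definition xc x := if c x == 0 then d x else c x.

Lemma xc_neq0 x : x != 0 -> xc x != 0.
Proof. by move=> x0; rewrite /xc; have [cx|//] := eqVneq (c x) 0; apply: d_neq0. Qed.

(* Kubota's cocycle on the image of [D^x], in additive notation. *)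
Definition bt x y : bool :=
  if c x == 0 then hs (conj (d x)) (xc y)
  else if c y == 0 then hs (- (c x * iota (Nrd x))) (conj (d y))
  else if c (x * y) == 0 then hs (c x) (conj (d (x * y)))
  else hs (c (x * y) * c x) (iota (Nrd x) * c (x * y) * c y).

(** The three-term relation between lower left entries; with nonzero entries it becomes the
    Steinberg relation that proves the cocycle identity. *)
Lemma plucker x y z :
  iota (Nrd y) * c x * c z + c y * c (x * y * z) = c (x * y) * c (y * z).
Proof.
by rewrite iNrd !(cM, dM); ring.
Qed.

Lemma Nrd_c_mul x y : iota (Nrd x) * c y + c x * conj (d (x * y)) = conj (d x) * c (x * y).
Proof. by rewrite iNrd cM dM rmorphD !rmorphM !conjK conj_iota; ring. Qed.

Ltac hs_solve := hs_solve_over iota n2L idxL splitFL.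
Ltac hs_both := hs_both_over iota n2 n2L idxF idxL splitFL.

(** The nonvanishing conditions concern only elements ending in [z], since right multiplication can
    arrange these. The degenerations of [x], [y] and [xy] are treated one by one, and the remaining
    case is [plucker]. *)
Lemma bt_cocycle_generic x y z : x != 0 -> y != 0 -> z != 0 ->
  c z != 0 -> c (y * z) != 0 -> c (x * y * z) != 0 ->
  bt x y (+) bt (x * y) z = bt x (y * z) (+) bt y z.
Proof.
move=> x0 y0 z0 cz cyz cxyz.
have nx := Nrd_neq0 x0; have ny := Nrd_neq0 y0.
have Pl := plucker x y z.
have eyz := cM y z; have exyz := cM x (y * z); rewrite mulrA in exyz.
have exy := cM x y.
rewrite /bt /xc (negPf cz) (negPf cyz) (mulrA x y z) (negPf cxyz) !NrdM.
have [cx|cx] := eqVneq (c x) 0.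
  have dx := d_neq0 x0 cx; have cdx : conj (d x) != 0 by rewrite fmorph_eq0.
  have exy' : c (x * y) = d x * c y by rewrite exy cx mul0r add0r.
  have exyz' : c (x * y * z) = d x * c (y * z) by rewrite exyz cx mul0r add0r.
  have nE : iota (Nrd x) = d x * conj (d x) by rewrite iNrd cx mul0r mulr0 subr0.
  have [cy|cy] := eqVneq (c y) 0.
    rewrite exy' cy mulr0 eqxx.
    have dy := d_neq0 y0 cy; have cdy : conj (d y) != 0 by rewrite fmorph_eq0.
    have -> : d (x * y) = d x * d y by rewrite dM cx mulr0 mul0r add0r.
    have -> : c (y * z) = d y * c z by rewrite eyz cy mul0r add0r.
    by rewrite rmorphM; hs_solve.
  have cxy : c (x * y) != 0 by rewrite exy' mulf_neq0.
  rewrite (negPf cxy) exy' exyz' rmorphM nE; hs_solve.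
have [cy|cy] := eqVneq (c y) 0.
  have dy := d_neq0 y0 cy; have cdy : conj (d y) != 0 by rewrite fmorph_eq0.
  have exy' : c (x * y) = c x * conj (d y) by rewrite exy cy mulr0 addr0.
  have cxy : c (x * y) != 0 by rewrite exy' mulf_neq0.
  have nE : iota (Nrd y) = d y * conj (d y) by rewrite iNrd cy mul0r mulr0 subr0.
  rewrite (negPf cxy) exy' rmorphM nE.
  have -> : c (y * z) = d y * c z by rewrite eyz cy mul0r add0r.
  apply: (xor_use (hs_conj_self dy)); hs_solve.
have [cxy|cxy] := eqVneq (c (x * y)) 0.
  have xy0 := mulD_neq0 x0 y0.
  have dxy := d_neq0 xy0 cxy; have cdxy : conj (d (x * y)) != 0 by rewrite fmorph_eq0.
  have nE : iota (Nrd x) * iota (Nrd y) = d (x * y) * conj (d (x * y)).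
    by rewrite -rmorphM -NrdM iNrd cxy mul0r mulr0 subr0.
  have exyz' : c (x * y * z) = d (x * y) * c z by rewrite cM cxy mul0r add0r.
  have inx : iota (Nrd x) != 0 by rewrite fmorph_eq0.
  have ecy : c y = - (c x * conj (d (x * y)) * (iota (Nrd x))^-1).
    have := Nrd_c_mul x y; rewrite cxy mulr0 => /eqP; rewrite addr_eq0 => /eqP e.
    by apply: (mulfI inx); rewrite e; field.
  have eny : iota (Nrd y) = d (x * y) * conj (d (x * y)) * (iota (Nrd x))^-1.
    by rewrite -nE mulrAC divff // mul1r.
  rewrite exyz' eny ecy.
  apply: (xor_use (hs_conj_self dxy)); hs_solve.
rewrite rmorphM.
have iny : iota (Nrd y) != 0 by rewrite fmorph_eq0.
have s1 : iota (Nrd y) * c x * c z != 0 by rewrite !mulf_neq0.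
have s2 : c y * c (x * y * z) != 0 by rewrite !mulf_neq0.
have s3 : c (x * y) * c (y * z) != 0 by rewrite !mulf_neq0.
apply: (xor_use (hs_sum s1 s2 s3 Pl)); hs_solve.
Qed.
Hypothesis chF : [pchar F] =i pred0.

(** The candidates are [k = (a + w)/(a - w)] with [w^2 = mu] and [a] in [F], which have norm one. Up
    to the denominator, [c (g k)] is a nonzero polynomial in [a] for each nonzero [g], so some
    natural number avoids all roots; the factor [X] keeps [a] and hence [c k] nonzero. *)
Lemma generic_element x y z : x != 0 -> y != 0 -> z != 0 ->
  exists k, [/\ Nrd k = 1, c k != 0, c (x * k) != 0, c (y * k) != 0 & c (z * k) != 0].
Proof.
move=> x0 y0 z0.
have chL : [pchar L] =i pred0 by move=> p; rewrite (fmorph_pchar iota) chF.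
pose P (g : D) : {poly L} := (c g)%:P * ('X^2 + (iota mu)%:P) + (2%:R * d g)%:P * 'X.
have PE g a : (P g).[iota a] = c g * iota (a ^+ 2 + mu) + d g * iota (2%:R * a).
  by rewrite /P !hornerE; ring.
have P0 g : g != 0 -> P g != 0.
  move=> g0; apply/eqP => e; have [cg|cg] := eqVneq (c g) 0.
    have := PE g 1; rewrite e horner0 cg mul0r add0r mulr1 rmorph_nat => /esym/eqP.
    by rewrite mulf_eq0 (negPf n2L) orbF (negPf (d_neq0 g0 cg)).
  have h1 := PE g 0; have h2 := PE g 1; have h3 := PE g (-1).
  rewrite e !horner0 in h1 h2 h3.
  case/negP: cg; have : 2%:R * c g = 0.
    have -> : 2%:R * c g = (c g * iota (1 ^+ 2 + mu) + d g * iota (2%:R * 1)) +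
      (c g * iota ((-1) ^+ 2 + mu) + d g * iota (2%:R * -1)) -
      2%:R * (c g * iota (0 ^+ 2 + mu) + d g * iota (2%:R * 0)) by ring.
    by rewrite -h1 -h2 -h3; ring.
  by move/eqP; rewrite mulf_eq0 (negPf n2L).
have X0 : ('X : {poly L}) != 0 by rewrite polyX_eq0.
have [n] := nat_nonroot chL (mulf_neq0 (mulf_neq0 (mulf_neq0 (P0 x x0) (P0 y y0)) (P0 z z0)) X0).
rewrite -(rmorph_nat iota) !rootM !negb_or rootX fmorph_eq0 /root !PE.
set a : F := n%:R => /andP[/andP[/andP[hx hy] hz] a0].
have s0 : a ^+ 2 - mu != 0.
  rewrite subr_eq0; apply: contraTneq mu_nonnorm => <-.
  by rewrite hs_sqrr.
pose s := a ^+ 2 - mu.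
have [k [ck dk]] := cd_surj (iota (2%:R * a / s)) (iota ((a ^+ 2 + mu) / s)).
have cgk g : c (g * k) = (c g * iota (a ^+ 2 + mu) + d g * iota (2%:R * a)) * iota s^-1.
  by rewrite cM ck dk conj_iota; ring.
have is0 : iota s^-1 != 0 by rewrite fmorph_eq0 invr_eq0.
exists k; split; rewrite ?cgk ?mulf_neq0 //; last first.
  by rewrite ck fmorph_eq0 !mulf_neq0 // invr_eq0.
by rewrite /Nrd ck dk !(nrm_iota conj_iota nrmE) /s; field.
Qed.

Lemma k_neq0 k : Nrd k = 1 -> k != 0.
Proof.
move=> e; apply/eqP => k0; move: e; rewrite k0 /Nrd c0E d0E.
have -> : nrm 0 = 0 by apply/eqP; rewrite (nrm_eq0 nrmE).
by rewrite mulr0 subr0 => /esym/eqP; rewrite oner_eq0.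
Qed.

(** For any two-cochain the cocycle defects at [(y, z, k)], [(xy, z, k)], [(x, yz, k)], [(x, y, zk)]
    and [(x, y, z)] sum to zero; the first four vanish for generic [k]. *)
Lemma bt_cocycle x y z : x != 0 -> y != 0 -> z != 0 ->
  bt x y (+) bt (x * y) z = bt x (y * z) (+) bt y z.
Proof.
move=> x0 y0 z0.
have yz0 := mulD_neq0 y0 z0; have xyz0 := mulD_neq0 x0 yz0; have xy0 := mulD_neq0 x0 y0.
have [k [nk ck czk cyzk cxyzk]] := generic_element z0 yz0 xyz0.
have k0 := k_neq0 nk; have zk0 := mulD_neq0 z0 k0.
rewrite !mulrA in cyzk cxyzk xyz0.
have e1 := bt_cocycle_generic y0 z0 k0 ck czk cyzk.
have e2 : bt (x * y) z (+) bt (x * y * z) k = bt (x * y) (z * k) (+) bt z k.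
  by apply: bt_cocycle_generic.
have e3 : bt x (y * z) (+) bt (x * (y * z)) k = bt x (y * z * k) (+) bt (y * z) k.
  by apply: bt_cocycle_generic; rewrite ?mulrA.
have e4 : bt x y (+) bt (x * y) (z * k) = bt x (y * (z * k)) (+) bt y (z * k).
  by apply: bt_cocycle_generic; rewrite ?mulrA.
rewrite !mulrA in e1 e2 e3 e4.
apply: (xor_use e1); apply: (xor_use e2); apply: (xor_use e3); apply: (xor_use e4).
xor_solve.
Qed.

(** * The splitting [s1] over the norm one group and its invariance *)

Definition nu x := Nrd (1 - x).

Lemma inu x : Nrd x = 1 -> iota (nu x) = 2%:R - d x - conj (d x).
Proof.
move=> e; have := iNrd x; rewrite e rmorph1 => h.
rewrite iNrd cB dB c1 d1 sub0r.
have -> : (1 - d x) * conj (1 - d x) - iota mu * (- c x * conj (- c x)) =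
  1 - d x - conj (d x) + (d x * conj (d x) - iota mu * (c x * conj (c x))) by ring.
by rewrite -h; ring.
Qed.

Lemma nu_neq0 x : x != 1 -> nu x != 0.
Proof. by move=> x1; apply: Nrd_neq0; rewrite subr_eq0 eq_sym. Qed.

(* The splitting over the norm one group, in additive notation; the symbol
   [(xc x, - nu x)] is suggested by the trace of the Weil representation. *)
Definition s1 x : bool :=
  if x == 1 then false else true (+) (hs (xc x) (iota (- nu x)) (+) hs (- (delta * mu)) (- nu x)).

Let delta0 : delta != 0 := delta_neq0 nsq.

Ltac hs_solveF := hs_expand n2 idxF; hs_sym n2; try xor_solve.

(** Here [e] is the square of the pure quaternion with [c = C] and [d = y r]. After projecting
    [(C, e)] to [F], the Steinberg relation for [delta y^2 + mu N(C) = e] reduces the sum to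
    [(delta, mu)], which is nontrivial because [D] is a division algebra. *)
Lemma pure_symbol (e y : F) (C : L) : e != 0 -> e = delta * y ^+ 2 + mu * nrm C ->
  (if C == 0 then false else hs C (iota e)) (+) hs (- (delta * mu)) e = true.
Proof.
move=> e0 ee; have hm := mu_nonnorm.
have [C0|C0] := eqVneq C 0.
  have n0 : nrm 0 = 0 by apply/eqP; rewrite (nrm_eq0 nrmE).
  rewrite C0 n0 mulr0 addr0 in ee; have y0 : y != 0.
    by apply: contra_neq e0 => y0; rewrite ee y0 expr0n mulr0.
  rewrite ee -hm expr2; hs_solveF.
have hp : hs C (iota e) = hs e (nrm C) by rewrite hsC ?fmorph_eq0 // hs_proj.
rewrite hp; have nC := nrm_neq0 C0.
have hn := hs_norm (is_norm_nrm C).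
rewrite -hm; apply: (xor_use hn).
have [y0|y0] := eqVneq y 0.
  rewrite y0 expr0n mulr0 add0r in ee; rewrite ee; hs_solveF.
have s1 : delta * y ^+ 2 != 0 by rewrite !mulf_neq0 ?expf_neq0.
have s2 : mu * nrm C != 0 by rewrite !mulf_neq0.
apply: (xor_use (hs_sum s1 s2 e0 (esym ee))); rewrite expr2; hs_solveF.
Qed.

Lemma bt1l x : bt 1 x = false.
Proof. by rewrite /bt c1 eqxx d1 rmorph1 hs1l. Qed.

Lemma bt1r x : bt x 1 = false.
Proof.
rewrite /bt /xc c1 eqxx d1 rmorph1; case: eqVneq => _; exact: hs1r.
Qed.

Lemma trace_relation x y :
  c (x * y) ^+ 2 + iota (Nrd x) * c y ^+ 2 + iota (Nrd y) * c x ^+ 2 =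
  (d x + conj (d x)) * c y * c (x * y) + (d y + conj (d y)) * c x * c (x * y)
  - (d (x * y) + conj (d (x * y))) * c x * c y.
Proof. by rewrite !iNrd cM dM rmorphD !rmorphM !conjK conj_iota; ring. Qed.

(** Supplies the square [S^2] of [weil_cochain_symbol], with [S = c x + c y - c (xy)]. *)
Lemma trace_relation1 x y : Nrd x = 1 -> Nrd y = 1 ->
  (c x + c y - c (x * y)) ^+ 2 = iota (nu (x * y)) * c x * c y
    - iota (nu x) * c y * c (x * y) - iota (nu y) * c x * c (x * y).
Proof.
move=> nx ny; have := trace_relation x y; rewrite nx ny rmorph1 !mul1r => e.
rewrite !inu ?NrdM ?nx ?ny ?mulr1 //.
have -> : (c x + c y - c (x * y)) ^+ 2 = (c (x * y) ^+ 2 + c y ^+ 2 + c x ^+ 2)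
   + 2%:R * c x * c y - 2%:R * c x * c (x * y) - 2%:R * c y * c (x * y) by ring.
by rewrite e; ring.
Qed.

(** Both sides are the square of the pure part of [nu(y) xy - nu(xy) y]. The difference of its [d]
    with the conjugate is anti-invariant, hence a multiple [q r], and [t = q / 2]. *)
Lemma pure_relation x y : Nrd x = 1 -> Nrd y = 1 -> exists t : F,
  - (nu x * nu y * nu (x * y)) =
  delta * t ^+ 2 + mu * nrm (c (x * y) * iota (nu y) - c y * iota (nu (x * y))).
Proof.
move=> nx ny; have nxy : Nrd (x * y) = 1 by rewrite NrdM nx ny mulr1.
pose I z := d z - conj (d z).
have [p [q eI]] := span (I (x * y) * iota (nu y) - I y * iota (nu (x * y))).
have p0 : p = 0.
  have e : conj (I (x * y) * iota (nu y) - I y * iota (nu (x * y))) =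
      - (I (x * y) * iota (nu y) - I y * iota (nu (x * y))).
    by rewrite rmorphB !rmorphM !rmorphB !conjK !conj_iota /I; ring.
  rewrite eI rmorphD rmorphM !conj_iota conj_r in e.
  apply/eqP; rewrite -(fmorph_eq0 iota); apply/eqP.
  have : 2%:R * iota p = 0.
    have -> : 2%:R * iota p = (iota p + iota q * - r) - - (iota p + iota q * r) by ring.
    by rewrite e subrr.
  by move/eqP; rewrite mulf_eq0 (negPf n2L) /= => /eqP.
exists (q / 2%:R); apply: (fmorph_inj iota).
have n4 : (4%:R : L) != 0 by rewrite (natrM L 2 2) mulf_neq0.
apply: (mulfI n4); rewrite rmorphN !rmorphM [in RHS]rmorphD [iota (mu * _)]rmorphM.
have -> : iota (delta * (q / 2%:R) ^+ 2) = iota delta * iota q ^+ 2 / 4%:R.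
  by rewrite rmorphM rmorphXn fmorph_div rmorph_nat; field; rewrite n4 n2L.
have eI2 : (I (x * y) * iota (nu y) - I y * iota (nu (x * y))) ^+ 2 = iota delta * iota q ^+ 2.
  by rewrite eI p0 rmorph0 add0r exprMn er mulrC.
rewrite nrmE -eI2.
have -> : conj (c (x * y) * iota (nu y) - c y * iota (nu (x * y))) =
    conj (c (x * y)) * iota (nu y) - conj (c y) * iota (nu (x * y)).
  rewrite -[in RHS](conj_iota (nu y)) -[in RHS](conj_iota (nu (x * y))); ring.
set A := iota (nu x); set B := iota (nu y); set C := iota (nu (x * y)).
pose T z := d z + conj (d z).
have TE z : Nrd z = 1 -> T z = 2%:R - iota (nu z) by move=> /inu ->; rewrite /T; ring.
have hI z : Nrd z = 1 -> I z ^+ 2 + 4%:R * (iota mu * (c z * conj (c z))) =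
    iota (nu z) ^+ 2 - 4%:R * iota (nu z).
  move=> nz; have e := iNrd z; rewrite nz rmorph1 in e.
  have -> : I z ^+ 2 + 4%:R * (iota mu * (c z * conj (c z))) =
    T z ^+ 2 - 4%:R * (d z * conj (d z) - iota mu * (c z * conj (c z))) by rewrite /I /T; ring.
  by rewrite -e (TE z nz); ring.
have h3 : I (x * y) * I y + 2%:R * iota mu * (c (x * y) * conj (c y) + conj (c (x * y)) * c y) =
    T (x * y) * T y - 2%:R * T x.
  have -> : T x = T x * iota (Nrd y) by rewrite ny rmorph1 mulr1.
  by rewrite iNrd /I /T cM dM !rmorphD !rmorphM !conjK conj_iota; ring.
transitivity (B ^+ 2 * (I (x * y) ^+ 2 + 4%:R * (iota mu * (c (x * y) * conj (c (x * y))))) +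
  C ^+ 2 * (I y ^+ 2 + 4%:R * (iota mu * (c y * conj (c y)))) -
  2%:R * B * C * (I (x * y) * I y + 2%:R * iota mu * (c (x * y) * conj (c y) + conj (c (x * y)) * c y))).
  by rewrite !hI // h3 !TE // -/A -/B -/C; ring.
by field; rewrite n4.
Qed.

Lemma s1_c x : c x != 0 ->
  s1 x = true (+) (hs (c x) (iota (- nu x)) (+) hs (- (delta * mu)) (- nu x)).
Proof.
move=> cx; rewrite /s1 /xc (negPf cx); case: eqP => // e.
by rewrite e c1 eqxx in cx.
Qed.

Lemma c_neq1 x : c x != 0 -> x != 1.
Proof. by apply: contra_neq => ->. Qed.

Lemma s1_generic x y : Nrd x = 1 -> Nrd y = 1 -> c x != 0 -> c y != 0 -> c (x * y) != 0 ->
  s1 (x * y) = s1 x (+) s1 y (+) bt x y.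
Proof.
move=> nx ny cx cy cxy.
rewrite !s1_c // /bt (negPf cx) (negPf cy) (negPf cxy) nx rmorph1 mul1r.
have [t et] := pure_relation nx ny; have R := trace_relation1 nx ny.
have v1 := nu_neq0 (c_neq1 cx); have v2 := nu_neq0 (c_neq1 cy); have v3 := nu_neq0 (c_neq1 cxy).
have e0 : - (nu x * nu y * nu (x * y)) != 0 by rewrite oppr_eq0 !mulf_neq0.
have dm : - (delta * mu) != 0 by rewrite oppr_eq0 mulf_neq0.
apply: (weil_cochain_symbol n2 idxF idxL splitFL cx cy cxy v1 v2 v3 dm erefl _
  (pure_symbol e0 et)).
exact: R.
Qed.

Lemma norm1_inv x : Nrd x = 1 -> c x = 0 -> conj (d x) = (d x)^-1 /\ nrm (d x) = 1.
Proof.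
move=> nx cx; have dx := d_neq0 (k_neq0 nx) cx.
have := iNrd x; rewrite nx cx mul0r mulr0 subr0 rmorph1 => e; split.
  by apply: (mulfI dx); rewrite -e divff.
by apply: (fmorph_inj iota); rewrite nrmE -e rmorph1.
Qed.

Lemma hs_norm1 z a : z != 0 -> nrm z = 1 -> a != 0 -> hs z (iota a) = false.
Proof. by move=> z0 nz a0; rewrite hsC ?fmorph_eq0 // hs_proj // nz hs1r. Qed.

Lemma nu_diag x : Nrd x = 1 -> c x = 0 -> - iota (nu x) * d x = (d x - 1) ^+ 2.
Proof.
move=> nx cx; have dx := d_neq0 (k_neq0 nx) cx.
by rewrite inu // (norm1_inv nx cx).1; field.
Qed.

Lemma s1_generic0 x y : Nrd x = 1 -> Nrd y = 1 -> c x = 0 -> x != 1 ->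
  c y != 0 -> c (x * y) != 0 -> s1 (x * y) = s1 x (+) s1 y (+) bt x y.
Proof.
move=> nx ny cx x1 cy cxy; rewrite !(s1_c cy, s1_c cxy).
have dx := d_neq0 (k_neq0 nx) cx; have [dV nd] := norm1_inv nx cx.
rewrite /s1 (negPf x1) /bt /xc cx eqxx (negPf cy) dV.
have exy : c (x * y) = d x * c y by rewrite cM cx mul0r add0r.
have [t et] := pure_relation nx ny.
have v1 := nu_neq0 x1; have v2 := nu_neq0 (c_neq1 cy); have v3 := nu_neq0 (c_neq1 cxy).
have e0 : - (nu x * nu y * nu (x * y)) != 0 by rewrite oppr_eq0 !mulf_neq0.
have dm : - (delta * mu) != 0 by rewrite oppr_eq0 mulf_neq0.
rewrite [in LHS]exy.
apply: (weil_cochain_symbol0 n2 idxF idxL splitFL dx cy v1 v2 v3 dm _ (nu_diag nx cx) _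
  (pure_symbol e0 et)).
  by move=> a a0; apply: hs_norm1.
by rewrite exy; ring.
Qed.

Lemma s1_semigeneric x y : Nrd x = 1 -> Nrd y = 1 -> c y != 0 -> c (x * y) != 0 ->
  s1 (x * y) = s1 x (+) s1 y (+) bt x y.
Proof.
move=> nx ny cy cxy; have [cx|cx] := eqVneq (c x) 0; last exact: s1_generic.
have [->|x1] := eqVneq x 1; last exact: s1_generic0.
by rewrite mul1r bt1l /s1 eqxx addbF.
Qed.

(** For a generic [k], computing [s1 (x y k)] with either bracketing uses only pairs covered by
    [s1_semigeneric]; the cocycle identity compares the two results. *)
Lemma s1M x y : Nrd x = 1 -> Nrd y = 1 -> s1 (x * y) = s1 x (+) s1 y (+) bt x y.
Proof.
move=> nx ny; have x0 := k_neq0 nx; have y0 := k_neq0 ny; have xy0 := mulD_neq0 x0 y0.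
have [k [nk ck cyk cxyk _]] := generic_element y0 xy0 xy0.
have k0 := k_neq0 nk; rewrite -mulrA in cxyk.
have nxy : Nrd (x * y) = 1 by rewrite NrdM nx ny mulr1.
have nyk : Nrd (y * k) = 1 by rewrite NrdM ny nk mulr1.
have e1 : s1 (x * y * k) = s1 (x * y) (+) s1 k (+) bt (x * y) k.
  by apply: s1_semigeneric; rewrite -?mulrA.
have e2 := s1_semigeneric ny nk ck cyk.
have e3 := s1_semigeneric nx nyk cyk cxyk.
have e4 := bt_cocycle x0 y0 k0.
rewrite mulrA in e3; rewrite e1 e2 in e3.
apply: (xor_use e3); apply: (xor_use e4); xor_solve.
Qed.

Lemma s11 : s1 1 = false. Proof. by rewrite /s1 eqxx. Qed.

Lemma c_quotient k y : iota (Nrd y) * c k = c (k * y) * d y - d (k * y) * c y.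
Proof. by rewrite iNrd cM dM; ring. Qed.

Lemma hs_conj_iota y a : y != 0 -> a != 0 -> hs (conj y) (iota a) = hs y (iota a).
Proof.
move=> y0 a0; have cy0 : conj y != 0 by rewrite fmorph_eq0.
rewrite ![hs _ (iota a)](hsC n2L) ?fmorph_eq0 //.
by rewrite !hs_proj // (nrm_conj span conj_iota conj_r nrmE).
Qed.

Lemma s1E x : x != 1 ->
  s1 x = true (+) (hs (xc x) (iota (- nu x)) (+) hs (- (delta * mu)) (- nu x)).
Proof. by move=> x1; rewrite /s1 (negPf x1). Qed.

(** Conjugation by a lift of [h] carries the lift of [k] to the lift of [k'], so the lifted [D^1] is
    normal. Generically this is the Steinberg relation of [quad]; vanishing entries of [h], [k],
    [k'] and [hk] are treated separately. *)
Lemma s1_conj h k k' : h != 0 -> Nrd k = 1 -> h * k = k' * h ->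
  bt h k (+) s1 k = s1 k' (+) bt k' h.
Proof.
move=> h0 nk e; have nh := Nrd_neq0 h0.
have nk' : Nrd k' = 1.
  by apply: (mulIf nh); rewrite -NrdM -e NrdM nk mul1r mulr1.
have k0 := k_neq0 nk; have k0' := k_neq0 nk'.
have [k1|k1] := eqVneq k 1.
  have -> : k' = 1 by apply: (mulIr (unitD h0)); rewrite -e k1 mulr1 mul1r.
  by rewrite k1 bt1r bt1l s11.
have k1' : k' != 1.
  apply: contra_neq k1 => k1'; apply: (mulrI (unitD h0)).
  by rewrite e k1' mulr1 mul1r.
have vE : nu k' = nu k.
  apply: (mulIf nh); rewrite -NrdM [RHS]mulrC -NrdM; congr Nrd.
  by rewrite mulrBl mulrBr -e mul1r mulr1.
have v0 := nu_neq0 k1; have iv0 : iota (nu k) != 0 by rewrite fmorph_eq0.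
have inh : iota (Nrd h) != 0 by rewrite fmorph_eq0.
have nv0 : - nu k != 0 by rewrite oppr_eq0.
have nN1 : (-1 : F) != 0 by rewrite oppr_eq0 oner_eq0.
have dm : - (delta * mu) != 0 by rewrite oppr_eq0 mulf_neq0.
have chk := cM h k; have chk' : c (h * k) = c k' * conj (d h) + d k' * c h by rewrite e cM.
have dhk := dM h k; have dhk' : d (h * k) = iota mu * c k' * conj (c h) + d k' * d h by rewrite e dM.
(* The form [X^2 - tr(k) X Y + Y^2] at [X = c (h k)], [Y = c h], rewritten with
   [tr k = 2 - nu k]. *)
have quad : (c (h * k) - c h) ^+ 2 + iota (nu k) * (c (h * k) * c h) =
    iota (Nrd h) * c k' * c k.
  rewrite c_quotient -e inu //.
  have -> : (c (h * k) - c h) ^+ 2 + (2%:R - d k - conj (d k)) * (c (h * k) * c h) =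
     c (h * k) ^+ 2 - (d k + conj (d k)) * (c (h * k) * c h) + iota 1 * c h ^+ 2 by rewrite rmorph1; ring.
  by rewrite -nk iNrd chk dhk; ring.
rewrite !s1E // vE /bt -e nk' rmorph1 ?mulr1 ?mul1r.
have [ch|ch] := eqVneq (c h) 0.
  have dh := d_neq0 h0 ch; have cdh : conj (d h) != 0 by rewrite fmorph_eq0.
  rewrite ch !(mul0r, mulr0, add0r, addr0, rmorph0) in chk dhk chk' dhk'.
  have ed : d k' = d k by apply: (mulIf dh); rewrite -dhk' dhk mulrC.
  have ec : c k' = c k * d h / conj (d h).
    by apply: (mulIf cdh); rewrite -chk' chk; field.
  have [ck|ck] := eqVneq (c k) 0.
    have ck' : c k' = 0 by rewrite ec ck !mul0r.
    rewrite ck' eqxx /xc ck ck' ch eqxx ed -(hs_conj (conj (d k))) conjK.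
    have hd : d k != 0 := d_neq0 k0 ck.
    by rewrite [hs (d k) (conj _)](hsC n2L) //; xor_solve.
  have ck' : c k' != 0 by rewrite ec !mulf_neq0 ?invr_eq0.
  rewrite (negPf ck') /xc (negPf ck) (negPf ck') ec.
  have f1 := hs_conj_iota dh nv0; have f2 := hs_conj_self dh.
  have f3 := hs_conj_iota dh nN1; rewrite rmorphN1 in f3.
  by apply: (xor_use f1); apply: (xor_use f2); hs_both.
have [ck|ck] := eqVneq (c k) 0.
  have dk := d_neq0 k0 ck; have [dV nd] := norm1_inv nk ck.
  have cdk : conj (d k) != 0 by rewrite fmorph_eq0.
  rewrite ck mulr0 addr0 dV in chk.
  have z1 := hs_norm1 dk nd nh; have z2 := hs_norm1 dk nd nN1; have z3 := hs_norm1 dk nd v0.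
  rewrite rmorphN1 in z2.
  have zV x : x != 0 -> hs x (- iota (nu k) * d k) = false by move=> x0; rewrite nu_diag // hs_sqrr.
  have [ck'|ck'] := eqVneq (c k') 0.
    rewrite ck' mul0r add0r in chk'.
    have ed : d k' = (d k)^-1 by apply: (mulIf ch); rewrite -chk' chk mulrC.
    rewrite /xc ck ck' eqxx (negPf ch) ed dV fmorphV dV invrK.
    by apply: (xor_use z1); apply: (xor_use z2); hs_both.
  have -> : (c (h * k) == 0) = false by rewrite chk mulf_eq0 invr_eq0 (negPf ch) (negPf dk).
  rewrite /xc ck eqxx (negPf ck') dV chk.
  by apply: (xor_use z1); apply: (xor_use z2); apply: (xor_use z3); apply: (xor_use (zV _ ck')); hs_both.
have [ck'|ck'] := eqVneq (c k') 0.
  have dk := d_neq0 k0' ck'; have [dV nd] := norm1_inv nk' ck'.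
  rewrite ck' mul0r add0r in chk'.
  have z1 := hs_norm1 dk nd nh; have z2 := hs_norm1 dk nd nN1; have z3 := hs_norm1 dk nd v0.
  rewrite rmorphN1 in z2.
  have zV x : x != 0 -> hs x (- iota (nu k) * d k') = false by move=> x0; rewrite -vE nu_diag // hs_sqrr.
  have -> : (c (h * k) == 0) = false by rewrite chk' mulf_eq0 (negPf ch) (negPf dk).
  rewrite /xc (negPf ck) ck' eqxx (negPf ch) dV chk'.
  by apply: (xor_use z1); apply: (xor_use z3); apply: (xor_use (zV _ ck)); hs_both.
rewrite /xc (negPf ck) (negPf ck').
have [chk0|chk0] := eqVneq (c (h * k)) 0.
  have hk0 := mulD_neq0 h0 k0; have dhk0 := d_neq0 hk0 chk0.
  have cdhk0 : conj (d (h * k)) != 0 by rewrite fmorph_eq0.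
  have := Nrd_c_mul k' h; rewrite nk' rmorph1 mul1r -e chk0 mulr0 => /eqP.
  rewrite addr_eq0 => /eqP ech; rewrite ech.
  have f1 : hs (iota (Nrd h) * c k' * c k) (iota (- nu k)) = false.
    by rewrite -quad chk0 mul0r mulr0 addr0 sub0r sqrrN hs_sqrl.
  by apply: (xor_use f1); hs_both.
have W0 : iota (Nrd h) * c k' * c k != 0 by rewrite !mulf_neq0.
have Y0 : iota (nu k) * (c (h * k) * c h) != 0 by rewrite !mulf_neq0.
have [t0|t0] := eqVneq (c (h * k) - c h) 0.
  have ech : c h = c (h * k) by apply/esym/subr0_eq.
  have f1 : hs (iota (Nrd h) * c k' * c k) (iota (- nu k)) =
      hs (iota (nu k) * (c (h * k) * c h)) (iota (- nu k)).
    by rewrite -quad t0 expr0n add0r.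
  rewrite ech in f1 *.
  by apply: (xor_use f1); hs_both.
have f1 := hs_sum (expf_neq0 2 t0) Y0 W0 quad; rewrite expr2 in f1.
set t := c (h * k) - c h in t0 f1; clearbody t.
by apply: (xor_use f1); hs_both.
Qed.

(** * Commutators in the cover, modulo the lift of the norm one group *)

Lemma diag_mulC x y : c x = 0 -> c y = 0 -> x * y = y * x.
Proof.
by move=> cx cy; apply: cd_inj; rewrite ?cM ?dM cx cy !(mul0r, mulr0, rmorph0, addr0, add0r) // mulrC.
Qed.

Lemma bt_diagC x y : x != 0 -> y != 0 -> c x = 0 -> c y = 0 -> bt x y = bt y x.
Proof.
move=> x0 y0 cx cy; have dx := d_neq0 x0 cx; have dy := d_neq0 y0 cy.
rewrite /bt /xc cx cy eqxx -hs_conj conjK (hsC n2L) // fmorph_eq0 //.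
Qed.

(** The commutator of lifts of [h] and [g] is the [s1] lift of [k]. With [c h = 1], both [nu k] and
    the norm of [c k] are explicit, so the projection formula moves every symbol to [F]. There
    [(delta, mu)] is nontrivial, [delta] is trivial on norms, and [Nrd h + mu = N(d h)] gives the
    last relation; [d h = 0] is separate. *)
Lemma bt_diag_comm h g k : h != 0 -> g != 0 -> c h = 1 -> c g = 0 -> h * g = k * (g * h) ->
  bt h g = s1 k (+) bt g h (+) bt k (g * h).
Proof.
move=> h0 g0 ch cg e; have gh0 := mulD_neq0 g0 h0.
have dg := d_neq0 g0 cg; have cdg : conj (d g) != 0 by rewrite fmorph_eq0.
have nh := Nrd_neq0 h0; have ng := nrm_neq0 dg.
have ngE : Nrd g = nrm (d g).
  have z0 : nrm 0 = 0 by apply/eqP; rewrite (nrm_eq0 nrmE).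
  by rewrite /Nrd cg z0 mulr0 subr0.
have nk : Nrd k = 1.
  have := congr1 Nrd e; rewrite !NrdM [Nrd g * _]mulrC => /esym /eqP.
  rewrite -subr_eq0 -[X in _ - X]mul1r -mulrBl mulf_eq0 mulf_eq0 (negPf nh) ngE (negPf ng) !orbF.
  by rewrite subr_eq0 => /eqP.
have chg : c (h * g) = conj (d g) by rewrite cM ch cg mul1r mulr0 addr0.
have dhg : d (h * g) = d h * d g by rewrite dM cg rmorph0 mulr0 add0r.
have cgh : c (g * h) = d g by rewrite cM ch cg mul0r mulr1 add0r.
have dgh : d (g * h) = d g * d h by rewrite dM cg mulr0 mul0r add0r.
have bgh : bt g h = false.
  by rewrite /bt cg eqxx /xc ch oner_eq0 hs1r.
have bhg : bt h g = hs (- Nrd h) (nrm (d g)).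
  by rewrite /bt ch oner_eq0 cg eqxx mul1r -rmorphN hs_proj ?oppr_eq0 // (nrm_conj span conj_iota conj_r nrmE).
rewrite bgh bhg addbF.
have nrmi := nrm_iota conj_iota nrmE.
have hm := mu_nonnorm.
have z0 : nrm 0 = 0 by apply/eqP; rewrite (nrm_eq0 nrmE).
have [k1|k1] := eqVneq k 1.
  have ez : d g = conj (d g) by rewrite -chg e k1 mul1r cgh.
  have [t ht] := trace_exists (d g); rewrite -ez in ht.
  have -> : d g = iota (t / 2%:R).
    by rewrite fmorph_div ht rmorph_nat; field.
  by rewrite k1 s11 bt1l nrmi hs_sqrr.
have [b eb] : exists b, d g - conj (d g) = iota b * r.
  have [p [q ez]] := span (d g); exists (2%:R * q).
  rewrite [d g in X in _ - X]ez ez (conjE conj_iota conj_r).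
  by rewrite rmorphM rmorph_nat; ring.
have b0 : b != 0.
  apply: contra_neq k1 => b0; apply: (mulIr (unitD gh0)); rewrite mul1r -e.
  move: eb; rewrite b0 rmorph0 mul0r => /subr0_eq ez.
  by apply: cd_inj; rewrite ?chg ?cgh ?dhg ?dgh // mulrC.
have nb : nrm (iota b * r) = - (delta * (b * b)).
  by rewrite (nrmM nrmE) nrmi (nrm_r er conj_r nrmE); ring.
have ngh : Nrd (g * h) = nrm (d g) * Nrd h by rewrite NrdM ngE.
have nuE : nu k = mu * delta * (b * b) / (nrm (d g) * Nrd h).
  have n0 : nrm (d g) * Nrd h != 0 by rewrite mulf_neq0.
  apply: (mulIf n0); rewrite divfK // -ngh -NrdM mulrBl mul1r -e.
  by rewrite /Nrd cB dB chg cgh dhg dgh mulrC [d h * _]mulrC subrr z0 eb nb; ring.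
have ckE : iota (Nrd (g * h)) * c k = - (d h * d g * (iota b * r)).
  by rewrite c_quotient -e chg dgh dhg cgh -eb; ring.
have nv0 : - nu k != 0 by rewrite oppr_eq0 nu_neq0.
have hdz := hs_norm (is_norm_nrm (d g)).
rewrite s1E // nuE.
have cgh0 : c (g * h) != 0 by rewrite cgh.
have [dh|dh] := eqVneq (d h) 0.
  have ck : c k = 0.
    move: ckE; rewrite dh !mul0r oppr0 => /eqP; rewrite mulf_eq0 fmorph_eq0 ngh.
    by rewrite mulf_eq0 (negPf ng) (negPf nh) => /eqP.
  have dk := d_neq0 (k_neq0 nk) ck; have [dV nd] := norm1_inv nk ck.
  have edk : d k = conj (d g) / d g.
    by apply: (mulIf dg); rewrite divfK // -chg e cM ck mul0r add0r cgh.
  have nhE : Nrd h = - mu.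
    by rewrite /Nrd dh z0 ch -(rmorph1 iota) nrmi expr1n; ring.
  rewrite /xc ck eqxx -nuE hs_norm1 // nuE /bt ck eqxx /xc (negPf cgh0) cgh edk.
  have -> : conj (conj (d g) / d g) = d g / conj (d g) by rewrite fmorph_div conjK.
  have -> : hs (d g / conj (d g)) (d g) = hs (-1) (nrm (d g)).
    have hz := hs_conj_self dg.
    have -> : hs (-1) (nrm (d g)) = hs (-1) (d g).
      by rewrite -hs_proj ?oppr_eq0 ?oner_eq0 // rmorphN1.
    by apply: (xor_use hz); hs_solve.
  rewrite nhE; apply: (xor_use hm); apply: (xor_use hdz); hs_solveF.
have nt := nrm_neq0 dh; have hdt := hs_norm (is_norm_nrm (d h)).
have ck : c k != 0.
  have : iota (Nrd (g * h)) * c k != 0.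
    by rewrite ckE oppr_eq0 !mulf_neq0 ?fmorph_eq0 // (r_neq0 nsq er).
  by rewrite mulf_eq0 negb_or => /andP[].
have nck : nrm (c k) = - (nrm (d h) * nrm (d g) * (delta * (b * b))) / (nrm (d g) * Nrd h) ^+ 2.
  have n0 : (nrm (d g) * Nrd h) ^+ 2 != 0 by rewrite expf_neq0 ?mulf_neq0.
  have h1 := congr1 nrm ckE; rewrite (nrmM nrmE) nrmi ngh in h1.
  apply: (mulfI n0); rewrite h1 -mulN1r -(rmorphN1 iota) (nrmM nrmE) nrmi (nrmM nrmE (d h * d g)) nb (nrmM nrmE).
  by field; rewrite nh ng.
have hE : hs (c k) (iota (- nu k)) = hs (- nu k) (nrm (c k)).
  by rewrite hsC ?fmorph_eq0 // hs_proj.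
have btk : bt k (g * h) = hs (nrm (d g)) (nrm (d g) * nrm (c k)).
  rewrite /bt (negPf ck) (negPf cgh0) -e chg fmorph_eq0 (negPf dg) nk rmorph1 mul1r cgh.
  rewrite [conj (d g) * d g]mulrC -nrmE hsC ?mulf_neq0 ?fmorph_eq0 //.
  by rewrite hs_proj ?mulf_neq0 // (nrmM nrmE) (nrm_conj span conj_iota conj_r nrmE).
have nhE : Nrd h + mu = nrm (d h).
  by rewrite /Nrd ch -(rmorph1 iota) nrmi expr1n; ring.
have f1 := hs_sum nh mu0 nt nhE.
rewrite /xc (negPf ck) -nuE hE btk nuE nck expr2.
apply: (xor_use hm); apply: (xor_use hdt); apply: (xor_use f1).
hs_solveF.
Qed.

(** The left side is Kubota's formula as evaluated by [betaE], with determinants written as [Nrd].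
    The two expressions agree after expansion, diagonal entries being paired with their conjugates
    by [hs_conj_self]. *)
Lemma kubota_bt x y (x1 x2 x12 : L) : x != 0 -> y != 0 ->
  x1 = (if c x != 0 then c x / (iota (Nrd x) * iota (Nrd y)) else d x / iota (Nrd x)) ->
  x2 = xc y / iota (Nrd y) ->
  x12 = xc (x * y) / (iota (Nrd x) * iota (Nrd y)) ->
  hs x1 x2 (+) hs (- x1^-1 * x2) x12 (+)
    (if c x != 0 then false else hs (iota (Nrd y)) (d x / iota (Nrd x))) = bt x y.
Proof.
move=> x0 y0 -> -> ->; have xy0 := mulD_neq0 x0 y0.
have nx := Nrd_neq0 x0; have ny := Nrd_neq0 y0.
have inx : iota (Nrd x) != 0 by rewrite fmorph_eq0.
have iny : iota (Nrd y) != 0 by rewrite fmorph_eq0.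
rewrite /bt /xc; have cxy := cM x y; have dxy := dM x y.
have [cx|cx] := eqVneq (c x) 0 => /=.
  have dx := d_neq0 x0 cx; have cdx : conj (d x) != 0 by rewrite fmorph_eq0.
  have nE : iota (Nrd x) = d x * conj (d x) by rewrite iNrd cx mul0r mulr0 subr0.
  rewrite cx mul0r add0r in cxy; rewrite cx mulr0 mul0r add0r in dxy.
  have f := hs_conj_self dx.
  rewrite cxy dxy mulf_eq0 (negPf dx) /= nE.
  have [cy|cy] := eqVneq (c y) 0.
    have dy := d_neq0 y0 cy; have cdy : conj (d y) != 0 by rewrite fmorph_eq0.
    have nEy : iota (Nrd y) = d y * conj (d y) by rewrite iNrd cy mul0r mulr0 subr0.
    by hs_solve.
  by hs_solve.
have [cy|cy] := eqVneq (c y) 0.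
  have dy := d_neq0 y0 cy; have cdy : conj (d y) != 0 by rewrite fmorph_eq0.
  have nEy : iota (Nrd y) = d y * conj (d y) by rewrite iNrd cy mul0r mulr0 subr0.
  rewrite cy mulr0 addr0 in cxy; rewrite cxy mulf_eq0 (negPf cx) (negPf cdy) /= nEy.
  have f := hs_conj_self dy.
  by apply: (xor_use f); hs_solve.
have [cxy0|cxy0] := eqVneq (c (x * y)) 0.
  have D0 := d_neq0 xy0 cxy0; have cD0 : conj (d (x * y)) != 0 by rewrite fmorph_eq0.
  have nE : iota (Nrd x) * iota (Nrd y) = d (x * y) * conj (d (x * y)).
    by rewrite -rmorphM -NrdM iNrd cxy0 mul0r mulr0 subr0.
  have ecy : c y = - (c x * conj (d (x * y)) * (iota (Nrd x))^-1).
    have := Nrd_c_mul x y; rewrite cxy0 mulr0 => /eqP; rewrite addr_eq0 => /eqP e.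
    by apply: (mulfI inx); rewrite e; field.
  have eny : iota (Nrd y) = d (x * y) * conj (d (x * y)) * (iota (Nrd x))^-1.
    by rewrite -nE mulrAC divff // mul1r.
  rewrite ecy eny; have f := hs_conj_self D0.
  set D1 := d (x * y) in D0 cD0 f *; clearbody D1.
  by apply: (xor_use f); hs_solve.
by hs_solve.
Qed.

(** If [Nrd x = p^2 - delta q^2], the diagonal element with [d g = p + q r] has the same reduced
    norm, and the quotient has norm one. *)
Lemma norm_decomposition x : x != 0 -> is_norm delta (Nrd x) ->
  exists k g, [/\ k != 0, g != 0, x = k * g, Nrd k = 1 & c g = 0].
Proof.
move=> x0 [p [q e]]; have nx := Nrd_neq0 x0.
have [g [cg dg]] := cd_surj 0 (iota p + iota q * r).
have z0 : nrm 0 = 0 by apply/eqP; rewrite (nrm_eq0 nrmE).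
have ng : Nrd g = Nrd x by rewrite /Nrd cg dg z0 mulr0 subr0 (nrm_coord er conj_iota conj_r nrmE) -e.
have g0 : g != 0.
  apply: contra_neq nx => g0; rewrite -ng g0 /Nrd c0E d0E z0; ring.
have gu := unitD g0.
have n1 : Nrd (x * g^-1) = 1 by apply: (mulIf nx); rewrite -{1}ng -NrdM mulrVK // mul1r.
by exists (x * g^-1), g; split=> //; [apply: k_neq0 | rewrite mulrVK].
Qed.

(* With [norm_decomposition], [D^x] is the union of [D^1 E^x] and [D^1 E^x h]. *)
Lemma coset_representative : exists h, [/\ h != 0, c h = 1 \/ h = 1 &
  forall x, x != 0 -> is_norm delta (Nrd x) \/ is_norm delta (Nrd (x * h^-1))].
Proof.
case: (pselect (exists2 x, x != 0 & ~ is_norm delta (Nrd x))) => [[x x0 nx]|nex]; last first.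
  exists 1; split; [exact: oner_neq0 | by right | move=> x x0; left].
  by apply: contrapT => h; apply: nex; exists x.
have z0 : nrm 0 = 0 by apply/eqP; rewrite (nrm_eq0 nrmE).
have cx : c x != 0.
  apply/eqP => cx; apply: nx; rewrite /Nrd cx z0 mulr0 subr0; exact: is_norm_nrm.
have [g [cg dg]] := cd_surj 0 (c x)^-1.
have g0 : g != 0.
  apply/eqP => g0; move: dg; rewrite g0 d0E => /esym/eqP; rewrite invr_eq0; exact/negP.
have ng : Nrd g = nrm (d g) by rewrite /Nrd cg z0 mulr0 subr0.
have h0 := mulD_neq0 g0 x0; have nh := Nrd_neq0 h0.
(* The diagonal factor normalizes the lower left entry to 1, as [bt_diag_comm] requires, and changes
   the reduced norm only by a norm from [L]. *)
exists (g * x); split=> //; first by left; rewrite cM cg mul0r add0r dg mulVf.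
move=> y y0; case: (pselect (is_norm delta (Nrd y))) => ny; [by left|right].
have nnh : ~ is_norm delta (Nrd (g * x)).
  rewrite NrdM => h; apply: nx; apply: (is_norm_div _ h); first exact: Nrd_neq0.
  by rewrite ng; apply: is_norm_nrm.
have -> : Nrd (y * (g * x)^-1) = Nrd y * Nrd (g * x) * ((Nrd (g * x))^-1) ^+ 2.
  have e : Nrd (y * (g * x)^-1) * Nrd (g * x) = Nrd y by rewrite -NrdM mulrVK ?unitD.
  by apply: (mulIf nh); rewrite e; field.
apply: is_normM; last exact: is_norm_sqr.
by apply: idxF => //; apply: Nrd_neq0.
Qed.

Theorem cover_splits (C : numClosedFieldType) : exists s : D -> C,
  (forall x, x != 0 -> s x != 0) /\
  (forall x y, x != 0 -> y != 0 -> s (x * y) = s x * s y * (-1) ^+ bt x y).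
Proof.
pose T : Type := ({x : D | x != 0} * bool)%type.
pose V x (x0 : x != 0) a : T := (exist _ x x0, a).
pose mul (X Y : T) : T :=
  (exist _ (val X.1 * val Y.1) (mulD_neq0 (valP X.1) (valP Y.1)),
   X.2 (+) Y.2 (+) bt (val X.1) (val Y.1)).
have inv0 x : x != 0 -> x^-1 != 0 :> D by rewrite invr_eq0.
pose inv (X : T) : T := (exist _ (val X.1)^-1 (inv0 _ (valP X.1)),
   X.2 (+) bt (val X.1)^-1 (val X.1)).
pose one : T := (exist _ 1 (oner_neq0 D), false).
have Teq (X Y : T) : val X.1 = val Y.1 -> X.2 = Y.2 -> X = Y.
  by case: X Y => [X a] [Y b] /= /val_inj -> ->.
have mulA : associative mul.
  move=> [[x x0] a] [[y y0] b] [[w w0] e]; apply: Teq => /=; first by rewrite mulrA.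
  have f := bt_cocycle x0 y0 w0.
  by apply: (xor_use f); xor_solve.
have mul1 : left_id one mul by move=> X; apply: Teq; rewrite /= ?mul1r // bt1l addbF.
have mulr1' : right_id one mul by move=> X; apply: Teq; rewrite /= ?mulr1 // bt1r !addbF.
have mulVx : left_inverse one inv mul.
  move=> X; apply: Teq; rewrite /= ?mulVr ?unitD ?(valP X.1) //; xor_solve.
have mulxV : right_inverse one inv mul.
  move=> X; rewrite -[mul X _]mul1 -{1}(mulVx (inv X)) -mulA [mul (inv X) (mul _ _)]mulA.
  by rewrite mulVx mul1 mulVx.
pose G : groupType := HB.pack T
  (Choice.class ({x : D | x != 0} * bool)%type) (isGroup.Build T mulA mul1 mulr1' mulVx mulxV).
pose el x (x0 : x != 0) a : G := (exist _ x x0, a).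
pose M (X : G) := Nrd (val X.1) = 1 /\ X.2 = s1 (val X.1).
pose A (X : G) := c (val X.1) = 0.
have [h [h0 ch hrep]] := coset_representative.
pose H : G := el h h0 false.
pose z : G := el 1 (oner_neq0 D) true.
have gE (X Y : G) : (X * Y)%g = mul X Y by [].
have M1 : M 1%g by split; rewrite /= ?Nrd1 // s11.
have MM (X Y : G) : M X -> M Y -> M (X * Y)%g.
  by move=> [nX eX] [nY eY]; split; rewrite /= ?NrdM ?nX ?nY ?mulr1 // s1M // eX eY.
have Mn (X m : G) : M m -> exists2 m', M m' & (X * m = m' * X)%g.
  case: X m => [[x x0] a] [[y y0] b] [/= nm em].
  pose k := x * y / x; have ek : x * y = k * x by rewrite /k mulrVK ?unitD.
  have nk : Nrd k = 1.
    by apply: (mulIf (Nrd_neq0 x0)); rewrite -NrdM -ek NrdM nm mulr1 mul1r.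
  exists (el k (k_neq0 nk) (s1 k)); first by [].
  apply: Teq => //=; have f := s1_conj x0 nm ek.
  by rewrite em; apply: (xor_use f); xor_solve.
have MV (X : G) : M X -> M X^-1%g.
  case: X => [[x x0] a] [/= nX eX]; have nV : Nrd x^-1 = 1.
    by apply: (mulIf (Nrd_neq0 x0)); rewrite -NrdM mulVr ?unitD // Nrd1 nX mulr1.
  split=> //=; have := s1M nV nX; rewrite mulVr ?unitD // s11 => f.
  by rewrite eX; apply: (xor_use f); xor_solve.
have AA (X Y : G) : A X -> A Y -> (X * Y = Y * X)%g.
  case: X Y => [[x x0] a] [[y y0] b]; rewrite /A /= => cx cy.
  apply: Teq => /=; first exact: diag_mulC.
  by rewrite (bt_diagC x0 y0) // [a (+) _]addbC.
have hA (a : G) : A a -> exists2 m, M m & (H * a = m * (a * H))%g.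
  move=> aA; case: ch => [ch|h1]; last first.
    exists 1%g => //; rewrite mul1g; apply: AA => //.
    by rewrite /A /= h1 c1.
  case: a aA => [[g g0] a]; rewrite /A /= => cg; have gh0 := mulD_neq0 g0 h0.
  pose k := h * g / (g * h); have ek : h * g = k * (g * h) by rewrite /k mulrVK ?unitD.
  have nk : Nrd k = 1.
    by apply: (mulIf (Nrd_neq0 gh0)); rewrite -NrdM -ek !NrdM mul1r mulrC.
  exists (el k (k_neq0 nk) (s1 k)); first by [].
  apply: Teq => //=; have f := bt_diag_comm h0 g0 ch cg ek.
  by apply: (xor_use f); xor_solve.
have gen (X : G) : exists m a, [/\ M m, A a & (X = m * a \/ X = m * a * H)%g].
  case: X => [[x x0] a]; case: (hrep _ x0) => [nX|nX].
    have [k [g [k0 g0 e nk cg]]] := norm_decomposition x0 nX.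
    exists (el k k0 (s1 k)), (el g g0 (a (+) s1 k (+) bt k g)); split=> //.
    by left; apply: Teq => //=; xor_solve.
  have xh0 : x * h^-1 != 0 by rewrite mulD_neq0 // invr_eq0.
  have [k [g [k0 g0 e nk cg]]] := norm_decomposition xh0 nX.
  exists (el k k0 (s1 k)), (el g g0 (a (+) s1 k (+) bt k g (+) bt (k * g) h)); split=> //.
  right; apply: Teq => //=; first by rewrite -e mulrVK ?unitD.
  by xor_solve.
have zz : (z * z = 1)%g by apply: Teq => /=; rewrite ?mulr1 // bt1l.
have zC (X : G) : (X * z = z * X)%g.
  by apply: Teq => /=; rewrite ?mulr1 ?mul1r // bt1l bt1r !addbF addbC.
have nMz : ~ M z by case=> _ /=; rewrite s11.
have Mcomm := commutator_criterion M1 MM MV Mn AA hA gen.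
have [phi [phi0 phiM phiz]] := character_extension C M1 MM MV Mcomm zz zC nMz.
(* The character restricted to the section [(x, 0)] of the cover; the value 1 at [x = 0] is a
   placeholder. *)
pose s x : C := if @insub _ (fun x : D => x != 0) _ x is Some X then phi (X, false) else 1.
have sE x (x0 : x != 0) : s x = phi (el x x0 false).
  by rewrite /s insubT.
exists s; split=> [x x0|x y x0 y0]; first by rewrite sE.
rewrite (sE _ x0) (sE _ y0) (sE _ (mulD_neq0 x0 y0)) -phiM.
have -> : (el x x0 false * el y y0 false)%g = (el (x * y)%R (mulD_neq0 x0 y0) (bt x y)).
  by apply: Teq.
case: (bt x y); rewrite ?expr0 ?mulr1 // expr1 -phiz -phiM.
by congr phi; apply: Teq => /=; rewrite ?mulr1 // bt1r.
Qed.

End QuaternionGroup.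
End Cover.

(** * Matrices *)

Lemma complete_square (F L : fieldType) (iota : {rmorphism F -> L}) (x : L) :
  (2%:R : F) != 0 -> (forall a, x != iota a) ->
  (forall z, exists a b, z = iota a + iota b * x) -> exists (delta : F) (r : L),
  [/\ forall c, delta != c ^+ 2, r ^+ 2 = iota delta &
      forall z, exists a b, z = iota a + iota b * r].
Proof.
move=> n2 nx sp; have [a [b e]] := sp (x ^+ 2); pose h := b / 2%:R.
have eb : b = 2%:R * h by rewrite mulrCA divff // mulr1.
have er : (x - iota h) ^+ 2 = iota (a + h ^+ 2).
  by rewrite sqrrB e eb; clearbody h; ring.
exists (a + h ^+ 2), (x - iota h); split=> //.
- move=> c; apply/eqP => ec; move: er; rewrite ec rmorphXn => /eqP.
  rewrite eqf_sqr => /orP [] /eqP f.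
    by case/eqP: (nx (c + h)); rewrite rmorphD -f subrK.
  by case/eqP: (nx (h - c)); rewrite rmorphB -f; ring.
- move=> z; have [a' [b' ->]] := sp z.
  by exists (a' + b' * h), b'; rewrite rmorphD rmorphM; ring.
Qed.

Lemma quadratic_generator (F : fieldType) (E : fieldExtType F) :
  (2%:R : F) != 0 -> \dim {:E} = 2%N -> exists (delta : F) (r : E),
  [/\ forall c, delta != c ^+ 2, r ^+ 2 = in_alg E delta &
      forall z, exists a b, z = in_alg E a + in_alg E b * r].
Proof.
move=> n2 dE.
have [x nx] : exists x : E, x \notin 1%VS.
  apply: contrapT => h.
  have : ({:E} <= 1)%VS.
    by apply/subvP => x _; apply: contrapT => nx; apply: h; exists x; apply/negP.
  by move/dimvS; rewrite dE dimv1.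
have fr : free [:: x; 1].
  by rewrite free_cons span_seq1 nx seq1_free oner_neq0.
apply: (@complete_square F E (in_alg E) x) => //.
  by move=> a; apply: contraNneq nx => ->; rewrite /= memvZ // mem1v.
move=> z; have : z \in <<[:: x; 1%R]>>%VS.
  have /eqP -> : <<[:: x; 1%R]>>%VS == {:E}%VS; last exact: memvf.
  by rewrite eqEdim subvf dE (eqP fr).
rewrite span_cons span_seq1 => /memv_addP [_ /vlineP [b ->] [_ /vlineP [a ->] ->]].
by exists a, b; rewrite /= addrC mulr_algl.
Qed.

(** * Kubota's cocycle in terms of bottom rows and determinants *)

Section MatrixCocycle.
Variable E : fieldType.
Implicit Types (g h : 'M[E]_2) (y : E).

Lemma diag1_mulE y g i j : (diag1 y *m g) i j = (if i == 0 then 1 else y) * g i j.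
Proof. by rewrite mul_diag_mx !mxE. Qed.

Lemma conjy_entry y g i j :
  conjy y g i j = (if i == 0 then 1 else y^-1) * g i j * (if j == 0 then 1 else y).
Proof. by rewrite /conjy mul_mx_diag mxE diag1_mulE !mxE. Qed.

Lemma conjy_pg_mul g h : \det h != 0 ->
  conjy (\det h) (pg g) *m pg h = diag1 (\det g * \det h)^-1 *m (g *m h).
Proof.
move=> h0; rewrite /conjy /pg.
have dM a b : diag1 a *m diag1 b = diag1 (a * b) :> 'M[E]_2.
  rewrite mulmx_diag; congr diag_mx; apply/rowP => i; rewrite !mxE.
  by case: (i == 0); rewrite ?mul1r.
have d1 : diag1 1 = 1%:M :> 'M[E]_2.
  by rewrite -diag_const_mx; congr diag_mx; apply/rowP => i; rewrite !mxE; case: (i == 0).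
by rewrite -!mulmxA [diag1 (\det h) *m _]mulmxA dM divff // d1 mul1mx !mulmxA dM invfM [_ * (\det g)^-1]mulrC.
Qed.

(** Only bottom rows and determinants enter: [p] divides the bottom row by the determinant, and
    conjugation by [diag(1, det h)] divides the lower left entry by [det h] while keeping the lower
    right one. *)
Lemma betaE g h : \det g != 0 -> \det h != 0 ->
  let x1 := if g 1 0 != 0 then g 1 0 / (\det g * \det h) else g 1 1 / \det g in
  let x2 := xg h / \det h in
  let x12 := xg (g *m h) / (\det g * \det h) in
  beta g h = hilbert x1 x2 * hilbert (- x1^-1 * x2) x12 *
    (if g 1 0 != 0 then 1 else hilbert (\det h) (g 1 1 / \det g)).
Proof.
move=> g0 h0 x1 x2 x12; rewrite /beta /beta_SL conjy_pg_mul //.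
have xgd y k : y != 0 -> xg (diag1 y^-1 *m k) = xg k / y.
  by move=> y0; rewrite /xg !diag1_mulE /= mulf_eq0 invr_eq0 (negPf y0) /=; case: ifP => _; rewrite mulrC.
rewrite /pg !xgd ?mulf_neq0 //.
rewrite /vyg !diag1_mulE /= mulf_eq0 invr_eq0 (negPf g0) /= [_ * g 1 1]mulrC.
have -> // : xg (conjy (\det h) (diag1 (\det g)^-1 *m g)) = x1.
rewrite /xg !conjy_entry !diag1_mulE /= !mulf_eq0 !invr_eq0 (negPf g0) (negPf h0) oner_eq0 /= orbF /x1.
by case: eqVneq => _ /=; field; rewrite ?g0 ?h0.
Qed.
End MatrixCocycle.

Section BaseField.
Variables (F L : fieldType) (iota : {rmorphism F -> L}).
Hypothesis split : forall a b : F, hilbert (iota a) (iota b) = 1.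

Lemma beta_base_field (g h : 'M[F]_2) : beta (map_mx iota g) (map_mx iota h) = 1.
Proof.
have dg y : diag1 (iota y) = map_mx iota (diag1 y).
  apply/matrixP => i j; rewrite !mxE rmorphMn /=.
  by case: (i == 0) => //; rewrite rmorph1.
have pgm k : pg (map_mx iota k) = map_mx iota (pg k).
  by rewrite /pg det_map_mx -fmorphV dg -map_mxM.
have conjm y k : conjy (iota y) (map_mx iota k) = map_mx iota (conjy y k).
  by rewrite /conjy -fmorphV !dg -!map_mxM.
have xgm k : xg (map_mx iota k) = iota (xg k).
  by rewrite /xg !mxE fmorph_eq0; case: ifP.
rewrite /beta /beta_SL /vyg !pgm det_map_mx conjm -map_mxM !xgm !mxE.
by rewrite -fmorphV -rmorphN -rmorphM !split !mul1r; case: ifP.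
Qed.
End BaseField.

Lemma mulmx2E (R : pzRingType) (A B : 'M[R]_2) i j :
  (A *m B) i j = A i 0 * B 0 j + A i 1 * B 1 j.
Proof. by rewrite mxE !big_ord_recl big_ord0 addr0; congr (_ + _ * _); congr fun_of_matrix; apply/val_inj. Qed.

Lemma matrix2_eq (R : Type) (A B : 'M[R]_2) :
  A 0 0 = B 0 0 -> A 0 1 = B 0 1 -> A 1 0 = B 1 0 -> A 1 1 = B 1 1 -> A = B.
Proof.
move=> e00 e01 e10 e11; apply/matrixP.
have cases (i : 'I_2) : i = 0 \/ i = 1.
  by case: i => [[|[|]]] // h; [left|right]; apply/val_inj.
by move=> i j; case: (cases i) => ->; case: (cases j) => ->.
Qed.

Lemma det_mx2 (R : comPzRingType) (A : 'M[R]_2) : \det A = A 0 0 * A 1 1 - A 0 1 * A 1 0.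
Proof.
rewrite (expand_det_row _ 0) !big_ord_recl big_ord0 addr0 /cofactor !det_mx11 !mxE /=.
have -> : lift (0 : 'I_2) 0 = 1 by apply/val_inj.
have -> : lift (1 : 'I_2) 0 = 0 by apply/val_inj.
by rewrite expr0 mul1r expr1 mulN1r mulrN.
Qed.

(** * Standard form of an embedding of [D] into 2 by 2 matrices *)

Section QuaternionCoordinates.
Variables (F L : fieldType) (iota : {rmorphism F -> L}) (delta : F) (r : L).
Variable conj : {rmorphism L -> L}.
Hypothesis n2 : (2%:R : F) != 0.
Hypothesis nsq : forall c, delta != c ^+ 2.
Hypothesis er : r ^+ 2 = iota delta.
Hypothesis span : forall z, exists a b, z = iota a + iota b * r.
Hypothesis conj_iota : forall a, conj (iota a) = iota a.
Hypothesis conj_r : conj r = - r.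
Variables (D : falgType F) (phi : D -> 'M[L]_2).
Hypothesis unitD : forall x : D, x != 0 -> x \is a GRing.unit.
Hypothesis center : forall x : D, (forall y, x * y = y * x) -> exists a, x = a%:A.
Hypothesis phiD : forall x y, phi (x + y) = phi x + phi y.
Hypothesis phiM : forall x y, phi (x * y) = phi x *m phi y.
Hypothesis phi1 : phi 1 = 1%:M.
Hypothesis phiZ : forall a x, phi (a *: x) = iota a *: phi x.
Hypothesis bottom_surj : forall a b, exists x, phi x 1 0 = a /\ phi x 1 1 = b.

Let n2L : (2%:R : L) != 0. Proof. by rewrite -(rmorph_nat iota) fmorph_eq0. Qed.
Let r0 : r != 0.
Proof. by rewrite -sqrf_eq0 er fmorph_eq0; have := nsq 0; rewrite expr0n. Qed.

Let phi0 : phi 0 = 0.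
Proof. by apply: (addrI (phi 0)); rewrite -phiD !addr0. Qed.

Let phiN x : phi (- x) = - phi x.
Proof. by apply/eqP; rewrite -addr_eq0 -phiD addNr phi0. Qed.

Lemma det_phi_neq0 x : x != 0 -> \det (phi x) != 0.
Proof.
move=> x0; have : \det (phi x) * \det (phi x^-1) = 1.
  by rewrite -det_mulmx -phiM mulrV ?unitD // phi1 det1.
by apply: contra_eq_neq => ->; rewrite mul0r eq_sym oner_neq0.
Qed.

Lemma phi_eq0 x : phi x 1 0 = 0 -> phi x 1 1 = 0 -> x = 0.
Proof.
move=> x10 x11; apply: contraTeq isT => /unitD ux.
have : phi (x * x^-1) 1 1 = 1 by rewrite mulrV // phi1 mxE.
by rewrite phiM mulmx2E x10 x11 !mul0r addr0 => /esym/eqP; rewrite oner_eq0.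
Qed.

Lemma phi_bottom_inj x y : phi x 1 0 = phi y 1 0 -> phi x 1 1 = phi y 1 1 -> x = y.
Proof.
move=> e0 e1; apply/eqP; rewrite -subr_eq0; apply/eqP.
by apply: phi_eq0; rewrite phiD phiN !mxE ?e0 ?e1 subrr.
Qed.

Lemma phi_scalar x z : phi x = z%:M -> exists a, x = a%:A.
Proof.
move=> e; apply: center => y; apply: phi_bottom_inj; rewrite !phiM e mul_scalar_mx mul_mx_scalar //.
Qed.

Lemma phi_alg a : phi a%:A = (iota a)%:M.
Proof. by rewrite phiZ phi1 scalemx1. Qed.

(** The standard form conjugated back by a unipotent upper triangular matrix with parameter [t].
    This conjugation keeps the lower left entry, and keeps the lower right one when the former
    vanishes, so [xg] of [phi x] itself can be read off from [c] and [d]. *)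
Lemma quaternion_coordinates : exists mu t, forall x,
  let c := phi x 1 0 in let d := phi x 1 1 - t * c in
  phi x 0 0 = conj d - c * t /\
  phi x 0 1 = (conj d - d) * t + conj c * iota mu - c * t ^+ 2.
Proof.
have addE (A B : 'M[L]_2) i k : (A + B) i k = A i k + B i k by rewrite mxE.
have [j [j10 j11]] := bottom_surj 0 r.
have jj : j * j = delta%:A.
  by apply: phi_bottom_inj; rewrite phiM phi_alg !mulmx2E j10 j11 !mxE /= ?mulr0n ?mulr1n -?er; ring.
have j00 : phi j 0 0 = - r.
  have := congr1 (fun x => phi x 0 0) jj; rewrite phiM phi_alg mulmx2E j10 mulr0 addr0 !mxE /= mulr1n -er -expr2.
  move/eqP; rewrite eqf_sqr => /orP [] /eqP // e00.
  (* If both diagonal entries were [r], then [j^2 = delta] would make [phi j] scalar, so [j] would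
     be central and [r] would lie in [F]. *)
  have := congr1 (fun x => phi x 0 1) jj; rewrite phiM phi_alg mulmx2E j11 e00 !mxE /= mulr0n => /eqP.
  rewrite [r * _]mulrC -mulrDr mulf_eq0 -mulr2n -mulr_natr mulf_eq0 (negPf r0) (negPf n2L) !orbF => /eqP j01.
  have /phi_scalar [a ea] : phi j = r%:M by apply: matrix2_eq; rewrite ?e00 ?j01 ?j10 ?j11 !mxE.
  have ra : r = iota a by rewrite -j11 ea phi_alg !mxE.
  by case/eqP: (nsq a); apply: (fmorph_inj iota); rewrite rmorphXn -er ra.
(* Chosen so that the unipotent conjugation diagonalizes [phi j]; the element [w] with bottom row
   [(1, t)] then anticommutes with [j]. *)
set k := phi j 0 1; pose t := - k / (2%:R * r).
have kE : k = - 2%:R * r * t by rewrite /t; field; rewrite n2L r0.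
have [w [w10 w11]] := bottom_surj 1 t.
have wj : w * j = - (j * w).
  by apply: phi_bottom_inj; rewrite phiN !phiM [RHS]mxE !mulmx2E j10 j11 w10 w11 -/k ?j00 ?kE; ring.
(* Since [w] anticommutes with [j], its square commutes with [j]; the lower left entry of this
   relation says that [phi w] has trace zero, so that [w^2] is scalar. *)
have w00 : phi w 0 0 = - t.
  have : (w * w) * j = j * (w * w) by rewrite -mulrA wj mulrN [w * (j * w)]mulrA wj mulNr opprK mulrA.
  move/(congr1 (fun x => phi x 1 0)); rewrite !phiM !mulmx2E j00 j10 j11 w10 w11.
  move=> e; have : 2%:R * r * (phi w 0 0 + t) = 0.
    move: e => /eqP; rewrite -subr_eq0 => /eqP e; rewrite -[RHS]oppr0 -[X in - X]e; ring.
  by move/eqP; rewrite !mulf_eq0 (negPf n2L) (negPf r0) /= addr_eq0 => /eqP.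
have [mu emu] : exists mu, w * w = mu%:A.
  apply: (@phi_scalar _ (phi w 0 1 + t ^+ 2)); rewrite phiM.
  by apply: matrix2_eq; rewrite !mulmx2E [RHS]mxE ?w00 ?w10 ?w11 /= ?mulr0n ?mulr1n; ring.
have w01 : phi w 0 1 = iota mu - t ^+ 2.
  have := congr1 (fun x => phi x 1 1) emu.
  by rewrite phiM phi_alg mulmx2E w10 w11 [RHS]mxE /= mulr1n => <-; ring.
have diag z : exists y, [/\ phi y 0 0 = conj z, phi y 0 1 = (conj z - z) * t,
    phi y 1 0 = 0 & phi y 1 1 = z].
  have [a [b ->]] := span z; exists (a%:A + b *: j).
  rewrite phiD phi_alg phiZ !mxE j00 j10 j11 -/k kE /= rmorphD rmorphM !conj_iota conj_r.
  by split; ring.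
exists mu, t => x c d.
have [y [y00 y01 y10 y11]] := diag d; have [z [z00 z01 z10 z11]] := diag c.
have -> : x = y + z * w.
  apply: phi_bottom_inj; rewrite phiD phiM !addE !mulmx2E ?y10 ?y11 z10 z11 ?w10 ?w11 -/c.
    by ring.
  by rewrite /d; ring.
by rewrite phiD phiM !addE !mulmx2E y00 y01 z00 z01 w00 w01 w10 w11; split; ring.
Qed.
End QuaternionCoordinates.

(** A matrix with zero bottom row is singular, so taking bottom rows is injective on the division
    algebra, and both sides have dimension 4 over [F]. *)
Lemma bottom_row_surj (F : fieldType) (E : fieldExtType F) (D : falgType F)
    (phi : D -> 'M[E]_2) : \dim {:E} = 2%N -> \dim {:D} = 4%N ->
  (forall x : D, x != 0 -> x \is a GRing.unit) -> Falg_hom phi ->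
  forall a b, exists x, phi x 1 0 = a /\ phi x 1 1 = b.
Proof.
move=> dE dD unitD [phiD phiM phi1 phiZ] a b.
pose f x : (E * E)%type := (phi x 1 0, phi x 1 1).
have fl : linear f.
  move=> k x y; rewrite /f phiD phiZ !mxE; congr pair; by rewrite /= mulr_algl.
pose f' := GRing.isLinear.Build F D (E * E)%type _ f fl.
pose fL : {linear D -> (E * E)%type} := HB.pack f f'.
pose g := linfun fL.
have ker : lker g == 0%VS.
  apply/lker0P => x y; rewrite !lfunE => -[e0 e1].
  exact: (phi_bottom_inj unitD phiD phiM phi1).
have lim : limg g = fullv.
  have dl : \dim (limg g) = \dim {:D} by apply: limg_dim_eq; rewrite (eqP ker) capv0.
  have dEE : \dim {: (E * E)%type} = (\dim {:E} + \dim {:E})%N by rewrite !dimvf.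
  by apply/eqP; rewrite eqEdim subvf dl dD dEE dE.
have : (a, b) \in limg g by rewrite lim memvf.
by case/memv_imgP => x _; rewrite lfunE => -[-> ->]; exists x.
Qed.

(** * Assembly of the two splittings *)

Section Splitting.
Variables (F : fieldType) (E : fieldExtType F).
Hypothesis locF : nonarch_local_field_char0 F.
Hypothesis dE : \dim {:E} = 2%N.

Lemma quaternion_splitting (C : numClosedFieldType) (D : falgType F) (phi : D -> 'M[E]_2) :
  quaternion_division_algebra D -> Falg_hom phi ->
  exists s : D -> C,
    (forall x, x != 0 -> s x != 0) /\
    (forall x y, x != 0 -> y != 0 ->
       s (x * y) = s x * s y * (beta (phi x) (phi y))%:~R).
Proof.
move=> [dD unitD center] hphi.
have surj := bottom_row_surj dE dD unitD hphi.
have [phiD phiM phi1 phiZ] := hphi.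
have [chF [v [vP vcompl vfin]]] := locF.
have n2 : (2%:R : F) != 0 by have := chF 2%N; rewrite !inE => /negbT.
have [delta [r [nsq er span]]] := quadratic_generator n2 dE.
have [conj [conj_iota conj_r]] := quadratic_conj nsq er span.
have [nrm nrmE] := norm_exists er span conj_iota conj_r.
have locE := nonarch_local_field_ext n2 nsq er span conj_iota conj_r nrmE vP vcompl vfin chF.
have idxF := local_index2 locF; have idxE := local_index2 locE.
have split := is_norm_quadratic_ext vP vcompl vfin n2 nsq er.
have n2E : (2%:R : E) != 0 by rewrite -(rmorph_nat (in_alg E)) fmorph_eq0.
have [mu [t coord]] := quaternion_coordinates n2 nsq er span conj_iota conj_r
   unitD center phiD phiM phi1 phiZ surj.
pose c x := phi x 1 0; pose d x := phi x 1 1 - t * c x.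
have p11 x : phi x 1 1 = d x + t * c x by rewrite /d subrK.
have addE (A B : 'M[E]_2) i k : (A + B) i k = A i k + B i k by rewrite mxE.
have phiN x : phi (- x) = - phi x by rewrite -[in LHS]scaleN1r phiZ !scaleN1r.
have cB x y : c (x - y) = c x - c y by rewrite /c phiD phiN !mxE.
have dB x y : d (x - y) = d x - d y by rewrite /d cB phiD phiN !mxE; ring.
have cM x y : c (x * y) = c x * conj (d y) + d x * c y.
  by rewrite /c phiM mulmx2E (coord y).1 -/(c x) -/(c y) -/(d y) p11; ring.
have dM x y : d (x * y) = in_alg E mu * c x * conj (c y) + d x * d y.
  rewrite {1}/d cM phiM mulmx2E (coord y).2 -/(c x) -/(c y) -/(d y) !p11; ring.
have detE x : \det (phi x) = d x * conj (d x) - in_alg E mu * (c x * conj (c x)).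
  rewrite det_mx2 (coord x).1 (coord x).2 -/(c x) -/(d x) p11; ring.
have c1 : c 1 = 0 by rewrite /c phi1 mxE.
have d1 : d 1 = 1 by rewrite /d c1 phi1 mxE mulr0 subr0.
have cd_inj x y : c x = c y -> d x = d y -> x = y.
  move=> ec ed; apply: (phi_bottom_inj unitD phiD phiM phi1) => //.
  by rewrite !p11 ec ed.
have cd_surj a b : exists x, c x = a /\ d x = b.
  have [x [xa xb]] := surj a (b + t * a); exists x; split=> //.
  by rewrite /d xb /c xa addrK.
have detN x : in_alg E (nrm (d x) - mu * nrm (c x)) = \det (phi x).
  by rewrite rmorphB rmorphM !nrmE detE.
have nonsing x : c x = 1 -> nrm (d x) - mu != 0.
  move=> cx; have x0 : x != 0.
    by apply: contra_eq_neq cx => ->; rewrite -(subrr 1) cB subrr eq_sym oner_neq0.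
  have := det_phi_neq0 unitD phiM phi1 x0; rewrite -detN fmorph_eq0.
  have -> : nrm (c x) = 1 by apply: (fmorph_inj (in_alg E)); rewrite nrmE cx !rmorph1 mul1r.
  by rewrite mulr1.
have mu0 : mu != 0.
  have [x [cx dx]] := cd_surj 1 0; have := nonsing x cx.
  have -> : nrm (d x) = 0 by apply: (fmorph_inj (in_alg E)); rewrite nrmE dx mul0r rmorph0.
  by rewrite sub0r oppr_eq0.
(* If [mu = p^2 - delta q^2], the nonzero element with [c = 1] and [d = p + q r] would have
   determinant zero. *)
have mu_nonnorm : hs delta mu = true.
  rewrite /hs; apply/asboolPn => -[p [q e]].
  have [x [cx dx]] := cd_surj 1 (in_alg E p + in_alg E q * r); have := nonsing x cx.
  by rewrite dx (nrm_coord er conj_iota conj_r nrmE) -e subrr eqxx.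
have [s [s0 sM]] := cover_splits n2 nsq er span conj_iota conj_r nrmE idxF idxE split
  unitD cB dB cM dM c1 d1 cd_inj cd_surj mu_nonnorm mu0 chF C.
exists s; split=> // x y x0 y0; rewrite sM //; congr (_ * _).
have xy0 := mulD_neq0 unitD x0 y0.
have detx := det_phi_neq0 unitD phiM phi1 x0.
have dety := det_phi_neq0 unitD phiM phi1 y0.
have NE z : (in_alg E : {rmorphism F -> E}) (Nrd nrm mu c d z) = \det (phi z) := detN z.
have xgE z : xg (phi z) = xc c d z.
  by rewrite /xg /xc -/(c z); case: eqVneq => //= cz; rewrite p11 cz mulr0 addr0.
have xcn z : z != 0 -> xc c d z != 0 by apply: (xc_neq0 cB dB cd_inj).
suff -> : beta (phi x) (phi y) = (-1) ^+ bt (in_alg E) conj nrm mu c d x y.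
  by rewrite rmorph_sign.
have := kubota_bt n2 er span conj_iota conj_r nrmE idxE split unitD cB dB cM dM cd_inj
  mu_nonnorm x0 y0 (erefl _) (erefl _) (erefl _).
rewrite !NE => <-; rewrite betaE // -/(c x) -phiM !xgE.
have -> : phi x 1 1 / \det (phi x) = (if c x != 0 then phi x 1 1 else d x) / \det (phi x).
  by case: eqVneq => //= cx; rewrite p11 cx mulr0 addr0.
have nz (a b : E) : a != 0 -> b != 0 -> a / b != 0 by move=> a0 b0; rewrite mulf_neq0 ?invr_neq0.
have hsE (a b e : E) : a != 0 -> b != 0 -> e != 0 ->
    hilbert a b * hilbert (- a^-1 * b) e = (-1) ^+ (hs a b (+) hs (- a^-1 * b) e).
  move=> a0 b0 e0; rewrite signr_addb !hilbertE //.
  by rewrite mulf_neq0 // oppr_eq0 invr_neq0.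
have dxy0 := mulf_neq0 detx dety.
have [cx|cx] /= := eqVneq (c x) 0; last by rewrite hsE ?nz ?xcn // mulr1 addbF.
have dx : d x != 0 by apply: (d_neq0 cB dB cd_inj x0).
by rewrite hsE ?nz ?xcn // hilbertE ?nz // [RHS]signr_addb.
Qed.
End Splitting.

Theorem theorem3p1 (F : fieldType) (E : fieldExtType F) (R : realType) :
  nonarch_local_field_char0 F ->
  \dim {:E} = 2%N ->
  (* (1) the twofold metaplectic cover splits over GL_2(F) *)
  (exists s : 'M[F]_2 -> int,
     (forall g, g \in unitmx -> s g = 1 \/ s g = -1) /\
     (forall g1 g2, g1 \in unitmx -> g2 \in unitmx ->
        s (g1 *m g2) = s g1 * s g2 *
          beta (map_mx (fun a : F => a%:A : E) g1)
               (map_mx (fun a : F => a%:A : E) g2)))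
  /\
  (* (2) the C^x-covering splits over D_F^x, for the quaternion division
     algebra D over F embedded in GL_2(E) by an F-algebra map phi *)
  (forall (D : falgType F) (phi : D -> 'M[E]_2),
     quaternion_division_algebra D -> Falg_hom phi ->
     exists s : D -> R[i],
       (forall d, d != 0 -> s d != 0) /\
       (forall d1 d2, d1 != 0 -> d2 != 0 ->
          s (d1 * d2) = s d1 * s d2 * (beta (phi d1) (phi d2))%:~R)).
Proof.
move=> locF dE; split; last by move=> D phi; apply: quaternion_splitting.
exists (fun=> 1); split=> [|g1 g2 _ _]; first by left.
rewrite !mul1r (beta_base_field (iota := in_alg E)) // => a b.
have [chF [v [vP vcompl vfin]]] := locF.
have n2 : (2%:R : F) != 0 by have := chF 2%N; rewrite !inE => /negbT.
have n2E : (2%:R : E) != 0 by rewrite -(rmorph_nat (in_alg E)) fmorph_eq0.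
have [delta [r [nsq er span]]] := quadratic_generator n2 dE.
(* [beta_base_field] ranges over all matrices, so it asks for the symbol at zero arguments too,
   where [hilbert] is 1 by its definition. *)
have [->|a0] := eqVneq a 0; first by rewrite rmorph0 hilbert0l.
have [->|b0] := eqVneq b 0; first by rewrite rmorph0 hilbert0r.
rewrite hilbertE ?fmorph_eq0 // /hs.
have := is_norm_quadratic_ext vP vcompl vfin n2 nsq er a0 b0.
by move/asboolT => ->.
Qed.
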